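(* Let $Y(u)\in\mathbb{R}^m_{>0}$, $u\in[0,\infty)$, be a nonconstant solution of $\frac{dY_i}{du}=-Y_iF_i(Y)$, $1\le i\le m$, with $\lim_{u\to\infty}Y(u)=\xi$, and let $g_{a,\vec b}(\tau)$, $\tau\in[0,\infty)$, be the corresponding ancient solution of the Ricci flow on the circle bundle $P_Q$. Then: (i) $g_{a,\vec b}(\tau)$ is of type I as $\tau\to\infty$, i.e., there is a constant $C<\infty$ such that for $\tau$ large $$\tau\cdot\sup_{x\in P_Q}|\mathrm{Rm}_{g_{a,\vec b}(\tau)}(x)|_{g_{a,\vec b}(\tau)}\le C;$$ (ii) there is a $\kappa>0$ so that the solution $g_{a,\vec b}(\tau)$ is $\kappa$-noncollapsed at all scales.
   Context: For $1\le i\le m$, $(M_i,g_i)$ is a compact Kähler–Einstein manifold of complex dimension $n_i$, $\mathrm{Rc}(g_i)=p_ig_i$ with $p_i$ a positive integer, with Kähler form $\omega_i$, scaled so that $\frac1{2\pi}[\omega_i]$ is integral and represents a torsion-free indivisible class in $H^2(M_i,\mathbb{Z})$. Let $q_1,\dots,q_m$ be nonzero integers and $P_Q\to M_1\times\cdots\times M_m$ the principal circle bundle with Euler class $\frac1{2\pi}\sum_iq_i[\omega_i]$, with principal connection $\sigma$ of curvature form $d\sigma=\sum_iq_i\omega_i$. Consider metrics $g_{a,\vec b}(\tau)=a(\tau)\,\sigma\otimes\sigma+\sum_ib_i(\tau)g_i$, $a,b_i>0$ ($g_i$ pulled back). With $\tau=-t$ the backwards Ricci flow for $g_{a,\vec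 b}(\tau)$ is $$\frac{da}{d\tau}=\sum_{i}n_iq_i^2\frac{a^2}{b_i^2},\qquad \frac{db_i}{d\tau}=2p_i-q_i^2\frac{a}{b_i}.$$ An ancient solution is one existing for all $t\in(-\infty,T)$ for some finite $T$. Put $Y_i=a/b_i$, $u=\int_0^\tau\frac{d\zeta}{a(\zeta)}$, $E(Y)=\sum_in_iq_i^2Y_i^2$, $F_i(Y)=2p_iY_i-q_i^2Y_i^2-E(Y)$. Then the flow becomes $\frac{d\ln a}{du}=E(Y)$, $\frac{dY_i}{du}=-Y_iF_i(Y)$. Conversely, a solution $Y(u)\in\mathbb{R}^m_{>0}$ and a choice of $a(0)>0$ determine the corresponding $g_{a,\vec b}(\tau)$ by $a(u)=a(0)\exp\int_0^uE(Y(\zeta))d\zeta$, $\tau(u)=\int_0^ua(\zeta)d\zeta$, $b_i=a/Y_i$. $\xi\in\mathbb{R}^m_{>0}$ is the unique point with $\xi_i>0$ and $F_i(\xi)=0$ for all $i$. If $Y(u)\to\xi$ as $u\to\infty$, then the corresponding $g_{a,\vec b}(\tau)$ is an ancient solution, defined for all $\tau\ge0$; modulo translation in $u$ the nonconstant such $Y$ form a $C^0$-family with $m-2$ parameters. $\kappa$-noncollapsed at all scales is meant in Perelman's sense: for every time, point $x$ and radius $\rho>0$, if $|\mathrm{Rm}|\le\rho^{-2}$ on the ball $B(x,\rho)$ then $\mathrm{Vol}\,B(x,\rho)\ge\kappa\rho^{\dim P_Q}$. *)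

(* Defs.v *)
From HB Require Import structures.
From mathcomp Require Import all_boot all_order all_algebra.
From mathcomp Require Import all_classical all_reals all_analysis.

Set Implicit Arguments.
Unset Strict Implicit.
Unset Printing Implicit Defensive.

Import Order.TTheory GRing.Theory Num.Theory.
Import numFieldNormedType.Exports.

Local Open Scope classical_set_scope.
Local Open Scope ring_scope.

(* Vectors are rows, so a linear map is a matrix acting on the right and the
   Jacobian has entry (i, j) equal to the i-th partial derivative of the j-th
   component. *)

Section Calculus.
Context {R : realType}.

Definition partial {d : nat} (i : 'I_d) (f : 'rV[R]_d -> R) : 'rV[R]_d -> R :=
  fun x => 'D_(delta_mx 0 i) f x.

Fixpoint Ck {d : nat} (k : nat) (U : set 'rV[R]_d) (f : 'rV[R]_d -> R) : Prop :=
  (forall x, U x -> {for x, continuous f}) /\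
  match k with
  | 0%N => True
  | k'.+1 => forall i, (forall x, U x -> derivable f x (delta_mx 0 i)) /\
                       Ck k' U (partial i f)
  end.

Definition smooth_fun {d : nat} (U : set 'rV[R]_d) (f : 'rV[R]_d -> R) : Prop :=
  forall k, Ck k U f.

Definition smooth_vfun {d e : nat} (U : set 'rV[R]_d)
    (f : 'rV[R]_d -> 'rV[R]_e) : Prop :=
  forall j, smooth_fun U (fun x => f x 0 j).

Definition jac {d e : nat} (f : 'rV[R]_d -> 'rV[R]_e) (x : 'rV[R]_d) :
    'M[R]_(d, e) :=
  \matrix_(i, j) partial i (fun y => f y 0 j) x.

(* Integral against Lebesgue measure on R^d as an iterated integral (Tonelli);
   only used for nonnegative Borel functions. *)
Fixpoint iter_integral (d : nat) : ('rV[R]_d -> \bar R) -> \bar R :=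
  match d with
  | 0%N => fun f => f 0
  | d'.+1 => fun f => (\int[@lebesgue_measure R]_t
               iter_integral (fun x : 'rV[R]_d' =>
                 f (row_mx (const_mx t : 'rV[R]_1) x)))%E
  end.

Definition row2 (s t : R) : 'rV[R]_2 := \row_j (if j == 0 then s else t).

End Calculus.

(* The data of an atlas; the axioms are in [smooth_manifold].  [coord] and
   [param] are only meaningful on [dom] and on its image.  [chart_at] selects a
   chart around each point; [base] is an arbitrary point, which only serves to
   make the type of points a [pointedType]. *)
Record charted (R : realType) (d : nat) := Charted {
  carrier :> topologicalType;
  base : carrier;
  chart_index : Type;
  dom : chart_index -> set carrier;
  coord : chart_index -> carrier -> 'rV[R]_d;
  param : chart_index -> 'rV[R]_d -> carrier;
  chart_at : carrier -> chart_index
}.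
Arguments base {R d} c.
Arguments chart_index {R d} c.
Arguments dom {R d c} _ _.
Arguments coord {R d c} _ _.
Arguments param {R d c} _ _.
Arguments chart_at {R d c} _.

Section Manifolds.
Context {R : realType}.

Definition img {d : nat} {M : charted R d} (al : chart_index M) :
    set 'rV[R]_d :=
  coord al @` dom al.

Definition coord_rep {d e : nat} {M : charted R d} {N : charted R e}
    (f : M -> N) (al : chart_index M) (be : chart_index N) :
    'rV[R]_d -> 'rV[R]_e :=
  fun x => coord be (f (param al x)).

Definition smooth_map {d e : nat} {M : charted R d} {N : charted R e}
    (W : set M) (f : M -> N) : Prop :=
  (forall p, W p -> {for p, continuous f}) /\
  forall (al : chart_index M) (be : chart_index N),
    smooth_vfun [set x | [/\ img al x, W (param al x)
                           & dom be (f (param al x))]]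
                (coord_rep f al be).

(* The last clause is the smoothness of all coordinate changes. *)
Definition smooth_manifold {d : nat} (M : charted R d) : Prop :=
  [/\ hausdorff_space M, @second_countable M,
      forall p : M, dom (chart_at p) p,
      (forall al : chart_index M,
        [/\ open (dom al), open (img al),
            forall p, dom al p -> param al (coord al p) = p,
            forall p, dom al p -> {for p, continuous (coord al)}
          & forall x, img al x -> {for x, continuous (param al)}])
    & smooth_map [set: M] (@idfun M)].

Definition euclid (d : nat) : charted R d :=
  {| carrier := 'rV[R]_d;
     base := 0;
     chart_index := unit;
     dom := fun _ => setT;
     coord := fun _ x => x;
     param := fun _ x => x;
     chart_at := fun _ => tt |}.

Definition prod2 {d e : nat} (M : charted R d) (N : charted R e) :
    charted R (d + e) :=
  {| carrier := (M * N)%type;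
     base := (base M, base N);
     chart_index := (chart_index M * chart_index N)%type;
     dom := fun al z => dom al.1 z.1 /\ dom al.2 z.2;
     coord := fun al z => row_mx (coord al.1 z.1) (coord al.2 z.2);
     param := fun al x => (param al.1 (lsubmx x), param al.2 (rsubmx x));
     chart_at := fun z => (chart_at z.1, chart_at z.2) |}.

Definition prodn {m : nat} {d : 'I_m -> nat} (M : forall i, charted R (d i)) :
    charted R (\sum_i d i) :=
  {| carrier := prod_topology (fun i => M i);
     base := fun i => base (M i);
     chart_index := forall i, chart_index (M i);
     dom := fun al z => forall i, dom (al i) (z i);
     coord := fun al z => \mxrow_i coord (al i) (z i);
     param := fun al x => fun i => param (al i) (submxrow x i);
     chart_at := fun z => fun i => chart_at (z i) |}.

Definition field1 {d : nat} (M : charted R d) :=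
  chart_index M -> 'rV[R]_d -> 'rV[R]_d.

(* T al x i j = T(d_i, d_j) at the point with coordinates x in the chart al. *)
Definition field2 {d : nat} (M : charted R d) :=
  chart_index M -> 'rV[R]_d -> 'M[R]_d.

Definition pull1 {d e : nat} {M : charted R d} {N : charted R e}
    (f : M -> N) (s : field1 N) : field1 M :=
  fun al x =>
    let be := chart_at (f (param al x)) in
    s be (coord_rep f al be x) *m (jac (coord_rep f al be) x)^T.

Definition pull2 {d e : nat} {M : charted R d} {N : charted R e}
    (f : M -> N) (T : field2 N) : field2 M :=
  fun al x =>
    let be := chart_at (f (param al x)) in
    let D := jac (coord_rep f al be) x in
    D *m T be (coord_rep f al be x) *m D^T.

Definition one_form {d : nat} {M : charted R d} (s : field1 M) : Prop :=
  (forall al, smooth_vfun (img al) (s al)) /\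
  forall al be x, img al x -> dom be (param al x) ->
    s al x = s be (coord_rep (@idfun M) al be x)
               *m (jac (coord_rep (@idfun M) al be) x)^T.

Definition tensor2 {d : nat} {M : charted R d} (T : field2 M) : Prop :=
  (forall al i j, smooth_fun (img al) (fun x => T al x i j)) /\
  forall al be x, img al x -> dom be (param al x) ->
    let D := jac (coord_rep (@idfun M) al be) x in
    T al x = D *m T be (coord_rep (@idfun M) al be x) *m D^T.

Definition ext_deriv1 {d : nat} {M : charted R d} (s : field1 M) : field2 M :=
  fun al x => \matrix_(i, j) (partial i (fun y => s al y 0 j) x
                              - partial j (fun y => s al y 0 i) x).

Definition closed2 {d : nat} {M : charted R d} (w : field2 M) : Prop :=
  forall al x, img al x -> forall i j k,
    partial i (fun y => w al y j k) x + partial j (fun y => w al y k i) x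
    + partial k (fun y => w al y i j) x = 0.

Definition riemannian_metric {d : nat} {M : charted R d} (g : field2 M) : Prop :=
  tensor2 g /\
  forall al x, img al x ->
    (g al x)^T = g al x /\
    forall v : 'rV[R]_d, v != 0 -> 0 < (v *m g al x *m v^T) 0 0.

Section Curvature.
Context {d : nat} (g : 'rV[R]_d -> 'M[R]_d).

(* Gamma^k_{ij} *)
Definition christoffel (i j k : 'I_d) (x : 'rV[R]_d) : R :=
  2^-1 * \sum_l invmx (g x) k l *
    (partial i (fun y => g y j l) x + partial j (fun y => g y i l) x
     - partial l (fun y => g y i j) x).

(* R(d_i, d_j) d_k = \sum_l (curvature i j k l) d_l, where
   R(X, Y) = [nabla_X, nabla_Y] - nabla_[X, Y] *)
Definition curvature (i j k l : 'I_d) (x : 'rV[R]_d) : R :=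
  partial i (christoffel j k l) x - partial j (christoffel i k l) x
  + \sum_h (christoffel j k h x * christoffel i h l x
            - christoffel i k h x * christoffel j h l x).

(* Rc(Y, Z) = trace of X |-> R(X, Y) Z *)
Definition ricci (x : 'rV[R]_d) : 'M[R]_d :=
  \matrix_(j, k) \sum_i curvature i j k i x.

Definition curvature_sqnorm (x : 'rV[R]_d) : R :=
  \sum_i \sum_i' \sum_j \sum_j' \sum_k \sum_k' \sum_l \sum_l'
    invmx (g x) i i' * invmx (g x) j j' * invmx (g x) k k' * g x l l' *
    curvature i j k l x * curvature i' j' k' l' x.

End Curvature.

Definition normRm {d : nat} {M : charted R d} (g : field2 M) (p : M) : R :=
  Num.sqrt (curvature_sqnorm (g (chart_at p)) (coord (chart_at p) p)).

Definition simplex (k : nat) : set 'rV[R]_k :=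
  [set x | (forall i, 0 <= x 0 i) /\ \sum_i x 0 i <= 1].

(* Smooth maps from the standard simplex: smooth on some neighbourhood of it. *)
Definition singular {d : nat} {M : charted R d} (k : nat)
    (f : 'rV[R]_k -> M) : Prop :=
  exists W : set 'rV[R]_k,
    [/\ open W, @simplex k `<=` W
      & smooth_map (M := euclid k) W f].

Definition speed {d : nat} {M : charted R d} (g : field2 M)
    (c : 'rV[R]_1 -> M) (t : R) : R :=
  Num.sqrt (pull2 (M := euclid 1) c g tt (const_mx t) 0 0).

Definition curve_length {d : nat} {M : charted R d} (g : field2 M)
    (c : 'rV[R]_1 -> M) : R :=
  \int[@lebesgue_measure R]_(t in `[0, 1]) speed g c t.

(* Some piecewise smooth curve from x to y has length L. *)
Inductive path_length {d : nat} {M : charted R d} (g : field2 M) (x : M) :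
    M -> R -> Prop :=
| path_nil : path_length g x x 0
| path_snoc (y : M) (L : R) (c : 'rV[R]_1 -> M) :
    path_length g x y L -> singular c -> c (const_mx 0) = y ->
    path_length g x (c (const_mx 1)) (L + curve_length g c).

Definition riem_dist {d : nat} {M : charted R d} (g : field2 M) (x y : M) :
    \bar R :=
  ereal_inf [set L%:E | L in path_length g x y].

Definition riem_ball {d : nat} {M : charted R d} (g : field2 M) (x : M)
    (r : R) : set M :=
  [set y | (riem_dist g x y < r%:E)%E].

Definition points {d : nat} (M : charted R d) : Type := M.
HB.instance Definition _ (d : nat) (M : charted R d) := Choice.on (points M).
HB.instance Definition _ (d : nat) (M : charted R d) :=
  isPointed.Build (points M) (base M).

Definition borel {d : nat} (M : charted R d) :=
  g_sigma_algebraType (@open M : set (set (points M))).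

(* mu is the Riemannian measure, sqrt(det g) dx in every chart; on a smooth
   manifold with a Riemannian metric there is exactly one such measure. *)
Definition riemannian_volume {d : nat} {M : charted R d} (g : field2 M)
    (mu : {measure set (borel M) -> \bar R}) : Prop :=
  forall (al : chart_index M) (A : set (borel M)),
    measurable A -> A `<=` dom al ->
    mu A = iter_integral (fun x =>
      (\1_(coord al @` A) x * Num.sqrt (\det (g al x)))%:E).

(* Perelman's condition for a single metric. *)
Definition noncollapsed {d : nat} {M : charted R d} (kappa : R)
    (g : field2 M) : Prop :=
  forall mu : {measure set (borel M) -> \bar R}, riemannian_volume g mu ->
  forall (x : M) (rho : R), 0 < rho ->
    (forall y, riem_ball g x rho y -> normRm g y <= rho ^- 2) ->
    ((kappa * rho ^+ d)%:E <= mu (riem_ball g x rho))%E.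

(* Singular cohomology is computed with smooth simplices.  The vertices of
   [simplex] in R^k are 0 and the k standard basis vectors, in this order. *)

Definition bary {k : nat} (x : 'rV[R]_k) (j : 'I_k.+1) : R :=
  if unlift ord0 j is Some l then x 0 l else 1 - \sum_l x 0 l.

(* The affine face opposite to vertex i: insert a zero as i-th barycentric
   coordinate. *)
Definition face {k : nat} (i : 'I_k.+2) (x : 'rV[R]_k) : 'rV[R]_k.+1 :=
  \row_l (if unlift i (lift ord0 l) is Some j then bary x j else 0).

(* Singular simplices are represented by total functions, which only matter on
   the standard simplex. *)
Definition cochain {d : nat} {M : charted R d} {A : zmodType} (k : nat)
    (c : ('rV[R]_k -> M) -> A) : Prop :=
  forall f f' : 'rV[R]_k -> M, singular f -> singular f' ->
    (forall x, simplex x -> f x = f' x) -> c f = c f'.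

Definition coboundary {d : nat} {M : charted R d} {A : zmodType} (k : nat)
    (c : ('rV[R]_k -> M) -> A) : ('rV[R]_k.+1 -> M) -> A :=
  fun f => \sum_(i < k.+2) (if odd i then - c (f \o face i)
                            else c (f \o face i)).

Definition cocycle {d : nat} {M : charted R d} {A : zmodType} (k : nat)
    (c : ('rV[R]_k -> M) -> A) : Prop :=
  cochain c /\
  forall f : 'rV[R]_k.+1 -> M, singular f -> coboundary c f = 0.

Definition cohomologous {d : nat} {M : charted R d} {A : zmodType} (k : nat)
    (c c' : ('rV[R]_k.+1 -> M) -> A) : Prop :=
  exists2 e : ('rV[R]_k -> M) -> A, cochain e &
    forall f : 'rV[R]_k.+1 -> M, singular f -> c f = c' f + coboundary e f.

Definition integral2 {d : nat} {M : charted R d} (w : field2 M)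
    (f : 'rV[R]_2 -> M) : R :=
  \int[@lebesgue_measure R]_(s in `[0, 1])
    (\int[@lebesgue_measure R]_(t in `[0, (1 - s)%R])
       pull2 (M := euclid 2) f w tt (row2 s t) 0 1)%R.

(* The de Rham class of w is the image in H^2(M; R) of a class in H^2(M; Z)
   that has infinite order and is not a proper multiple. *)
Definition indivisible_integral {d : nat} {M : charted R d}
    (w : field2 M) : Prop :=
  exists c : ('rV[R]_2 -> M) -> int,
    [/\ cocycle c,
        cohomologous (integral2 w) (fun f => (c f)%:~R),
        (forall k : int, cohomologous (fun f => k * c f) (fun=> 0) -> k = 0)
      & forall (k : int) (c' : ('rV[R]_2 -> M) -> int), cocycle c' ->
          cohomologous c (fun f => k * c' f) -> `|k| = 1].

(* Coordinates in R^(n + n) are (x, y) with z = x + i y, and v |-> v *m Jstd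
   is multiplication by i. *)
Definition Jstd (n : nat) : 'M[R]_(n + n) := block_mx 0 1%:M (- 1%:M) 0.

(* Coordinate changes satisfy the Cauchy-Riemann equations. *)
Definition complex_manifold {n : nat} (M : charted R (n + n)) : Prop :=
  smooth_manifold M /\
  forall (al be : chart_index M) x, img al x -> dom be (param al x) ->
    let D := jac (coord_rep (@idfun M) al be) x in
    D *m Jstd n = Jstd n *m D.

(* omega(X, Y) = g(JX, Y) *)
Definition kaehler_form {n : nat} {M : charted R (n + n)} (g : field2 M) :
    field2 M :=
  fun al x => Jstd n *m g al x.

Definition kaehler {n : nat} (M : charted R (n + n)) (g : field2 M) : Prop :=
  [/\ complex_manifold M, riemannian_metric g,
      forall al x, img al x -> Jstd n *m g al x *m (Jstd n)^T = g al x
    & closed2 (kaehler_form g)].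

Definition compact_kaehler_einstein {n : nat} (M : charted R (n + n))
    (g : field2 M) (lam : R) : Prop :=
  [/\ kaehler g, compact [set: M], connected [set: M]
    & forall al x, img al x -> ricci (g al) x = lam *: g al x].

(* The circle is R / 2 pi Z, acting on P through [act].  In the last clause,
   p |-> (proj p, phi p) identifies proj^-1(U) equivariantly with U x S^1, with
   inverse (b, (cos t, sin t)) |-> act t (s b). *)
Definition principal_circle_bundle {d e : nat} (P : charted R d)
    (B : charted R e) (proj : P -> B) (act : R -> P -> P) : Prop :=
  [/\ smooth_manifold P /\ smooth_map [set: P] proj,
      smooth_map (M := prod2 (euclid 1) P) setT
        (fun z => act (z.1 0 0) z.2),
      (forall p, act 0 p = p) /\
      (forall s t p, act (s + t) p = act s (act t p)),
      (forall t p, act t p = p <-> exists k : int, t = k%:~R * (2 * pi)) /\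
      (forall p p', proj p = proj p' <-> exists t, p' = act t p)
    & forall b : B, exists (U : set B) (s : B -> P) (phi : P -> 'rV[R]_2),
        [/\ open U /\ U b, smooth_map U s, forall b', U b' -> proj (s b') = b',
            smooth_map (N := euclid 2) (proj @^-1` U) phi
          & forall b' t, U b' -> phi (act t (s b')) = row2 (cos t) (sin t)]].

(* The first condition on sigma: its value on the generator of the action
   is 1. *)
Definition principal_connection {d : nat} {P : charted R d}
    (act : R -> P -> P) (sigma : field1 P) : Prop :=
  [/\ one_form sigma,
      (forall al x, img al x ->
        \sum_j sigma al x 0 j *
          'D_1 (fun t : R => coord al (act t (param al x)) 0 j) 0 = 1)
    & forall t al x, img al x -> pull1 (act t) sigma al x = sigma al x].

Section Bundle.
Context {m : nat} {n : 'I_m -> nat} {M : forall i, charted R (n i + n i)}.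
Context {P : charted R (\sum_i (n i + n i)).+1}.

(* d sigma = \sum_i q_i omega_i.  By Chern-Weil, (1 / 2 pi) \sum_i q_i [omega_i]
   is then the Euler class of the bundle; there is no torsion to account for,
   since the M_i have positive Ricci curvature and are simply connected. *)
Definition has_curvature (g : forall i, field2 (M i)) (q : 'I_m -> int)
    (proj : P -> prodn M) (sigma : field1 P) : Prop :=
  forall al x, img al x ->
    ext_deriv1 sigma al x =
    \sum_i (q i)%:~R *: pull2 (fun p => proj p i) (kaehler_form (g i)) al x.

Definition bundle_metric (g : forall i, field2 (M i)) (proj : P -> prodn M)
    (sigma : field1 P) (a : R) (b : 'I_m -> R) : field2 P :=
  fun al x => a *: ((sigma al x)^T *m sigma al x) +
    \sum_i b i *: pull2 (fun p => proj p i) (g i) al x.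

End Bundle.

Section Flow.
Context {m : nat} (n p : 'I_m -> nat) (q : 'I_m -> int).

Definition flowE (Y : 'I_m -> R) : R :=
  \sum_i (n i)%:R * (q i)%:~R ^+ 2 * Y i ^+ 2.

Definition flowF (i : 'I_m) (Y : 'I_m -> R) : R :=
  2 * (p i)%:R * Y i - (q i)%:~R ^+ 2 * Y i ^+ 2 - flowE Y.

(* dY_i/du = - Y_i F_i(Y) on [0, +oo[ with values in the positive orthant; the
   one-sided equation at u = 0 follows from continuity at 0. *)
Definition flow_solution (Y : R -> 'I_m -> R) : Prop :=
  [/\ forall u i, 0 <= u -> 0 < Y u i,
      forall i, {within `[0, +oo[, continuous (fun u => Y u i)}
    & forall (u : R) i, 0 < u ->
        is_derive u 1 (fun v => Y v i) (- (Y u i * flowF i (Y u)))].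

(* a as a function of u *)
Definition fiber_scale (a0 : R) (Y : R -> 'I_m -> R) (u : R) : R :=
  a0 * expR (\int[@lebesgue_measure R]_(z in `[0, u]) flowE (Y z)).

(* tau as a function of u *)
Definition back_time (a0 : R) (Y : R -> 'I_m -> R) (u : R) : R :=
  \int[@lebesgue_measure R]_(z in `[0, u]) fiber_scale a0 Y z.

(* (a, b), as functions of tau >= 0, is the solution of the backwards Ricci flow
   determined by Y and by the value of a at 0. *)
Definition corresponding (Y : R -> 'I_m -> R) (a : R -> R)
    (b : 'I_m -> R -> R) : Prop :=
  0 < a 0 /\
  forall u, 0 <= u ->
    a (back_time (a 0) Y u) = fiber_scale (a 0) Y u /\
    forall i, b i (back_time (a 0) Y u) = fiber_scale (a 0) Y u / Y u i.

End Flow.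

Definition type_I {d : nat} {M : charted R d} (g : R -> field2 M) : Prop :=
  exists C tau0 : R, forall tau, tau0 <= tau ->
    (tau%:E * ereal_sup [set (normRm (g tau) x)%:E | x in [set: M]]
       <= C%:E)%E.

End Manifolds.

(* Main.v *)
(** With [Y_i = a / b_i], the metric at time [tau] is [a(tau)] times the metric
    [sigma^2 + \sum_i Y_i^-1 g_i] with fibres of unit scale.  Since [Y] converges
    inside the positive orthant, the numbers [Y_i^-1] stay in a compact box [K],
    so that up to scaling we deal with a compact family of metrics on the compact
    manifold [P].  Their curvature norms are bounded above on [P * K] by
    continuity, and bounded below by a positive constant: the generator [V] of
    the circle action is a Killing field of constant length, hence
    [Rc(V, V) = - tr ((nabla V)^2) = |nabla V|^2], and [nabla V] is [d sigma] up to
    a factor, which does not vanish.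

    As [d ln a / du = E(Y) >= e > 0], we get [e tau <= a], and
    [|Rm| <= C / a <= C / (e tau)].  A ball of radius [rho <= e' sqrt a] contains a
    coordinate cube of size comparable to [rho / sqrt a], which bounds its volume
    below by a multiple of [rho^dim P], uniformly on [P * K].  If [rho] is larger
    and [|Rm| <= rho^-2], the lower bound on the curvature gives
    [rho <= C sqrt a], and the ball of radius [e' sqrt a] is large enough. *)

Require Import Defs.
From HB Require Import structures.
From mathcomp Require Import all_boot all_order all_algebra.
From mathcomp Require Import all_classical all_reals all_analysis.
From mathcomp Require Import perm ring lra.

Set Implicit Arguments.
Unset Strict Implicit.
Unset Printing Implicit Defensive.

Import Order.TTheory GRing.Theory Num.Theory.
Import numFieldNormedType.Exports.

Local Open Scope classical_set_scope.
Local Open Scope ring_scope.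

(** * Calculus in coordinates *)

(** The norm of the curvature is evaluated in the chart selected by [chart_at], which jumps from
    point to point. Before compactness can act, the norm must be shown independent of the chart;
    hence the transformation laws of connection and curvature, the former obtained from uniqueness
    of the Levi-Civita connection. Joint continuity in the point and in the numbers b_i comes from
    treating the b_i as m further coordinates of one smooth matrix function.

    That the generator V is Killing is derived infinitesimally, in one chart, from sigma(V) = 1, d
    proj(V) = 0 and d sigma(V, .) = 0.

    The form d sigma can be nonzero only if some factor has positive dimension. Nonconstancy of Y
    supplies a factor, and indivisibility of the class of omega_i excludes dimension 0, where H^2
    vanishes.

    Volumes are bounded from below and lengths from above by comparison with constants, so no
    integrand has to be shown measurable. Balls do have to be Borel sets; they are open, because a
    path shorter than rho can be prolonged by a short coordinate segment. *)

Section CvgBig.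
Context {R : realType} {T I : Type} {F : set_system T} {FF : Filter F}.
Context (r : seq I) (P : pred I).

Lemma cvg_sumr (V : normedModType R) (f : I -> T -> V) (l : I -> V) :
  (forall i, P i -> f i x @[x --> F] --> l i) ->
  \sum_(i <- r | P i) f i x @[x --> F] --> \sum_(i <- r | P i) l i.
Proof. by move=> H; apply: cvg_big => //; exact: add_continuous. Qed.

End CvgBig.

Lemma cvg_mx {R : realType} {T : Type} {F : set_system T} {FF : Filter F}
    {m n : nat} (f : T -> 'M[R]_(m, n)) (l : 'M[R]_(m, n)) :
  (forall i j, f x i j @[x --> F] --> l i j) -> f x @[x --> F] --> l.
Proof.
move=> H; rewrite (matrix_sum_delta l).
have -> : f = (fun x => \sum_i \sum_j f x i j *: delta_mx i j).
  by apply/funext => x; rewrite -matrix_sum_delta.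
apply: cvg_sumr => i _; apply: cvg_sumr => j _; by apply: cvgZr_tmp; exact: H.
Qed.

Lemma continuous_mx {R : realType} {T : topologicalType} {m n : nat}
    (f : T -> 'M[R]_(m, n)) (x : T) :
  (forall i j, {for x, continuous (fun y => f y i j)}) -> {for x, continuous f}.
Proof. by move=> H; apply: cvg_mx => i j; exact: H. Qed.

Lemma nbhs_norm_ltP {R : realType} (V : normedModType R) (x : V) (A : set V) :
  nbhs x A <-> exists2 r : R, 0 < r & forall y, `|x - y| < r -> A y.
Proof.
split=> [/nbhs_ballP[r /= r0 H]|[r r0 H]].
  by exists r => // y yr; apply: H; rewrite -ball_normE.
by apply/nbhs_ballP; exists r => // y; rewrite -ball_normE; exact: H.
Qed.

Lemma near_forall_fin {T : topologicalType} {I : finType} (x : T)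
  (A : I -> T -> Prop) :
  (forall i, \forall y \near x, A i y) -> \forall y \near x, forall i, A i y.
Proof. by move=> H; apply: filter_forall. Qed.

Section DirectionalMVT.
Context {R : realType}.

Lemma is_derive_line (V : normedModType R) (f : V -> R) (y v : V) (s : R) :
  derivable f (y + s *: v) v ->
  is_derive s 1 (fun s => f (y + s *: v)) ('D_v f (y + s *: v)).
Proof.
have E : (fun h : R => h^-1 *: (f (y + (h *: (1 : R) + s) *: v) - f (y + s *: v)))
  = (fun h : R => h^-1 *: (f (h *: v + (y + s *: v)) - f (y + s *: v))).
  apply/funext => h; congr (_ *: (f _ - _)).
  by rewrite scalerDl [_%:A]mulr1 addrCA.
by move=> df; apply: DeriveDef; rewrite /derivable/derive /= E.
Qed.

Lemma MVT_line (V : normedModType R) (f : V -> R) (y v : V) (t : R) :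
  (forall s : R, `|s| <= `|t| -> derivable f (y + s *: v) v) ->
  exists2 c, `|c| <= `|t| & f (y + t *: v) - f y = t * 'D_v f (y + c *: v).
Proof.
move=> df.
pose phi (s : R) := f (y + s *: v).
have dphi (s : R) : `|s| <= `|t| -> is_derive s 1 phi ('D_v f (y + s *: v)).
  by move=> /df; exact: is_derive_line.
have cphi (a b : R) : (forall s, s \in `[a, b] -> `|s| <= `|t|) ->
    {within `[a, b], continuous phi}.
  move=> ab; by apply: derivable_within_continuous => s /ab /dphi [].
have phi0 : f y = phi 0 by rewrite /phi scale0r addr0.
have [t0|t0|->] := ltgtP t 0; last first.
- by exists 0 => //; rewrite scale0r addr0 mul0r subrr.
- have bd s : s \in `[0, t] -> `|s| <= `|t|.
    by rewrite in_itv/= => /andP[s0 st]; rewrite !ger0_norm// ltW.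
  have [c ct E] := MVT t0 (fun s hs => dphi s (bd s (subset_itv_oo_cc hs))) (cphi _ _ bd).
  exists c; first exact/bd/subset_itv_oo_cc.
  by rewrite phi0 [LHS]E subr0 mulrC.
- have bd s : s \in `[t, 0] -> `|s| <= `|t|.
    by rewrite in_itv/= => /andP[s0 st]; rewrite !ler0_norm ?lerN2// ltW.
  have [c ct E] := MVT t0 (fun s hs => dphi s (bd s (subset_itv_oo_cc hs))) (cphi _ _ bd).
  exists c; first exact/bd/subset_itv_oo_cc.
  by rewrite phi0 -[LHS]opprB [X in - X]E sub0r mulrN opprK mulrC.
Qed.

End DirectionalMVT.

Section C1.
Context {R : realType} {d : nat}.
Implicit Types (f : 'rV[R]_d -> R) (x y h : 'rV[R]_d).

(** The way from [x] to [x + h] is taken along a polygon with edges parallel to the axes; this is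
    the displacement after [k] edges. *)
Definition trunc_row (k : nat) h : 'rV[R]_d := \row_j (if (j < k)%N then h 0 j else 0).

Lemma trunc_row0 h : trunc_row 0 h = 0.
Proof. by apply/rowP => j; rewrite !mxE. Qed.

Lemma trunc_row_full h : trunc_row d h = h.
Proof. by apply/rowP => j; rewrite !mxE ltn_ord. Qed.

Lemma trunc_rowS (k : 'I_d) h :
  trunc_row k.+1 h = trunc_row k h + h 0 k *: delta_mx 0 k.
Proof.
apply/rowP => j; rewrite !mxE /= ltnS leq_eqVlt -val_eqE /=.
by case: eqP => [/val_inj ->|]; rewrite ?ltnn /= ?mulr1 ?add0r ?mulr0 ?addr0.
Qed.

Lemma entry_le_norm k l (A : 'M[R]_(k, l)) i j : `|A i j| <= `|A|.
Proof.
rewrite [leRHS]/Num.Def.normr/= mx_normrE.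
exact: (le_bigmax _ (fun ij => `|A ij.1 ij.2|) (i, j)).
Qed.

Lemma norm_row_le x (e : R) : 0 <= e -> (forall i, `|x 0 i| <= e) -> `|x| <= e.
Proof.
move=> e0 H; rewrite [leLHS]/Num.Def.normr/= mx_normrE.
by apply: bigmax_le => // -[i j] _ /=; rewrite ord1.
Qed.

Lemma norm_delta_row (i : 'I_d) (s : R) : `|s *: delta_mx 0 i : 'rV[R]_d| <= `|s|.
Proof.
apply: norm_row_le => // j; rewrite !mxE /= normrM.
by apply: ler_piMr => //; case: (_ == _); rewrite ?normr1 ?normr0.
Qed.

Lemma norm_trunc_row k h : `|trunc_row k h| <= `|h|.
Proof.
apply: norm_row_le => // j; rewrite mxE; case: ifP => _; first exact: entry_le_norm.
by rewrite normr0.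
Qed.

(** The increment telescopes along the polygon of truncations. On each edge the mean value theorem
    gives a partial derivative at a nearby point, which by continuity is close to the one at [x]. *)
Lemma C1_differentiable f x :
  (\forall y \near x, forall i : 'I_d, derivable f y (delta_mx 0 i)) ->
  (forall i, {for x, continuous (partial i f)}) -> differentiable f x.
Proof.
move=> df cf.
pose D : 'cV[R]_d := \col_i partial i f x.
pose L (h : 'rV[R]_d) : R := (h *m D) 0 0.
have Llin : linear L by move=> c u v; rewrite /L mulmxDl -scalemxAl !mxE.
pose Lb := GRing.isLinear.Build _ _ _ _ _ Llin.
pose LL : {linear 'rV[R]_d -> R} := HB.pack L Lb.
have Lc : continuous LL.
  have -> : LL = (fun h : 'rV[R]_d => \sum_i h 0 i * D i 0) :> ('rV[R]_d -> R).
    by apply/funext => h; rewrite /LL /= /L mxE.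
  by move=> h; apply: (@cvg_sumr _ _ _ (nbhs h)) => i _; apply: (@cvgMr_tmp _ _ (nbhs h)); exact: (@coord_continuous R 1 d 0 i h).
have key : f \o shift x = cst (f x) + LL +o_ (0 : 'rV[R]_d) id.
  apply/eqaddoP => _/posnumP[e].
  (* Each of the [d] edges contributes an error of at most this times [|h|]; the denominator [d.+1]
     is positive also for [d = 0]. *)
  have e'0 : 0 < e%:num / (d.+1)%:R by [].
  have : \forall y \near x, forall i, derivable f y (delta_mx 0 i) /\
      `|partial i f y - partial i f x| <= e%:num / (d.+1)%:R.
    apply: near_forall_fin => i.
    have /cvgrPdist_le/(_ _ e'0) H := cf i.
    by apply: filterS2 df H => y dfy Hy; split; [exact: dfy|rewrite distrC].
  case/nbhs_norm_ltP => r r0 Hr.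
  (* A point of the polygon differs from [x] by a truncation of [h] and a piece of one edge, each of
     norm at most [|h|]; hence half the radius. *)
  apply/nbhs_norm_ltP; exists (r / 2) => [|h]; first exact: divr_gt0.
  rewrite sub0r normrN => hr.
  have -> : (f \o shift x - (cst (f x) + LL)) h = f (x + h) - f x - L h.
    have -> : (f \o shift x - (cst (f x) + LL)) h = f (h + x) - (f x + L h) by [].
    by rewrite opprD addrA [h + x]addrC.
  have Hst (k : 'I_d) : `|f (x + trunc_row k.+1 h) - f (x + trunc_row k h)
       - h 0 k * partial k f x| <= `|h| * (e%:num / (d.+1)%:R).
    have nc c : `|c| <= `|h 0 k| -> `|x - (x + trunc_row k h + c *: delta_mx 0 k)| < r.
      move=> ch; rewrite -addrA opprD addrA subrr add0r normrN.
      apply: (le_lt_trans (ler_normD _ _)); rewrite [r]splitr; apply: ltr_leD.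
        by apply: le_lt_trans hr; exact: norm_trunc_row.
      apply: le_trans (ltW hr); apply: le_trans (norm_delta_row _ _) _.
      exact: le_trans (entry_le_norm h 0 k).
    have [c ch E] := @MVT_line R _ f (x + trunc_row k h) (delta_mx 0 k) (h 0 k)
      (fun s hs => (Hr _ (nc s hs) k).1).
    rewrite trunc_rowS addrA E -mulrBr normrM; apply: ler_pM => //.
      exact: entry_le_norm.
    exact: (Hr _ (nc c ch) k).2.
  have -> : f (x + h) - f x - L h = \sum_(k < d) (f (x + trunc_row k.+1 h)
      - f (x + trunc_row k h) - h 0 k * partial k f x).
    rewrite big_split /= sumrN; congr (_ - _); last first.
      by rewrite /L mxE; apply: eq_bigr => i _; rewrite mxE.
    rewrite -(big_mkord xpredT (fun k => f (x + trunc_row k.+1 h) - f (x + trunc_row k h))).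
    by rewrite telescope_sumr// trunc_row_full trunc_row0 addr0.
  apply: (le_trans (ler_norm_sum _ _ _)).
  apply: (@le_trans _ _ (\sum_(i < d) `|h| * (e%:num / (d.+1)%:R))).
    by apply: ler_sum => i _; exact: Hst.
  rewrite sumr_const card_ord -mulrnAr mulrC; apply: ler_wpM2r => //.
  rewrite -[X in X *+ _]/(e%:num / d.+1%:R) -mulr_natr -mulrA ger_pMr//.
  by rewrite mulrC ler_pdivrMr ?mul1r ?ler_nat.
have HH := diff_unique Lc key.
by apply/diff_locallyP; rewrite HH; split.
Qed.

End C1.

Lemma continuous_at_ext {T V : topologicalType} (U : set T) (f g : T -> V) x :
  open U -> U x ->
  (forall y, U y -> f y = g y) ->
  {for x, continuous f} -> {for x, continuous g}.
Proof.
move=> oU Ux E cf; rewrite /prop_for /continuous_at -(E x Ux).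
apply: cvg_trans cf; apply: near_eq_cvg.
have : nbhs x U by exact: open_nbhs_nbhs.
by apply: filterS => y /E.
Qed.

Section CkAlgebra.
Context {R : realType} {d : nat}.
Implicit Types (U : set 'rV[R]_d) (f g : 'rV[R]_d -> R) (x : 'rV[R]_d).

Lemma CkW k U f : Ck k.+1 U f -> Ck k U f.
Proof.
elim: k f => [|k IH] f /=; first by case.
by case=> cf H; split=> // i; have [di Hi] := H i; split => //; exact: IH.
Qed.

Lemma Ck_sub k U U' f : U' `<=` U -> Ck k U f -> Ck k U' f.
Proof.
move=> UU'; elim: k f => [|k IH] f /= [cf H]; split=> //.
- by move=> x /UU'; exact: cf.
- by move=> x /UU'; exact: cf.
move=> i; have [di Hi] := H i; split; last exact: IH.
by move=> x /UU'; exact: di.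
Qed.

(** Every clause of [Ck] is a condition at single points, so the sets [W] may be arbitrary, open or
    not. *)
Lemma Ck_cover k U f :
  (forall x, U x -> exists2 W, W x & Ck k W f) -> Ck k U f.
Proof.
elim: k f => [|k IH] f H /=; split=> //.
- by move=> x /H[W Wx [cf _]]; exact: cf.
- by move=> x /H[W Wx [cf _]]; exact: cf.
move=> i; split; first by move=> x /H[W Wx [_ /(_ i)[+ _]]]; exact.
by apply: IH => x /H[W Wx [_ /(_ i)[_ ?]]]; exists W.
Qed.

Lemma partial_ext U f g x i : open U -> U x ->
  (forall y, U y -> f y = g y) -> partial i f x = partial i g x.
Proof.
move=> oU Ux E; rewrite /partial; apply: near_eq_derive.
have : nbhs x U by exact: open_nbhs_nbhs.
by apply: filterS => y /E.
Qed.

Lemma derivable_ext U f g x v : open U -> U x ->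
  (forall y, U y -> f y = g y) -> derivable f x v -> derivable g x v.
Proof.
move=> oU Ux E; apply: near_eq_derivable.
have : nbhs x U by exact: open_nbhs_nbhs.
by apply: filterS => y /E.
Qed.

Lemma Ck_ext k U f g : open U -> (forall y, U y -> f y = g y) ->
  Ck k U f -> Ck k U g.
Proof.
move=> oU; elim: k f g => [|k IH] f g E /= [cf H]; split=> //.
- by move=> x Ux; apply: (continuous_at_ext oU Ux E); exact: cf.
- by move=> x Ux; apply: (continuous_at_ext oU Ux E); exact: cf.
move=> i; have [di Hi] := H i; split.
  by move=> x Ux; apply: (derivable_ext oU Ux E); exact: di.
by apply: IH Hi => y Uy; exact: (partial_ext _ oU Uy E).
Qed.

Lemma Ck_cst k U (c : R) : Ck k U (cst c).
Proof.
elim: k c => [|k IH] c /=; split=> //.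
- by move=> x _; exact: cst_continuous.
- by move=> x _; exact: cst_continuous.
move=> i; split=> [x _|]; first exact: derivable_cst.
have -> : partial i (cst c) = (cst 0 : 'rV[R]_d -> R).
  by apply/funext => x; rewrite /partial derive_cst.
exact: IH.
Qed.

Lemma partial_coord (j : 'I_d) i x :
  partial i (fun y : 'rV[R]_d => y 0 j) x = (i == j)%:R.
Proof.
rewrite /partial; have := @derive_mx R _ 1 d id x (delta_mx 0 i) (@derivable_id R _ x (delta_mx 0 i)).
by rewrite derive_id => /matrixP/(_ 0 j); rewrite !mxE eqxx /= eq_sym => <-.
Qed.

Lemma derivable_coord (j : 'I_d) x v : derivable (fun y : 'rV[R]_d => y 0 j) x v.
Proof. by have /derivable_mxP := @derivable_id R _ x v; exact. Qed.

Lemma Ck_coord k U (j : 'I_d) : Ck k U (fun y => y 0 j).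
Proof.
case: k => [|k] /=; split=> //.
- by move=> x _; exact: coord_continuous.
- by move=> x _; exact: coord_continuous.
move=> i; split=> [x _|]; first exact: derivable_coord.
have -> : partial i (fun y => y 0 j) = (cst (i == j)%:R : 'rV[R]_d -> R).
  by apply/funext => x; rewrite partial_coord.
exact: Ck_cst.
Qed.

Lemma CkD k U f g : open U -> Ck k U f -> Ck k U g -> Ck k U (fun x => f x + g x).
Proof.
move=> oU; elim: k f g => [|k IH] f g /= [cf Hf] [cg Hg]; split=> //.
- by move=> x Ux; apply: (@continuousD _ _ _ f g); [exact: cf|exact: cg].
- by move=> x Ux; apply: (@continuousD _ _ _ f g); [exact: cf|exact: cg].
move=> i; have [df {}Hf] := Hf i; have [dg {}Hg] := Hg i; split.
  by move=> x Ux; apply: (@derivableD _ _ _ f g); [exact: df|exact: dg].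
apply: (Ck_ext oU _ (IH _ _ Hf Hg)) => y Uy.
by rewrite /partial (@deriveD _ _ _ f g)//; [exact: df|exact: dg].
Qed.

Lemma CkM k U f g : open U -> Ck k U f -> Ck k U g -> Ck k U (fun x => f x * g x).
Proof.
move=> oU; elim: k f g => [|k IH] f g Hf0 Hg0; have [cf Hf] := Hf0; have [cg Hg] := Hg0.
  by split=> // x Ux; apply: (@continuousM _ _ f g); [exact: cf|exact: cg].
split.
  by move=> x Ux; apply: (@continuousM _ _ f g); [exact: cf|exact: cg].
move=> i; have [df {}Hf] := Hf i; have [dg {}Hg] := Hg i; split.
  by move=> x Ux; apply: (@derivableM _ _ f g); [exact: df|exact: dg].
apply: (Ck_ext oU _ (CkD oU (IH _ _ (CkW Hf0) Hg) (IH _ _ (CkW Hg0) Hf))) => y Uy.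
by rewrite /partial (@deriveM _ _ f g)//; [exact: df|exact: dg].
Qed.

Lemma CkZ k U (c : R) f : open U -> Ck k U f -> Ck k U (fun x => c * f x).
Proof. by move=> oU; apply: CkM => //; exact: Ck_cst. Qed.

Lemma CkN k U f : open U -> Ck k U f -> Ck k U (fun x => - f x).
Proof.
move=> oU H; apply: (Ck_ext oU _ (CkZ (-1) oU H)) => y _; exact: mulN1r.
Qed.

Lemma CkV k U f : open U -> (forall x, U x -> f x != 0) ->
  Ck k U f -> Ck k U (fun x => (f x)^-1).
Proof.
move=> oU f0; elim: k => [|k IH] Hf0; have [cf Hf] := Hf0.
  by split=> // x Ux; apply: (@continuousV _ _ f); [exact: f0|exact: cf].
split; first by move=> x Ux; apply: (@continuousV _ _ f); [exact: f0|exact: cf].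
have HV := IH (CkW Hf0).
move=> i; have [df {}Hf] := Hf i; split.
  by move=> x Ux; apply: derivableV; [exact: f0|exact: df].
apply: (Ck_ext oU _ (CkN oU (CkM oU (CkM oU HV HV) Hf))) => y Uy.
rewrite /partial (@deriveV _ _ f)//; [|exact: f0|exact: df].
by rewrite -exprVn expr2 -mulNr.
Qed.

Lemma Ck_sum k U (I : Type) (r : seq I) (P : pred I) (f : I -> 'rV[R]_d -> R) :
  open U -> (forall i, P i -> Ck k U (f i)) ->
  Ck k U (fun x => \sum_(i <- r | P i) f i x).
Proof.
move=> oU H; elim: r => [|i r IH].
  by apply: (Ck_ext oU _ (Ck_cst k U 0)) => y _; rewrite big_nil.
have [Pi|/negPf Pi] := boolP (P i).
  by apply: (Ck_ext oU _ (CkD oU (H i Pi) IH)) => y _; rewrite big_cons Pi.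
by apply: (Ck_ext oU _ IH) => y _; rewrite big_cons Pi.
Qed.

Lemma Ck_prod k U (I : Type) (r : seq I) (P : pred I) (f : I -> 'rV[R]_d -> R) :
  open U -> (forall i, P i -> Ck k U (f i)) ->
  Ck k U (fun x => \prod_(i <- r | P i) f i x).
Proof.
move=> oU H; elim: r => [|i r IH].
  by apply: (Ck_ext oU _ (Ck_cst k U 1)) => y _; rewrite big_nil.
have [Pi|/negPf Pi] := boolP (P i).
  by apply: (Ck_ext oU _ (CkM oU (H i Pi) IH)) => y _; rewrite big_cons Pi.
by apply: (Ck_ext oU _ IH) => y _; rewrite big_cons Pi.
Qed.

Lemma Ck_differentiable k U f x : open U -> U x -> Ck k.+1 U f ->
  differentiable f x.
Proof.
move=> oU Ux [cf H]; apply: C1_differentiable.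
  have : nbhs x U by exact: open_nbhs_nbhs.
  by apply: filterS => y Uy i; have [+ _] := H i; exact.
move=> i; have [_] := H i; case: k {H} => [|k] [+ _]; exact.
Qed.

End CkAlgebra.

Section Chain.
Context {R : realType} {d e : nat}.
Implicit Types (phi : 'rV[R]_d -> 'rV[R]_e) (f : 'rV[R]_e -> R).

Lemma differentiable_row phi x :
  (forall j, differentiable (fun y => phi y 0 j) x) -> differentiable phi x.
Proof.
move=> H; have -> : phi = \sum_(j < e) (fun y => phi y 0 j *: delta_mx 0 j).
  by apply/funext => y; rewrite fct_sumE [LHS]row_sum_delta.
by apply: differentiable_sum => j; exact: differentiableZl.
Qed.

Lemma partial_comp f phi x i :
  differentiable phi x -> differentiable f (phi x) ->
  partial i (f \o phi) x =
  \sum_j partial i (fun y => phi y 0 j) x * partial j f (phi x).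
Proof.
move=> dphi df.
rewrite /partial deriveE; last exact: differentiable_comp.
rewrite diff_comp//= -[X in 'd f _ X](deriveE _ dphi) derive_mx;
  last exact: diff_derivable.
rewrite [X in 'd f _ X]row_sum_delta raddf_sum; apply: eq_bigr => j _.
by rewrite [LHS]linearZ -deriveE// !mxE.
Qed.

Lemma Ck_comp k (U : set 'rV[R]_d) (V : set 'rV[R]_e) f phi :
  open U -> open V -> (forall x, U x -> V (phi x)) ->
  (forall j, Ck k U (fun y => phi y 0 j)) -> Ck k V f -> Ck k U (f \o phi).
Proof.
move=> oU oV UV; elim: k f => [|k IH] f Hphi Hf.
  split=> // x Ux; apply: continuous_comp; last by have [+ _] := Hf; apply; exact: UV.
  by apply: continuous_mx => i j; rewrite ord1; have [+ _] := Hphi j; exact.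
have dphi x : U x -> differentiable phi x.
  by move=> Ux; apply: differentiable_row => j; exact: Ck_differentiable (Hphi j).
have df x : U x -> differentiable f (phi x).
  by move=> Ux; apply: Ck_differentiable Hf => //; exact: UV.
split.
  by move=> x Ux; apply: differentiable_continuous; apply: differentiable_comp; auto.
move=> i; split.
  by move=> x Ux; apply: diff_derivable; apply: differentiable_comp; auto.
apply: (@Ck_ext _ _ _ _ (fun x =>
  \sum_j partial i (fun y => phi y 0 j) x * partial j f (phi x))) => //.
  by move=> x Ux; rewrite partial_comp; auto.
apply: Ck_sum => // j _; apply: CkM => //.
  by have [_ /(_ i)[]] := Hphi j.
apply: (IH (partial j f)) => [l|]; first exact: CkW.
by have [_ /(_ j)[]] := Hf.
Qed.

End Chain.

(** * Symmetry of second derivatives *)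

Section Schwarz.
Context {R : realType} {d : nat}.
Implicit Types (U : set 'rV[R]_d) (f : 'rV[R]_d -> R) (x : 'rV[R]_d).

(** The mean value theorem is applied in direction [i] to the difference of [f] and its translate,
    then in direction [j] to [partial i f]. The second difference is symmetric in [i] and [j], the
    derivative on the right is not yet known to be. *)
Lemma mixed_increment f x (i j : 'I_d) (r s : R) :
  (forall y, `|x - y| < r -> derivable f y (delta_mx 0 i)) ->
  (forall y, `|x - y| < r -> derivable (partial i f) y (delta_mx 0 j)) ->
  `|s| + `|s| < r ->
  exists2 y, `|x - y| <= `|s| + `|s| &
    f (x + s *: delta_mx 0 i + s *: delta_mx 0 j) - f (x + s *: delta_mx 0 i)
      - (f (x + s *: delta_mx 0 j) - f x) = s * (s * partial j (partial i f) y).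
Proof.
move=> di dij sr.
have nr (c c' : R) : `|c| <= `|s| -> `|c'| <= `|s| ->
    `|x - (x + c *: delta_mx 0 i + c' *: delta_mx 0 j)| <= `|s| + `|s|.
  move=> cs cs'; rewrite -addrA opprD addrA subrr add0r normrN.
  apply: (le_trans (ler_normD _ _)); apply: lerD.
    exact: le_trans (norm_delta_row _ _) cs.
  exact: le_trans (norm_delta_row _ _) cs'.
pose phi y := f (y + s *: delta_mx 0 j) - f y.
have dshift (c : R) : `|c| <= `|s| -> is_derive (x + c *: delta_mx 0 i) (delta_mx 0 i)
    (fun y => f (y + s *: delta_mx 0 j))
    (partial i f (x + c *: delta_mx 0 i + s *: delta_mx 0 j)).
  move=> cs; set y := x + c *: delta_mx 0 i.
  have dy : derivable f (y + s *: delta_mx 0 j) (delta_mx 0 i).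
    by apply: di; apply: le_lt_trans sr; exact: nr.
  have E : (fun h : R => h^-1 *: (f (h *: delta_mx 0 i + y + s *: delta_mx 0 j)
       - f (y + s *: delta_mx 0 j)))
    = (fun h : R => h^-1 *: (f (h *: delta_mx 0 i + (y + s *: delta_mx 0 j))
       - f (y + s *: delta_mx 0 j))).
    by apply/funext => h; rewrite [in RHS]addrA.
  by apply: DeriveDef; rewrite /partial /derivable /derive /= E.
have d0 (c : R) : `|c| <= `|s| ->
    is_derive (x + c *: delta_mx 0 i) (delta_mx 0 i) f (partial i f (x + c *: delta_mx 0 i)).
  move=> cs; apply: DeriveDef => //; apply: di; apply: le_lt_trans sr.
  by have := nr c 0 cs; rewrite scale0r addr0 normr0; apply.
have dphi (c : R) : `|c| <= `|s| -> is_derive (x + c *: delta_mx 0 i) (delta_mx 0 i) phi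
   (partial i f (x + c *: delta_mx 0 i + s *: delta_mx 0 j)
    - partial i f (x + c *: delta_mx 0 i)).
  by move=> cs; have A := dshift c cs; have B := d0 c cs; exact: is_deriveB.
have [c cs E] := @MVT_line R _ phi x (delta_mx 0 i) s (fun c cs => @ex_derive _ _ _ _ _ _ _ (dphi c cs)).
rewrite (@derive_val _ _ _ _ _ _ _ (dphi c cs)) in E.
have [|c' cs' E'] := @MVT_line R _ (partial i f) (x + c *: delta_mx 0 i) (delta_mx 0 j) s.
  by move=> c' cs'; apply: dij; apply: le_lt_trans sr; exact: nr.
exists (x + c *: delta_mx 0 i + c' *: delta_mx 0 j); first exact: nr.
by rewrite -E' -E.
Qed.

(** Both mixed derivatives, each at some point near [x], equal the same second difference divided by
    [s ^+ 2]; continuity at [x] brings the two points together. *)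
Lemma partialC U f x i j : open U -> U x -> smooth_fun U f ->
  partial i (partial j f) x = partial j (partial i f) x.
Proof.
move=> oU Ux sf; apply/eqP; rewrite -subr_eq0 -normr_le0.
apply/ler_addgt0Pr => _/posnumP[e]; rewrite add0r.
have [_ S2] := sf 2.
have Dd k y : U y -> derivable f y (delta_mx 0 k) by have [+ _] := S2 k; exact.
have Dd2 k l y : U y -> derivable (partial k f) y (delta_mx 0 l).
  by have [_ [_ /(_ l)[+ _]]] := S2 k; exact.
have Cd k l : {for x, continuous (partial l (partial k f))}.
  by have [_ [_ /(_ l)[_ [+ _]]]] := S2 k; exact.
have /cvgrPdist_le/(_ (e%:num / 2) ltac:(by [])) Hij := Cd i j.
have /cvgrPdist_le/(_ (e%:num / 2) ltac:(by [])) Hji := Cd j i.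
have nU : nbhs x U by exact: open_nbhs_nbhs.
have [r r0 Hr] := iffLR (@nbhs_norm_ltP R _ x _) (filterI nU (filterI Hij Hji)).
(* The two displacements add up to r / 2, strictly inside the ball on which the estimates hold. *)
pose s := r / 4.
have s0 : 0 < s by rewrite divr_gt0.
have sr : `|s| + `|s| < r by rewrite gtr0_norm// /s; lra.
have [y yx Ey] := @mixed_increment f x i j r s
  (fun y yr => Dd i y (Hr y yr).1) (fun y yr => Dd2 i j y (Hr y yr).1) sr.
have [z zx Ez] := @mixed_increment f x j i r s
  (fun y yr => Dd j y (Hr y yr).1) (fun y yr => Dd2 j i y (Hr y yr).1) sr.
have Eyz : partial j (partial i f) y = partial i (partial j f) z.
  apply: (mulfI (lt0r_neq0 s0)); apply: (mulfI (lt0r_neq0 s0)).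
  have K (a b c a' : R) : a - b - (c - a') = a - c - (b - a') by ring.
  by rewrite -Ey -Ez [x + s *: delta_mx 0 j + _]addrAC; exact: K.
have [_ [/= H1 _]] := Hr y (le_lt_trans yx sr).
have [_ [_ /= H2]] := Hr z (le_lt_trans zx sr).
have -> : partial i (partial j f) x - partial j (partial i f) x =
  (partial i (partial j f) x - partial i (partial j f) z)
  - (partial j (partial i f) x - partial j (partial i f) y).
  have K (a b c : R) : a - b = a - c - (b - c) by ring.
  by rewrite Eyz; exact: K.
apply: le_trans (ler_normB _ _) _.
by rewrite [leRHS]splitr; exact: lerD H2 H1.
Qed.

End Schwarz.

Section SmoothFun.
Context {R : realType} {d : nat}.
Implicit Types (U : set 'rV[R]_d) (f g : 'rV[R]_d -> R) (x : 'rV[R]_d).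

Lemma smooth_cover U f :
  (forall x, U x -> exists2 W, W x & smooth_fun W f) -> smooth_fun U f.
Proof. by move=> H k; apply: Ck_cover => x /H[W Wx sW]; exists W. Qed.

Lemma smooth_sub U U' f : U' `<=` U -> smooth_fun U f -> smooth_fun U' f.
Proof. by move=> UU' sf k; exact: Ck_sub (sf k). Qed.

Lemma smooth_ext U f g : open U -> (forall y, U y -> f y = g y) ->
  smooth_fun U f -> smooth_fun U g.
Proof. by move=> oU E sf k; exact: Ck_ext (sf k). Qed.

Lemma smooth_cst U (c : R) : smooth_fun U (cst c).
Proof. by move=> k; exact: Ck_cst. Qed.

Lemma smooth_coord U j : smooth_fun U (fun y => y 0 j).
Proof. by move=> k; exact: Ck_coord. Qed.

Lemma smoothD U f g : open U -> smooth_fun U f -> smooth_fun U g ->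
  smooth_fun U (fun x => f x + g x).
Proof. by move=> oU sf sg k; exact: CkD. Qed.

Lemma smoothM U f g : open U -> smooth_fun U f -> smooth_fun U g ->
  smooth_fun U (fun x => f x * g x).
Proof. by move=> oU sf sg k; exact: CkM. Qed.

Lemma smoothN U f : open U -> smooth_fun U f -> smooth_fun U (fun x => - f x).
Proof. by move=> oU sf k; exact: CkN. Qed.

Lemma smoothB U f g : open U -> smooth_fun U f -> smooth_fun U g ->
  smooth_fun U (fun x => f x - g x).
Proof. by move=> oU sf sg; apply: smoothD => //; exact: smoothN. Qed.

Lemma smoothV U f : open U -> (forall x, U x -> f x != 0) ->
  smooth_fun U f -> smooth_fun U (fun x => (f x)^-1).
Proof. by move=> oU f0 sf k; exact: CkV. Qed.

Lemma smooth_sum U (I : Type) (r : seq I) (P : pred I) (f : I -> 'rV[R]_d -> R) :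
  open U -> (forall i, P i -> smooth_fun U (f i)) ->
  smooth_fun U (fun x => \sum_(i <- r | P i) f i x).
Proof. by move=> oU sf k; apply: Ck_sum => // i Pi; exact: sf. Qed.

Lemma smooth_prod U (I : Type) (r : seq I) (P : pred I) (f : I -> 'rV[R]_d -> R) :
  open U -> (forall i, P i -> smooth_fun U (f i)) ->
  smooth_fun U (fun x => \prod_(i <- r | P i) f i x).
Proof. by move=> oU sf k; apply: Ck_prod => // i Pi; exact: sf. Qed.

Lemma smooth_partial U f i : smooth_fun U f -> smooth_fun U (partial i f).
Proof. by move=> sf k; have [_ /(_ i)[]] := sf k.+1. Qed.

Lemma smooth_derivable U f x i : smooth_fun U f -> U x ->
  derivable f x (delta_mx 0 i).
Proof. by move=> sf Ux; have [_ /(_ i)[+ _]] := sf 1; exact. Qed.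

Lemma smooth_differentiable U f x : open U -> smooth_fun U f -> U x ->
  differentiable f x.
Proof. by move=> oU sf Ux; exact: Ck_differentiable (sf 1). Qed.

Lemma smooth_continuous U f x : smooth_fun U f -> U x -> {for x, continuous f}.
Proof. by move=> sf Ux; have [+ _] := sf 0; exact. Qed.

Lemma smooth_det U n (A : 'rV[R]_d -> 'M[R]_n) : open U ->
  (forall i j, smooth_fun U (fun x => A x i j)) -> smooth_fun U (fun x => \det (A x)).
Proof.
move=> oU sA; apply: (@smooth_sum U _ (index_enum {perm 'I_n}) xpredT
  (fun s x => (-1) ^+ s * \prod_i A x i (s i)) oU) => s _.
apply: (@smoothM _ (cst ((-1) ^+ s)) (fun x => \prod_i A x i (s i)) oU).
  exact: smooth_cst.
by apply: (@smooth_prod U _ _ xpredT (fun i x => A x i (s i)) oU) => i _; exact: sA.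
Qed.

Lemma smooth_invmx U n (A : 'rV[R]_d -> 'M[R]_n) : open U ->
  (forall i j, smooth_fun U (fun x => A x i j)) ->
  (forall x, U x -> A x \in unitmx) ->
  forall i j, smooth_fun U (fun x => invmx (A x) i j).
Proof.
move=> oU sA uA i j.
apply: (@smooth_ext _ (fun x => (\det (A x))^-1 * cofactor (A x) j i)) => //.
  by move=> x Ux; rewrite /invmx uA// !mxE.
apply: smoothM => //.
  by apply: smoothV => // [x /uA|]; [rewrite unitmxE unitfE|exact: smooth_det].
apply: (@smoothM _ (cst _) (fun x => \det (row' j (col' i (A x)))) oU).
  exact: smooth_cst.
by apply: smooth_det => // k l; under eq_fun do rewrite !mxE; exact: sA.
Qed.

Lemma smooth_mulmx U m n p (A : 'rV[R]_d -> 'M[R]_(m, n)) (B : 'rV[R]_d -> 'M[R]_(n, p)) :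
  open U ->
  (forall i j, smooth_fun U (fun x => A x i j)) ->
  (forall i j, smooth_fun U (fun x => B x i j)) ->
  forall i j, smooth_fun U (fun x => (A x *m B x) i j).
Proof.
move=> oU sA sB i j; under eq_fun do rewrite mxE.
by apply: smooth_sum => // k _; exact: smoothM.
Qed.

Lemma smooth_jac U e (f : 'rV[R]_d -> 'rV[R]_e) :
  smooth_vfun U f -> forall i j, smooth_fun U (fun x => jac f x i j).
Proof.
by move=> sf i j; under eq_fun do rewrite mxE; apply: smooth_partial; exact: sf.
Qed.

Lemma smooth_vdifferentiable U e (f : 'rV[R]_d -> 'rV[R]_e) x :
  open U -> smooth_vfun U f -> U x -> differentiable f x.
Proof.
move=> oU sf Ux; apply: differentiable_row => j.
exact: smooth_differentiable (sf j) Ux.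
Qed.

Lemma smooth_vcontinuous U e (f : 'rV[R]_d -> 'rV[R]_e) x :
  smooth_vfun U f -> U x -> {for x, continuous f}.
Proof.
move=> sf Ux; apply: continuous_mx => i j; rewrite ord1.
exact: smooth_continuous (sf j) Ux.
Qed.

Lemma jac_ext U e (f g : 'rV[R]_d -> 'rV[R]_e) x : open U -> U x ->
  (forall y, U y -> f y = g y) -> jac f x = jac g x.
Proof.
move=> oU Ux E; apply/matrixP => i j; rewrite !mxE.
by apply: (partial_ext _ oU Ux) => y /E ->.
Qed.

Lemma jac_id x : jac (fun y => y) x = 1%:M :> 'M[R]_d.
Proof. by apply/matrixP => i j; rewrite !mxE partial_coord. Qed.

End SmoothFun.

Section SmoothComp.
Context {R : realType} {d e : nat}.
Implicit Types (U : set 'rV[R]_d) (V : set 'rV[R]_e) (phi : 'rV[R]_d -> 'rV[R]_e).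

Lemma smooth_comp U V (f : 'rV[R]_e -> R) phi :
  open U -> open V -> (forall x, U x -> V (phi x)) ->
  smooth_vfun U phi -> smooth_fun V f -> smooth_fun U (fun x => f (phi x)).
Proof. by move=> oU oV UV sp sf k; apply: (Ck_comp oU oV) => // j; exact: sp. Qed.

Lemma smooth_vcomp l U V (f : 'rV[R]_e -> 'rV[R]_l) phi :
  open U -> open V -> (forall x, U x -> V (phi x)) ->
  smooth_vfun U phi -> smooth_vfun V f -> smooth_vfun U (fun x => f (phi x)).
Proof.
move=> oU oV UV sp sf j.
exact: (@smooth_comp _ _ (fun z => f z 0 j) _ oU oV UV sp (sf j)).
Qed.

Lemma partial_compE (f : 'rV[R]_e -> R) phi x i :
  differentiable phi x -> differentiable f (phi x) ->
  partial i (fun y => f (phi y)) x = \sum_j jac phi x i j * partial j f (phi x).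
Proof.
move=> dp df; have := partial_comp i dp df; rewrite /comp => ->.
by apply: eq_bigr => j _; rewrite mxE.
Qed.

Lemma jac_compE l (f : 'rV[R]_e -> 'rV[R]_l) phi x :
  differentiable phi x -> (forall j, differentiable (fun y => f y 0 j) (phi x)) ->
  jac (fun y => f (phi y)) x = jac phi x *m jac f (phi x).
Proof.
move=> dp df; apply/matrixP => i j; rewrite !mxE.
rewrite (@partial_compE (fun y => f y 0 j))//; apply: eq_bigr => k _.
by rewrite !mxE.
Qed.

Lemma affine_smooth U (A : 'M[R]_(d, e)) (b : 'rV[R]_e) :
  open U -> smooth_vfun U (fun x => b + x *m A).
Proof.
move=> oU j.
apply: (@smooth_ext _ _ _ (fun x => b 0 j + \sum_k x 0 k * A k j)) => //.
  by move=> x _; rewrite !mxE.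
apply: smoothD => //; first exact: smooth_cst.
by apply: smooth_sum => // k _; apply: smoothM => //; [exact: smooth_coord|exact: smooth_cst].
Qed.

Lemma jac_affine (A : 'M[R]_(d, e)) (b : 'rV[R]_e) x : jac (fun x => b + x *m A) x = A.
Proof.
apply/matrixP => i j; rewrite !mxE /partial.
have D k : derivable (fun y : 'rV[R]_d => y 0 k * A k j) x (delta_mx 0 i).
  apply: (@derivableM _ _ (fun y : 'rV[R]_d => y 0 k) (cst (A k j))).
    exact: derivable_coord.
  exact: derivable_cst.
have -> : (fun y : 'rV[R]_d => (b + y *m A) 0 j) =
   cst (b 0 j) + \sum_(k < d) (fun y : 'rV[R]_d => y 0 k * A k j).
  by apply/funext => y; rewrite !mxE fctE fct_sumE.
rewrite deriveD; [|exact: derivable_cst|exact: derivable_sum].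
rewrite derive_cst add0r derive_sum// (bigD1 i)//= big1 ?addr0.
  rewrite (@deriveM _ _ (fun y : 'rV[R]_d => y 0 i) (cst (A i j))); [|exact: derivable_coord|exact: derivable_cst].
  rewrite derive_cst scaler0 add0r [X in _ *: X](partial_coord i i x) eqxx.
  by rewrite /cst; exact: mulr1.
move=> k /negPf ki.
rewrite (@deriveM _ _ (fun y : 'rV[R]_d => y 0 k) (cst (A k j))); [|exact: derivable_coord|exact: derivable_cst].
rewrite derive_cst scaler0 add0r [X in _ *: X](partial_coord k i x) eq_sym ki.
exact: scaler0.
Qed.

End SmoothComp.

(** * Positive definite forms and tensor norms *)

Section PositiveDefinite.
Context {R : rcfType}.

Definition posdef {n : nat} (g : 'M[R]_n) : Prop :=
  g^T = g /\ forall v : 'rV[R]_n, v != 0 -> 0 < (v *m g *m v^T) 0 0.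

Lemma posdef_congr n (g L : 'M[R]_n) :
  L \in unitmx -> posdef g -> posdef (L *m g *m L^T).
Proof.
move=> uL [sg pg]; split; first by rewrite !trmx_mul trmxK sg mulmxA.
move=> v v0; have := pg (v *m L); rewrite trmx_mul !mulmxA; apply.
by apply: contra v0 => /eqP vL; rewrite -(mulmxK uL v) vL mul0mx.
Qed.

Lemma posdef_unitmx n (g : 'M[R]_n) : posdef g -> g \in unitmx.
Proof.
move=> [_ pg]; rewrite -row_free_unit -kermx_eq0; apply/rowV0P => v /sub_kermxP vg.
by apply/eqP; apply: contraT => /pg; rewrite vg mul0mx mxE ltxx.
Qed.

Lemma posdef_drsub n (g : 'M[R]_(1 + n)) : posdef g -> posdef (drsubmx g).
Proof.
move=> [sg pg]; split; first by rewrite trmx_drsub sg.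
move=> v v0; pose w : 'rV[R]_(1 + n) := row_mx 0 v.
have -> : v *m drsubmx g *m v^T = w *m g *m w^T.
  rewrite -[in RHS](submxK g) tr_row_mx mul_row_block mul_row_col trmx0 mulmx0.
  by rewrite !mul0mx !add0r.
by apply: pg; apply: contra v0 => /eqP; rewrite -row_mx0 => /eq_row_mx[_ ->].
Qed.

Lemma schur_block n (a : R) (b : 'M[R]_(n, 1)) (c : 'M[R]_n) : a != 0 ->
  (block_mx 1%:M 0 (- (a^-1 *: b)) 1%:M : 'M[R]_(1 + n))
    *m block_mx a%:M b^T b c *m (block_mx 1%:M 0 (- (a^-1 *: b)) 1%:M)^T
  = block_mx a%:M 0 0 (c - a^-1 *: (b *m b^T)).
Proof.
move=> a0.
have bT : (a^-1 *: b)^T = a^-1 *: b^T by rewrite linearZ.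
have aa : a^-1 *: b *m a%:M = b.
  by rewrite mul_mx_scalar scalerA mulfV// scale1r.
rewrite tr_block_mx !mulmx_block !trmx1 !trmx0 linearN /= bT.
rewrite !mulmx1 !mul1mx !mulmx0 !mul0mx !addr0 !mulNmx aa addNr mul0mx add0r.
congr block_mx.
  by rewrite mulmxN mul_scalar_mx scalerA mulfV// scale1r addNr.
by rewrite addrC -scalemxAl.
Qed.

Lemma diag_block_congr n (a s : R) (g L : 'M[R]_n) :
  s * a * s = 1 -> L *m g *m L^T = 1%:M ->
  (block_mx s%:M 0 0 L : 'M[R]_(1 + n)) *m block_mx a%:M 0 0 g
    *m (block_mx s%:M 0 0 L)^T = 1%:M.
Proof.
move=> ssa LE; rewrite tr_block_mx !mulmx_block !trmx0 !mulmx0 !mul0mx.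
by rewrite !addr0 !add0r !mul0mx LE tr_scalar_mx -!scalar_mxM ssa [RHS]scalar_mx_block.
Qed.

(** Gram-Schmidt by induction on the size: [E] clears the first row and column, the Schur complement
    [g'] is again positive definite, and [s] normalizes the first vector. *)
Lemma posdef_orthonormal n (g : 'M[R]_n) : posdef g ->
  exists2 L : 'M[R]_n, L \in unitmx & L *m g *m L^T = 1%:M.
Proof.
elim: n g => [|n IH] g pg.
  by exists 1%:M; [exact: unitmx1|apply/matrixP => -[]].
pose a := (g : 'M[R]_(1 + n)) 0 0.
have a0 : 0 < a.
  have [_ /(_ (delta_mx 0 0))] := pg; rewrite -rowE mxE => H.
  have : (delta_mx 0 0 : 'rV[R]_n.+1) != 0.
    by apply/eqP => /matrixP/(_ 0 0); rewrite !mxE !eqxx; apply/eqP; exact: oner_neq0.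
  move/H; rewrite (bigD1 0)//= big1 => [|j j0].
    by rewrite !mxE !eqxx mulr1 addr0.
  by rewrite !mxE eqxx (negPf j0) mulr0.
pose b : 'M[R]_(n, 1) := dlsubmx (g : 'M[R]_(1 + n)).
pose E : 'M[R]_(1 + n) := block_mx 1%:M 0 (- (a^-1 *: b)) 1%:M.
have uE : E \in unitmx by rewrite unitmxE det_lblock !det1 mulr1 unitr1.
have ul : ulsubmx (g : 'M[R]_(1 + n)) = a%:M.
  rewrite [LHS]mx11_scalar; congr (_%:M); rewrite !mxE /a; congr (g _ _); exact: val_inj.
have ur : ursubmx (g : 'M[R]_(1 + n)) = b^T.
  by rewrite /b trmx_dlsub pg.1.
pose dd := drsubmx (g : 'M[R]_(1 + n)).
have gB : (g : 'M[R]_(1 + n)) = block_mx a%:M b^T b dd.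
  by rewrite -ul -ur /b /dd submxK.
pose g' := dd - a^-1 *: (b *m b^T).
have Eg' : E *m (g : 'M[R]_(1 + n)) *m E^T = block_mx a%:M 0 0 g'.
  by rewrite gB; apply: schur_block; rewrite lt0r_neq0.
have pg' : posdef g'.
  by have := posdef_drsub (posdef_congr uE pg); rewrite Eg' block_mxKdr.
have [L' uL' L'E] := IH _ pg'.
pose s := (Num.sqrt a)^-1.
have s0 : s != 0 by rewrite invr_eq0 gt_eqF// sqrtr_gt0.
have ssa : s * a * s = 1.
  by rewrite mulrAC -expr2 /s exprVn sqr_sqrtr ?mulVf ?lt0r_neq0// ltW.
pose F : 'M[R]_(1 + n) := block_mx s%:M 0 0 L'.
have uF : F \in unitmx.
  by rewrite unitmxE det_ublock det_scalar1 unitrM unitfE s0 -unitmxE.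
exists (F *m E); first by rewrite unitmx_mul uF.
have H : F *m (E *m (g : 'M[R]_(1 + n)) *m E^T) *m F^T = 1%:M.
  by rewrite Eg'; exact: diag_block_congr.
by rewrite trmx_mul; move: H; rewrite !mulmxA.
Qed.

(* With B = L A L^T the trace is -|B|^2. *)
Lemma trace_sqr_antisym_lt0 n (g A : 'M[R]_n) : posdef g -> A^T = - A -> A != 0 ->
  \tr (A *m invmx g *m (A *m invmx g)) < 0.
Proof.
move=> pg aA A0; have [L uL LE] := posdef_orthonormal pg.
have ug := posdef_unitmx pg.
have uLT : L^T \in unitmx by rewrite unitmx_tr.
have hE : invmx g = L^T *m L.
  apply: (can_inj (mulKmx ug)); rewrite mulmxV// mulmxA.
  apply: (can_inj (mulKmx uL)); apply: (can_inj (mulmxK uLT)).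
  by rewrite !mulmxA LE mulmx1 mul1mx.
pose B := L *m A *m L^T.
have aB : B^T = - B by rewrite /B !trmx_mul trmxK aA !(mulmxN, mulNmx) mulmxA.
have -> : \tr (A *m invmx g *m (A *m invmx g)) = \tr (B *m B).
  rewrite hE /B [in RHS]mxtrace_mulC.
  by rewrite -[in RHS](mulmxA L) -(mulmxA L) [in RHS]mxtrace_mulC !mulmxA.
have -> : \tr (B *m B) = - \sum_i \sum_j B i j ^+ 2.
  rewrite /mxtrace -sumrN; apply: eq_bigr => i _; rewrite mxE -sumrN.
  apply: eq_bigr => j _; have /matrixP/(_ i j) := aB; rewrite !mxE => ->.
  by rewrite mulrN expr2.
rewrite oppr_lt0 lt_neqAle eq_sym sumr_ge0 ?andbT; last first.
  by move=> i _; apply: sumr_ge0 => j _; exact: sqr_ge0.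
apply: contra A0 => /eqP H.
have B0 : B = 0.
  apply/matrixP => i j; rewrite [RHS]mxE; apply/eqP; rewrite -sqrf_eq0; apply/eqP.
  have /psumr_eq0P := H => /(_ _ i isT) H1.
  have H2 : \sum_j B i j ^+ 2 = 0.
    by apply: H1 => k _; apply: sumr_ge0 => l _; exact: sqr_ge0.
  by move/psumr_eq0P : H2 => -> // k _; exact: sqr_ge0.
rewrite -(mulKmx uL A) -(mulmxK uLT (L *m A)) -/B B0.
by rewrite mul0mx mulmx0.
Qed.

End PositiveDefinite.

(** * Norms of tensors with three lower indices and one upper index *)

Section TensorNorm.
Context {R : comUnitRingType} {d : nat}.
Implicit Types (h g D E : 'M[R]_d) (T : 'I_d -> 'I_d -> 'I_d -> 'I_d -> R).

Definition contract h (F : 'I_d -> 'I_d -> R) := \sum_i \sum_i' h i i' * F i i'.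

(** In the applications [h] is the inverse of [g]: it contracts the three lower indices, and [g] the
    upper one. Nested contractions, unlike a single eightfold sum, let each index be transformed
    separately. *)
Definition tensor_sqnorm h g T :=
  contract h (fun i i' => contract h (fun j j' => contract h (fun k k' =>
    contract g (fun l l' => T i j k l * T i' j' k' l')))).

Lemma eq_contract h F G : (forall i i', F i i' = G i i') -> contract h F = contract h G.
Proof. by move=> E; apply: eq_bigr => i _; apply: eq_bigr => i' _; rewrite E. Qed.

Lemma contract_sum h (u v : 'I_d -> R) (G : 'I_d -> 'I_d -> 'I_d -> 'I_d -> R) :
  contract h (fun i i' => \sum_a \sum_b u a * v b * G a b i i') =
  \sum_a \sum_b u a * v b * contract h (G a b).
Proof.
rewrite /contract; under [LHS]eq_bigr => i _.
  under eq_bigr => i' _ do rewrite mulr_sumr.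
  rewrite exchange_big /=; over.
rewrite exchange_big /=; apply: eq_bigr => a _.
under [LHS]eq_bigr => i _.
  under eq_bigr => i' _ do rewrite mulr_sumr.
  rewrite exchange_big /=; over.
rewrite exchange_big /=; apply: eq_bigr => b _; rewrite mulr_sumr.
apply: eq_bigr => i _; rewrite mulr_sumr; apply: eq_bigr => i' _.
by rewrite mulrCA.
Qed.

Lemma contract_congr h D F G :
  (forall i i', F i i' = \sum_a \sum_b D i a * D i' b * G a b) ->
  contract h F = contract (D^T *m h *m D) G.
Proof.
move=> FG; rewrite /contract.
under eq_bigr => i _ do under eq_bigr => i' _ do rewrite FG mulr_sumr.
under eq_bigr => i _ do rewrite exchange_big /=.
rewrite exchange_big /=; apply: eq_bigr => a _.
under eq_bigr => i _ do under eq_bigr => i' _ do rewrite mulr_sumr.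
under eq_bigr => i _ do rewrite exchange_big /=.
rewrite exchange_big /=; apply: eq_bigr => b _.
rewrite !mxE mulr_suml exchange_big /=; apply: eq_bigr => i' _.
rewrite !mxE !mulr_suml; apply: eq_bigr => i _; rewrite !mxE; ring.
Qed.

Lemma tensor_sqnorm_congr h g D E T T' :
  (forall i j k l, T i j k l = \sum_a D i a * \sum_b D j b * \sum_c D k c *
     \sum_e E e l * T' a b c e) ->
  tensor_sqnorm h g T = tensor_sqnorm (D^T *m h *m D) (E *m g *m E^T) T'.
Proof.
move=> TT'.
(* [T3], [T2] and [T1] are [T'] with its last one, two and three indices transformed; each round of
   [contract_congr] below peels off the outermost matrix. The transpose of [E] puts the upper index
   into the form that this lemma expects. *)
pose T3 a b c l := \sum_e E^T l e * T' a b c e.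
pose T2 a b k l := \sum_c D k c * T3 a b c l.
pose T1 a j k l := \sum_b D j b * T2 a b k l.
have T0E i j k l : T i j k l = \sum_a D i a * T1 a j k l.
  rewrite TT'; apply: eq_bigr => a _; congr (_ * _).
  apply: eq_bigr => b _; congr (_ * _); apply: eq_bigr => c _; congr (_ * _).
  by apply: eq_bigr => e _; rewrite mxE.
have prod (u v X X' : 'I_d -> R) : (\sum_a u a * X a) * (\sum_b v b * X' b) =
    \sum_a \sum_b u a * v b * (X a * X' b).
  rewrite big_distrl /=; apply: eq_bigr => a _; rewrite big_distrr /=.
  by apply: eq_bigr => b _; ring.
rewrite /tensor_sqnorm; apply: contract_congr => i i'.
under eq_contract => j j' do under eq_contract => k k' do
  under eq_contract => l l' do rewrite !T0E prod.
under eq_contract => j j' do under eq_contract => k k' do rewrite contract_sum.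
under eq_contract => j j' do rewrite contract_sum.
rewrite contract_sum; apply: eq_bigr => a _; apply: eq_bigr => a' _; congr (_ * _).
apply: contract_congr => j j'.
under eq_contract => k k' do under eq_contract => l l' do rewrite prod.
under eq_contract => k k' do rewrite contract_sum.
rewrite contract_sum; apply: eq_bigr => b _; apply: eq_bigr => b' _; congr (_ * _).
apply: contract_congr => k k'.
under eq_contract => l l' do rewrite prod.
rewrite contract_sum; apply: eq_bigr => c _; apply: eq_bigr => c' _; congr (_ * _).
by rewrite -{1}(trmxK E); apply: contract_congr => l l'; rewrite prod.
Qed.

Lemma tensor_sqnormE h g T :
  \sum_i \sum_i' \sum_j \sum_j' \sum_k \sum_k' \sum_l \sum_l'
    h i i' * h j j' * h k k' * g l l' * T i j k l * T i' j' k' l' =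
  tensor_sqnorm h g T.
Proof.
rewrite /tensor_sqnorm /contract.
apply: eq_bigr => i _; apply: eq_bigr => i' _.
rewrite mulr_sumr; apply: eq_bigr => j _.
rewrite mulr_sumr; apply: eq_bigr => j' _; rewrite !mulr_sumr.
apply: eq_bigr => k _; rewrite !mulr_sumr; apply: eq_bigr => k' _; rewrite !mulr_sumr.
apply: eq_bigr => l _; rewrite !mulr_sumr; apply: eq_bigr => l' _.
by rewrite !mulrA.
Qed.

End TensorNorm.

Section TensorNormPos.
Context {R : rcfType} {d : nat}.
Implicit Types (g : 'M[R]_d) (T : 'I_d -> 'I_d -> 'I_d -> 'I_d -> R).

Lemma contract_id (F : 'I_d -> 'I_d -> R) : contract 1%:M F = \sum_i F i i.
Proof.
apply: eq_bigr => i _; rewrite (bigD1 i)//= big1 => [|j ji].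
  by rewrite mxE eqxx mul1r addr0.
by rewrite mxE eq_sym (negPf ji) mul0r.
Qed.

Lemma sum_mulmx_id (D L : 'M[R]_d) (X : 'I_d -> R) i : D *m L = 1%:M ->
  \sum_a D i a * (\sum_k L a k * X k) = X i.
Proof.
move=> DL; under eq_bigr => a _ do rewrite mulr_sumr.
rewrite exchange_big /= (bigD1 i)//= [X in _ + X]big1 => [|k ki].
  under eq_bigr => a _ do rewrite mulrA.
  by rewrite -mulr_suml addr0; have /matrixP/(_ i i) := DL; rewrite !mxE eqxx => ->; rewrite mul1r.
under eq_bigr => a _ do rewrite mulrA.
rewrite -mulr_suml; have /matrixP/(_ i k) := DL; rewrite !mxE eq_sym (negPf ki) => ->.
by rewrite mul0r.
Qed.

(** In the orthonormal frame formed by the rows of [L] both matrices of the contraction become the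
    identity, and the norm is the sum of the squares of the components [T']. *)
Lemma tensor_sqnorm_gt0 g T i j k l : posdef g -> T i j k l != 0 ->
  0 < tensor_sqnorm (invmx g) g T.
Proof.
move=> pg T0; have [L uL LE] := posdef_orthonormal pg.
have ug := posdef_unitmx pg.
have uLT : L^T \in unitmx by rewrite unitmx_tr.
pose D := invmx L.
have DL : D *m L = 1%:M by rewrite mulVmx.
have LD : L *m D = 1%:M by rewrite mulmxV.
pose T' a b c e := \sum_i L a i * \sum_j L b j * \sum_k L c k *
  \sum_l D^T e l * T i j k l.
(* Transforming to the frame and back: each [transitivity] cancels one pair [D *m L], and the
   innermost one reorders the sums. *)
have TE i' j' k' l' : T i' j' k' l' = \sum_a D i' a * \sum_b D j' b * \sum_c D k' c *
     \sum_e L e l' * T' a b c e.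
  symmetry.
  transitivity (\sum_a D i' a * \sum_i L a i * T i j' k' l'); last exact: sum_mulmx_id.
  apply: eq_bigr => a _; congr (_ * _).
  transitivity (\sum_b D j' b * \sum_j L b j * \sum_i L a i * T i j k' l'); last exact: sum_mulmx_id.
  apply: eq_bigr => b _; congr (_ * _).
  transitivity (\sum_c D k' c * \sum_k L c k * \sum_j L b j * \sum_i L a i * T i j k l'); last exact: sum_mulmx_id.
  apply: eq_bigr => c _; congr (_ * _).
  transitivity (\sum_e L^T l' e * \sum_l D^T e l * \sum_k L c k * \sum_j L b j * \sum_i L a i * T i j k l).
    apply: eq_bigr => e _; rewrite mxE; congr (_ * _); rewrite /T'.
    under eq_bigr => i1 _ do (rewrite mulr_sumr; under eq_bigr => j1 _ do
      (rewrite !mulr_sumr; under eq_bigr => k1 _ do rewrite !mulr_sumr)).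
    under [RHS]eq_bigr => l1 _ do (rewrite mulr_sumr; under eq_bigr => k1 _ do
      (rewrite !mulr_sumr; under eq_bigr => j1 _ do rewrite !mulr_sumr)).
    rewrite [RHS]exchange_big /=; under [RHS]eq_bigr => k1 _ do rewrite exchange_big /=.
    under [RHS]eq_bigr => k1 _ do under eq_bigr => j1 _ do rewrite exchange_big /=.
    rewrite [RHS]exchange_big /=; under [RHS]eq_bigr => j1 _ do rewrite exchange_big /=.
    rewrite [RHS]exchange_big /=; apply: eq_bigr => i1 _; apply: eq_bigr => j1 _.
    by apply: eq_bigr => k1 _; apply: eq_bigr => l1 _; ring.
  by apply: sum_mulmx_id; rewrite -trmx_mul DL trmx1.
have gE : L *m g *m L^T = 1%:M := LE.
have hE : D^T *m invmx g *m D = 1%:M.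
  have -> : invmx g = L^T *m L.
    apply: (can_inj (mulKmx ug)); rewrite mulmxV// mulmxA.
    apply: (can_inj (mulKmx uL)); apply: (can_inj (mulmxK uLT)).
    by rewrite !mulmxA LE mulmx1 mul1mx.
  by rewrite !mulmxA -trmx_mul LD trmx1 mul1mx.
rewrite (tensor_sqnorm_congr _ _ TE) hE gE /tensor_sqnorm contract_id.
under eq_bigr => a _ do (rewrite contract_id; under eq_bigr => b _ do
  (rewrite contract_id; under eq_bigr => c _ do rewrite contract_id)).
have ge0 (a b c e : 'I_d) : 0 <= T' a b c e * T' a b c e by rewrite -expr2 sqr_ge0.
rewrite lt_neqAle eq_sym; apply/andP; split; last first.
  by apply: sumr_ge0 => a _; apply: sumr_ge0 => b _; apply: sumr_ge0 => c _; apply: sumr_ge0.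
apply: contra T0 => /eqP H; rewrite TE.
suff T'0 a b c e : T' a b c e = 0.
  rewrite big1// => a _; rewrite big1 ?mulr0// => b _; rewrite big1 ?mulr0// => c _.
  by rewrite big1 ?mulr0// => e _; rewrite T'0 mulr0.
have S0 (F : 'I_d -> R) : (forall i, 0 <= F i) -> \sum_i F i = 0 -> forall i, F i = 0.
  by move=> F0 /psumr_eq0P FF i0; apply: FF.
have ge3 a' b' c' : 0 <= \sum_i T' a' b' c' i * T' a' b' c' i by apply: sumr_ge0.
have ge2 a' b' : 0 <= \sum_c \sum_i T' a' b' c i * T' a' b' c i by apply: sumr_ge0.
have ge1 a' : 0 <= \sum_b \sum_c \sum_i T' a' b c i * T' a' b c i by apply: sumr_ge0.
have H4 := S0 _ (ge0 a b c) (S0 _ (ge3 a b) (S0 _ (ge2 a) (S0 _ ge1 H a) b) c) e.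
by move/eqP: H4; rewrite mulf_eq0 orbb => /eqP.
Qed.

End TensorNormPos.

(** * Curvature and coordinate changes *)

Section MatrixPartial.
Context {R : realType} {d : nat}.
Implicit Types (U : set 'rV[R]_d) (x : 'rV[R]_d).

Definition smooth_mx {m n : nat} U (A : 'rV[R]_d -> 'M[R]_(m, n)) : Prop :=
  forall j k, smooth_fun U (fun x => A x j k).

Definition mpartial {m n : nat} (i : 'I_d) (A : 'rV[R]_d -> 'M[R]_(m, n)) x : 'M[R]_(m, n) :=
  \matrix_(j, k) partial i (fun y => A y j k) x.

Lemma smooth_mpartial m n U (A : 'rV[R]_d -> 'M[R]_(m, n)) i :
  smooth_mx U A -> smooth_mx U (mpartial i A).
Proof.
by move=> sA j k; rewrite /mpartial; under eq_fun do rewrite mxE; apply: smooth_partial; exact: sA.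
Qed.

Lemma smooth_mx_mul m n p U (A : 'rV[R]_d -> 'M[R]_(m, n)) (B : 'rV[R]_d -> 'M[R]_(n, p)) :
  open U -> smooth_mx U A -> smooth_mx U B -> smooth_mx U (fun x => A x *m B x).
Proof. by move=> oU sA sB; exact: smooth_mulmx. Qed.

Lemma smooth_mxD m n U (A B : 'rV[R]_d -> 'M[R]_(m, n)) :
  open U -> smooth_mx U A -> smooth_mx U B -> smooth_mx U (fun x => A x + B x).
Proof.
by move=> oU sA sB j k; under eq_fun do rewrite mxE; exact: (smoothD oU (sA j k) (sB j k)).
Qed.

Lemma smooth_mxZ m n U (f : 'rV[R]_d -> R) (A : 'rV[R]_d -> 'M[R]_(m, n)) :
  open U -> smooth_fun U f -> smooth_mx U A -> smooth_mx U (fun x => f x *: A x).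
Proof.
by move=> oU sf sA j k; under eq_fun do rewrite mxE; exact: (smoothM oU sf (sA j k)).
Qed.

Lemma smooth_mx_sum m n U (I : Type) (r : seq I) (A : I -> 'rV[R]_d -> 'M[R]_(m, n)) :
  open U -> (forall i, smooth_mx U (A i)) -> smooth_mx U (fun x => \sum_(i <- r) A i x).
Proof.
move=> oU sA j k; under eq_fun do rewrite summxE.
by apply: (@smooth_sum _ _ U _ r xpredT (fun i x => A i x j k)) => // i _; exact: sA.
Qed.

Lemma smooth_mx_tr m n U (A : 'rV[R]_d -> 'M[R]_(m, n)) :
  smooth_mx U A -> smooth_mx U (fun x => (A x)^T).
Proof. by move=> sA j k; under eq_fun do rewrite mxE; exact: sA. Qed.

Lemma mpartial_ext m n U (A B : 'rV[R]_d -> 'M[R]_(m, n)) i x : open U -> U x ->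
  (forall y, U y -> A y = B y) -> mpartial i A x = mpartial i B x.
Proof.
move=> oU Ux E; apply/matrixP => j k; rewrite !mxE.
by apply: (partial_ext _ oU Ux) => y /E ->.
Qed.

Lemma mpartial_tr m n (A : 'rV[R]_d -> 'M[R]_(m, n)) i x :
  mpartial i (fun y => (A y)^T) x = (mpartial i A x)^T.
Proof. by apply/matrixP => j k; rewrite !mxE; congr ('D__ _ x); apply/funext => y; rewrite mxE. Qed.

Lemma mpartial_cst m n (A : 'M[R]_(m, n)) i x : mpartial i (cst A) x = 0.
Proof. by apply/matrixP => j k; rewrite !mxE /partial derive_cst. Qed.

Lemma partial_sum (I : Type) (r : seq I) (f : I -> 'rV[R]_d -> R) i x :
  (forall k, derivable (f k) x (delta_mx 0 i)) ->
  partial i (fun y => \sum_(k <- r) f k y) x = \sum_(k <- r) partial i (f k) x /\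
  derivable (fun y => \sum_(k <- r) f k y) x (delta_mx 0 i).
Proof.
move=> df; elim: r => [|k r [IH1 IH2]].
  rewrite big_nil; have -> : (fun y => \sum_(k <- [::]) f k y) = cst 0.
    by apply/funext => y; rewrite big_nil.
  by rewrite /partial derive_cst; split=> //; exact: derivable_cst.
have -> : (fun y => \sum_(j <- k :: r) f j y) = f k + (fun y => \sum_(j <- r) f j y).
  by apply/funext => y; rewrite big_cons.
split; last exact: derivableD.
by rewrite big_cons -IH1 /partial deriveD.
Qed.

Lemma partialM (f g : 'rV[R]_d -> R) i x :
  derivable f x (delta_mx 0 i) -> derivable g x (delta_mx 0 i) ->
  partial i (fun y => f y * g y) x = f x * partial i g x + g x * partial i f x.
Proof. by move=> df dg; rewrite /partial (@deriveM _ _ f g). Qed.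

Lemma partialD (f g : 'rV[R]_d -> R) i x :
  derivable f x (delta_mx 0 i) -> derivable g x (delta_mx 0 i) ->
  partial i (fun y => f y + g y) x = partial i f x + partial i g x.
Proof. by move=> df dg; rewrite /partial (@deriveD _ _ _ f g). Qed.

Section AtPoint.
Context (U : set 'rV[R]_d) (x : 'rV[R]_d) (oU : open U) (Ux : U x).

Lemma smooth_mx_derivable m n (A : 'rV[R]_d -> 'M[R]_(m, n)) i j k :
  smooth_mx U A -> derivable (fun y => A y j k) x (delta_mx 0 i).
Proof. by move=> sA; apply: smooth_derivable (sA j k) Ux. Qed.

Lemma mpartial_mul m n p (A : 'rV[R]_d -> 'M[R]_(m, n)) (B : 'rV[R]_d -> 'M[R]_(n, p)) i :
  smooth_mx U A -> smooth_mx U B ->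
  mpartial i (fun y => A y *m B y) x = mpartial i A x *m B x + A x *m mpartial i B x.
Proof.
move=> sA sB; apply/matrixP => j k; rewrite !mxE.
have -> : (fun y => (A y *m B y) j k) = (fun y => \sum_l A y j l * B y l k).
  by apply/funext => y; rewrite mxE.
rewrite (partial_sum _ _).1 => [|l]; last first.
  apply: (@derivableM _ _ (fun y => A y j l) (fun y => B y l k)); exact: smooth_mx_derivable.
rewrite -big_split /=; apply: eq_bigr => l _.
rewrite (@partialM (fun y => A y j l) (fun y => B y l k)) ?mxE.
- by rewrite addrC [B x l k * _]mulrC.
- exact: smooth_mx_derivable.
- exact: smooth_mx_derivable.
Qed.

Lemma mpartialD m n (A B : 'rV[R]_d -> 'M[R]_(m, n)) i :
  smooth_mx U A -> smooth_mx U B ->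
  mpartial i (fun y => A y + B y) x = mpartial i A x + mpartial i B x.
Proof.
move=> sA sB; apply/matrixP => j k; rewrite !mxE.
have -> : (fun y => (A y + B y) j k) = (fun y => A y j k + B y j k).
  by apply/funext => y; rewrite mxE.
by rewrite (@partialD (fun y => A y j k) (fun y => B y j k))//; exact: smooth_mx_derivable.
Qed.

Lemma mpartialZ m n (f : 'rV[R]_d -> R) (A : 'rV[R]_d -> 'M[R]_(m, n)) i :
  smooth_fun U f -> smooth_mx U A ->
  mpartial i (fun y => f y *: A y) x = partial i f x *: A x + f x *: mpartial i A x.
Proof.
move=> sf sA; apply/matrixP => j k; rewrite !mxE.
have -> : (fun y => (f y *: A y) j k) = (fun y => f y * A y j k).
  by apply/funext => y; rewrite mxE.
rewrite (@partialM f (fun y => A y j k)); first by rewrite addrC [A x j k * _]mulrC.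
- exact: smooth_derivable sf Ux.
- exact: smooth_mx_derivable.
Qed.

Lemma mpartial_sum m n (I : Type) (r : seq I) (A : I -> 'rV[R]_d -> 'M[R]_(m, n)) i :
  (forall k, smooth_mx U (A k)) ->
  mpartial i (fun y => \sum_(k <- r) A k y) x = \sum_(k <- r) mpartial i (A k) x.
Proof.
move=> sA; apply/matrixP => j k; rewrite !mxE summxE.
have -> : (fun y => (\sum_(l <- r) A l y) j k) = (fun y => \sum_(l <- r) A l y j k).
  by apply/funext => y; rewrite summxE.
rewrite (partial_sum _ _).1 => [|l]; last exact: smooth_mx_derivable.
by apply: eq_bigr => l _; rewrite mxE.
Qed.

Lemma mpartialC m n (A : 'rV[R]_d -> 'M[R]_(m, n)) i j :
  smooth_mx U A -> mpartial i (mpartial j A) x = mpartial j (mpartial i A) x.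
Proof.
move=> sA; apply/matrixP => k l; rewrite [LHS]mxE [RHS]mxE.
have E h : (fun y => mpartial h A y k l) = partial h (fun y => A y k l).
  by apply/funext => y; rewrite mxE.
rewrite !E; exact: (partialC i j oU Ux (sA k l)).
Qed.

End AtPoint.

Lemma mpartial_comp e m n (U : set 'rV[R]_d) (V : set 'rV[R]_e)
    (phi : 'rV[R]_d -> 'rV[R]_e) (A : 'rV[R]_e -> 'M[R]_(m, n)) i x :
  open U -> open V -> U x -> V (phi x) -> smooth_vfun U phi ->
  (forall j k, smooth_fun V (fun y => A y j k)) ->
  mpartial i (fun y => A (phi y)) x =
  \sum_a jac phi x i a *: \matrix_(j, k) partial a (fun y => A y j k) (phi x).
Proof.
move=> oU oV Ux Vx sp sA; apply/matrixP => j k; rewrite !mxE summxE.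
rewrite (@partial_compE _ _ _ (fun y => A y j k)).
- by apply: eq_bigr => a _; rewrite !mxE.
- exact: smooth_vdifferentiable sp Ux.
- exact: smooth_differentiable (sA j k) Vx.
Qed.

End MatrixPartial.

Section LeviCivita.
Context {R : realType} {d : nat}.
Context (U : set 'rV[R]_d) (g : 'rV[R]_d -> 'M[R]_d).
Context (oU : open U) (sg : smooth_mx U g) (pg : forall x, U x -> posdef (g x)).
Implicit Types (x : 'rV[R]_d).

Lemma mx_addE (m n : nat) (A B : 'M[R]_(m, n)) i j : (A + B) i j = A i j + B i j.
Proof. by rewrite mxE. Qed.

Lemma mulmx_entry (m n p : nat) (A : 'M[R]_(m, n)) (B : 'M[R]_(n, p)) i k :
  (A *m B) i k = \sum_j A i j * B j k.
Proof. by rewrite mxE. Qed.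

Lemma mx_scaleE (m n : nat) (c : R) (A : 'M[R]_(m, n)) i j :
  (c *: A) i j = c * A i j.
Proof. by rewrite mxE. Qed.

Lemma mx_oppE (m n : nat) (A : 'M[R]_(m, n)) i j : (- A) i j = - A i j.
Proof. by rewrite mxE. Qed.

(* The connection matrix A_i of nabla_(d_i): its entry (j, k) is Gamma^k_{ij}. *)
Definition conn (h : 'rV[R]_d -> 'M[R]_d) (i : 'I_d) x : 'M[R]_d :=
  \matrix_(j, k) christoffel h i j k x.

(** Since matrices act on rows from the right, the products stand in the opposite order to the usual
    commutator of connection matrices. *)
Definition curv_mx (h : 'rV[R]_d -> 'M[R]_d) (i j : 'I_d) x : 'M[R]_d :=
  mpartial i (conn h j) x - mpartial j (conn h i) x
  + (conn h j x *m conn h i x - conn h i x *m conn h j x).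

Lemma curvatureE h i j k l x : curvature h i j k l x = curv_mx h i j x k l.
Proof.
have mpE i' j' : mpartial i' (conn h j') x k l = partial i' (christoffel h j' k l) x.
  by rewrite mxE; congr (partial i' _ x); apply/funext => y; rewrite mxE.
have mmE i' j' : (conn h i' x *m conn h j' x) k l =
    \sum_m christoffel h i' k m x * christoffel h j' m l x.
  by rewrite mxE; apply: eq_bigr => m _; rewrite !mxE.
rewrite [RHS]mx_addE; congr (_ + _).
  by rewrite mx_addE mx_oppE; congr (_ - _); symmetry; exact: mpE.
rewrite mx_addE mx_oppE; etransitivity; first exact: sumrB.
by congr (_ - _); symmetry; exact: mmE.
Qed.

Lemma metric_unit x : U x -> g x \in unitmx.
Proof. by move=> Ux; exact: posdef_unitmx (pg Ux). Qed.

Lemma smooth_conn i : smooth_mx U (conn g i).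
Proof.
move=> j k; rewrite /conn; under eq_fun do rewrite mxE.
apply: (@smoothM _ _ U (cst 2^-1) (fun x => \sum_l _)) => //; first exact: smooth_cst.
apply: (@smooth_sum _ _ U _ _ xpredT (fun l x => _)) => // l _.
apply: (@smoothM _ _ U (fun x => invmx (g x) k l) (fun x => _)) => //.
  by apply: smooth_invmx => //; exact: metric_unit.
apply: (@smoothB _ _ U (fun x => partial i _ x + partial j _ x) (partial l _)) => //.
  by apply: (@smoothD _ _ U (partial i _) (partial j _)) => //; exact/smooth_partial/sg.
exact/smooth_partial/sg.
Qed.

Lemma partial_metric_sym x l i j : U x ->
  partial l (fun y => g y i j) x = partial l (fun y => g y j i) x.
Proof.
move=> Ux; apply: (partial_ext _ oU Ux) => y Uy.
by rewrite -{1}(pg Uy).1 mxE.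
Qed.

Lemma conn_sym x i j k : U x -> conn g i x j k = conn g j x i k.
Proof.
move=> Ux; rewrite !mxE /christoffel; congr (_ * _); apply: eq_bigr => l _.
congr (_ * _); rewrite (partial_metric_sym l i j Ux); congr (_ - _); exact: addrC.
Qed.

Lemma conn_lower x i j l : U x -> (conn g i x *m g x) j l =
  2^-1 * (partial i (fun y => g y j l) x + partial j (fun y => g y i l) x
     - partial l (fun y => g y i j) x).
Proof.
move=> Ux.
pose C : 'M[R]_d := \matrix_(j, m) (partial i (fun y => g y j m) x
  + partial j (fun y => g y i m) x - partial m (fun y => g y i j) x).
have -> : conn g i x = 2^-1 *: (C *m (invmx (g x))^T).
  apply/matrixP => j' k; rewrite [LHS]mxE [RHS]mxE [(_ *m _) _ _]mxE; congr (_ * _).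
  by apply: eq_bigr => m _; rewrite !mxE mulrC.
rewrite -scalemxAl -mulmxA -{2}(pg Ux).1 -trmx_mul mulmxV ?metric_unit//.
by rewrite trmx1 mulmx1 !mxE.
Qed.

Lemma conn_compat x i : U x ->
  mpartial i g x = conn g i x *m g x + (conn g i x *m g x)^T.
Proof.
move=> Ux; apply/matrixP => j l; rewrite mx_addE [(_^T) _ _]mxE !conn_lower//.
rewrite [LHS]mxE (partial_metric_sym i l j Ux).
have K (a b c : R) : a = 2^-1 * (a + b - c) + 2^-1 * (a + c - b) by field.
exact: K.
Qed.

(** With its upper index lowered by [G], the difference of the connections is symmetric in its first
    two indices and antisymmetric in its last two; alternating the two exchanges turns it into its
    own negative. *)
Lemma conn_unique (G : 'M[R]_d) (A B : 'I_d -> 'M[R]_d) : G \in unitmx ->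
  (forall i j k, A i j k = A j i k) -> (forall i j k, B i j k = B j i k) ->
  (forall i, A i *m G + (A i *m G)^T = B i *m G + (B i *m G)^T) ->
  forall i, A i = B i.
Proof.
move=> uG sA sB AB i.
pose e i j k := (A i *m G) j k - (B i *m G) j k.
have e1 i' j k : e i' j k = e j i' k.
  rewrite /e (mulmx_entry (A i')) (mulmx_entry (A j)) (mulmx_entry (B i')) (mulmx_entry (B j)).
  congr (_ - _).
    by apply: eq_bigr => l _; rewrite sA.
  by apply: eq_bigr => l _; rewrite sB.
have e2 i' j k : e i' j k = - e i' k j.
  have /matrixP/(_ j k) := AB i'; rewrite !mx_addE ![(_^T) _ _]mxE /e.
  move: ((A i' *m G) j k) ((A i' *m G) k j) ((B i' *m G) j k) ((B i' *m G) k j).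
  by clear; move=> a b a' b' H; lra.
have e0 i' j k : e i' j k = 0.
  have : e i' j k = - e i' j k.
    by rewrite {1}e2 e1 e2 opprK e1 e2 e1.
  by move/eqP; rewrite -addr_eq0 -mulr2n mulrn_eq0 => /eqP.
apply: (can_inj (mulmxK uG)); apply/matrixP => j k.
by apply/eqP; rewrite -subr_eq0; apply/eqP; exact: e0.
Qed.

End LeviCivita.

Lemma gauge_compat (R : comPzRingType) (n : nat) (a E G X : 'M[R]_n) : G^T = G ->
  (a *m G + E *m (X + X^T)) *m E^T + E *m G *m a^T =
  a *m G *m E^T + E *m X *m E^T + (a *m G *m E^T + E *m X *m E^T)^T.
Proof.
move=> sG; rewrite mulmxDl mulmxDr mulmxDl raddfD /= !trmx_mul !trmxK sG !mulmxA.
by rewrite -!addrA; congr (_ + (_ + _)); exact: addrC.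
Qed.

(** The derivatives enter as independent matrices: the first two hypotheses are the derivatives of
    the last two, and [ddD] is the common second derivative of the gauge [D]. What remains is
    algebra. *)
Lemma curv_gauge (R : comNzRingType) (n : nat)
    (dAij dAji Ai Aj D diD djD ddD Bi Bj dBij dBji : 'M[R]_n) :
  dAij *m D + Aj *m diD = ddD + (diD *m Bj + D *m dBij) ->
  dAji *m D + Ai *m djD = ddD + (djD *m Bi + D *m dBji) ->
  Ai *m D = diD + D *m Bi -> Aj *m D = djD + D *m Bj ->
  (dAij - dAji + (Aj *m Ai - Ai *m Aj)) *m D =
  D *m (dBij - dBji + (Bj *m Bi - Bi *m Bj)).
Proof.
move=> H1 H2 Ti Tj.
have E1 : dAij *m D = ddD + (diD *m Bj + D *m dBij) - Aj *m diD by rewrite -H1 addrK.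
have E2 : dAji *m D = ddD + (djD *m Bi + D *m dBji) - Ai *m djD by rewrite -H2 addrK.
have E3 : Aj *m Ai *m D = Aj *m diD + (djD *m Bi + D *m (Bj *m Bi)).
  by rewrite -mulmxA Ti mulmxDr mulmxA Tj mulmxDl -mulmxA.
have E4 : Ai *m Aj *m D = Ai *m djD + (diD *m Bj + D *m (Bi *m Bj)).
  by rewrite -mulmxA Tj mulmxDr mulmxA Ti mulmxDl -mulmxA.
rewrite !mulmxDl !mulmxDr !mulNmx !mulmxN E1 E2 E3 E4.
move: (Aj *m diD) (Ai *m djD) (diD *m Bj) (djD *m Bi) (D *m dBij) (D *m dBji).
move: (D *m (Bj *m Bi)) (D *m (Bi *m Bj)) => a1 a2 a3 a4 a5 a6 a7 a8.
by apply/matrixP => k l; rewrite !mxE; ring.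
Qed.

Section CoordinateChange.
Context {R : realType} {d : nat}.
Context (U V : set 'rV[R]_d) (g g' : 'rV[R]_d -> 'M[R]_d) (phi : 'rV[R]_d -> 'rV[R]_d).
Context (oU : open U) (oV : open V) (sg : smooth_mx U g) (sg' : smooth_mx V g').
Context (pg : forall x, U x -> posdef (g x)) (pg' : forall x, V x -> posdef (g' x)).
Context (UV : forall x, U x -> V (phi x)) (sphi : smooth_vfun U phi).
Context (uD : forall x, U x -> jac phi x \in unitmx).
Context (gE : forall x, U x -> g x = jac phi x *m g' (phi x) *m (jac phi x)^T).

Let D := jac phi.
(** The connection matrix of [g'] along the image of the j-th coordinate field under [phi]. *)
Let At (j : 'I_d) (x : 'rV[R]_d) : 'M[R]_d := \sum_a D x j a *: conn g' a (phi x).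

Let sD : smooth_mx U D.
Proof. exact: smooth_jac. Qed.

Let smooth_phi_mx (m n : nat) (A : 'rV[R]_d -> 'M[R]_(m, n)) : smooth_mx V A ->
  smooth_mx U (fun x => A (phi x)).
Proof.
by move=> sA j k; apply: (@smooth_comp _ _ _ _ _ (fun z => A z j k) phi oU oV) => //; exact: sA.
Qed.

Let sAt j : smooth_mx U (At j).
Proof.
apply: smooth_mx_sum => // a; apply: (@smooth_mxZ _ _ _ _ U (fun x => D x j a)) => //.
by apply: smooth_phi_mx; exact: smooth_conn.
Qed.

(** The right side times the inverse Jacobian is symmetric in its two lower indices, because second
    derivatives of [phi] commute, and it is compatible with [g], because [g] is the pullback of
    [g']. By uniqueness it is the Levi-Civita connection of [g]. *)
Lemma conn_change x i : U x ->
  conn g i x *m jac phi x = mpartial i (jac phi) x + jac phi x *m At i x.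
Proof.
move=> Ux; pose B i := mpartial i D x + D x *m At i x.
suff -> : conn g i x = B i *m invmx (D x) by rewrite mulmxKV ?uD.
apply: (@conn_unique _ _ (g x) (fun i => conn g i x) (fun i => B i *m invmx (D x))).
- exact: (metric_unit pg).
- by move=> i' j k; exact: (conn_sym oU pg).
- move=> i' j k; rewrite !mulmx_entry; apply: eq_bigr => l _; congr (_ * _).
  rewrite /B !mx_addE; congr (_ + _).
    rewrite [LHS]mxE [RHS]mxE; have E h : (fun y => D y h l) = partial h (fun y => phi y 0 l).
      by apply/funext => y; rewrite mxE.
    by rewrite !E; exact: (partialC i' j oU Ux (sphi l)).
  rewrite !mulmx_entry /At.
  transitivity (\sum_b \sum_a D x j b * D x i' a * conn g' a (phi x) b l).
    apply: eq_bigr => b _; rewrite summxE mulr_sumr; apply: eq_bigr => a _.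
    by rewrite mx_scaleE mulrA.
  rewrite exchange_big /=; apply: eq_bigr => a _; rewrite summxE mulr_sumr.
  apply: eq_bigr => b _; rewrite mx_scaleE mulrA [D x j b * _]mulrC.
  by rewrite (conn_sym oV pg' _ _ _ (UV Ux)).
move=> j; rewrite -(conn_compat oU pg j Ux).
have sym' := (pg' (UV Ux)).1.
rewrite (mpartial_ext j oU Ux gE) (mpartial_mul Ux); last 2 first.
- by apply: smooth_mx_mul => //; exact: smooth_phi_mx.
- by apply: smooth_mx_tr; exact: sD.
rewrite (mpartial_mul Ux) //; last exact: smooth_phi_mx.
rewrite mpartial_tr (mpartial_comp j oU oV Ux (UV Ux) sphi sg').
rewrite -/(D x) (gE Ux) -/(D x).
have -> : B j *m invmx (D x) *m (D x *m g' (phi x) *m (D x)^T) =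
   mpartial j D x *m g' (phi x) *m (D x)^T + D x *m (At j x *m g' (phi x)) *m (D x)^T.
  by rewrite !mulmxA mulmxKV ?uD// /B !mulmxDl ?mulmxA.
have -> : \sum_a D x j a *: (\matrix_(j0, k) partial a (fun y => g' y j0 k) (phi x))
   = At j x *m g' (phi x) + (At j x *m g' (phi x))^T.
  rewrite /At mulmx_suml linear_sum /= -big_split /=; apply: eq_bigr => a _.
  rewrite -scalemxAl linearZ /= -scalerDr; congr (_ *: _).
  exact: (conn_compat oV pg' a (UV Ux)).
exact: gauge_compat.
Qed.

(** Differentiating [conn_change] exhibits the Jacobian as a gauge transformation between the
    connection matrices of [g] and the matrices [At], so only the curvature of the latter has to be
    expanded. *)
Lemma curv_change x i j : U x -> curv_mx g i j x *m jac phi x =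
  \sum_a \sum_b (jac phi x i a * jac phi x j b) *:
      (jac phi x *m curv_mx g' a b (phi x)).
Proof.
move=> Ux.
have sA i' : smooth_mx U (conn g i') by exact: smooth_conn.
have sA' i' : smooth_mx V (conn g' i') by exact: smooth_conn.
have E k l : mpartial k (conn g l) x *m D x + conn g l x *m mpartial k D x =
   mpartial k (mpartial l D) x + (mpartial k D x *m At l x + D x *m mpartial k (At l) x).
  rewrite -(mpartial_mul Ux k (sA l) sD) -(mpartial_mul Ux k sD (sAt l)).
  rewrite -(mpartialD Ux); last first.
  - by apply: smooth_mx_mul.
  - exact: smooth_mpartial.
  by apply: (mpartial_ext _ oU Ux) => y Uy; exact: conn_change.
have T k : conn g k x *m D x = mpartial k D x + D x *m At k x by exact: conn_change.
have F1 : curv_mx g i j x *m D x = D x *m (mpartial i (At j) x - mpartial j (At i) x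
    + (At j x *m At i x - At i x *m At j x)).
  have Eij := E i j; have Eji := E j i; rewrite (mpartialC oU Ux j i sD) in Eji.
  exact: curv_gauge Eij Eji (T i) (T j).
rewrite -/(D x) F1 {F1}; under eq_bigr => a _ do under eq_bigr => b _ do rewrite scalemxAr.
under eq_bigr => a _ do rewrite -mulmx_sumr.
rewrite -mulmx_sumr; congr (_ *m _).
(* The first sum carries the second derivatives of [phi]. It is symmetric in [k] and [l] and cancels
   in the curvature. *)
have dAt k l : mpartial k (At l) x = \sum_b (mpartial k D x l b *: conn g' b (phi x))
   + \sum_a \sum_b (D x k a * D x l b) *: mpartial a (conn g' b) (phi x).
  rewrite /At (mpartial_sum Ux); last first.
    move=> b; apply: (@smooth_mxZ _ _ _ _ U (fun x => D x l b)) => //.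
    exact: smooth_phi_mx.
  rewrite [X in _ = _ + X]exchange_big -big_split /=; apply: eq_bigr => b _.
  rewrite (mpartialZ Ux); last first.
  - exact: smooth_phi_mx.
  - exact: sD.
  rewrite [mpartial k D x l b]mxE; congr (_ + _).
  rewrite (mpartial_comp k oU oV Ux (UV Ux) sphi (sA' b)) scaler_sumr.
  by apply: eq_bigr => a _; rewrite scalerA mulrC.
have Dsym k l b : mpartial k D x l b = mpartial l D x k b.
  rewrite [LHS]mxE [RHS]mxE; have Ey h : (fun y => D y h b) = partial h (fun y => phi y 0 b).
    by apply/funext => y; rewrite mxE.
  by rewrite !Ey; exact: (partialC k l oU Ux (sphi b)).
have AA k l : At k x *m At l x =
   \sum_a \sum_b (D x l a * D x k b) *: (conn g' b (phi x) *m conn g' a (phi x)).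
  rewrite /At mulmx_suml exchange_big /=; apply: eq_bigr => b _.
  rewrite mulmx_sumr; apply: eq_bigr => a _.
  by rewrite -scalemxAl -scalemxAr scalerA mulrC.
have Dsum : \sum_b (mpartial i D x j b *: conn g' b (phi x)) =
    \sum_b (mpartial j D x i b *: conn g' b (phi x)).
  by apply: eq_bigr => b _; congr (_ *: _); exact: Dsym.
have K (S P Q W : 'M[R]_d) : S + P - (S + Q) + W = P - Q + W.
  by rewrite opprD addrACA subrr add0r.
rewrite (dAt i j) (dAt j i) Dsum K (AA j i) (AA i j).
rewrite [X in _ - X + _]exchange_big [X in _ + (_ - X)]exchange_big /=.
rewrite -!sumrB -big_split /=; apply: eq_bigr => a _.
rewrite -!sumrB -big_split /=; apply: eq_bigr => b _.
by rewrite [D x j b * _]mulrC -!scalerBr -scalerDr.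
Qed.

Lemma curvature_sqnorm_change x : U x ->
  curvature_sqnorm g x = curvature_sqnorm g' (phi x).
Proof.
move=> Ux; rewrite /curvature_sqnorm !tensor_sqnormE.
have uDx := uD Ux; have Vx := UV Ux.
rewrite (@tensor_sqnorm_congr _ _ (invmx (g x)) (g x) (jac phi x) (invmx (jac phi x)) _
  (fun i j k l => curvature g' i j k l (phi x))).
  congr tensor_sqnorm; last first.
    by rewrite (gE Ux) !mulmxA mulVmx// mul1mx -mulmxA -trmx_mul mulVmx// trmx1 mulmx1.
  have ug' := posdef_unitmx (pg' Vx).
  have uDT : (jac phi x)^T \in unitmx by rewrite unitmx_tr.
  apply: (can_inj (mulKmx ug')); rewrite mulmxV//.
  apply: (can_inj (mulKmx uDx)); apply: (can_inj (mulmxK uDT)).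
  rewrite !mulmxA mulmx1 -(gE Ux) mulmxV ?mul1mx//.
  exact: posdef_unitmx (pg Ux).
move=> i j k l; rewrite curvatureE -[curv_mx g i j x](mulmxK uDx) curv_change//.
rewrite mulmx_suml summxE; apply: eq_bigr => a _.
rewrite mulmx_suml summxE mulr_sumr; apply: eq_bigr => b _.
rewrite -scalemxAl mx_scaleE -mulmxA mulmx_entry -mulrA; congr (_ * (_ * _)).
apply: eq_bigr => c _; rewrite mulmx_entry; congr (_ * _).
by apply: eq_bigr => e _; rewrite curvatureE mulrC.
Qed.

End CoordinateChange.

Section Scaling.
Context {R : realType} {d : nat}.

Lemma contractZl (c : R) (h : 'M[R]_d) F : contract (c *: h) F = c * contract h F.
Proof.
rewrite /contract mulr_sumr; apply: eq_bigr => i _; rewrite mulr_sumr.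
by apply: eq_bigr => j _; rewrite mx_scaleE mulrA.
Qed.

Lemma contractZr (c : R) (h : 'M[R]_d) F :
  contract h (fun i j => c * F i j) = c * contract h F.
Proof.
rewrite /contract mulr_sumr; apply: eq_bigr => i _; rewrite mulr_sumr.
by apply: eq_bigr => j _; rewrite mulrCA.
Qed.

Lemma tensor_sqnormZ (c : R) (h g : 'M[R]_d) T : c != 0 ->
  tensor_sqnorm (c^-1 *: h) (c *: g) T = c ^- 2 * tensor_sqnorm h g T.
Proof.
move=> c0; rewrite /tensor_sqnorm contractZl.
under eq_contract => i i'.
  rewrite contractZl; under eq_contract => j j'.
    rewrite contractZl; under eq_contract => k k' do rewrite contractZl.
    rewrite contractZr mulKf//; over.
  over.
rewrite contractZr mulrA -expr2 exprVn; congr (_ * _).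
Qed.

Lemma invmxZ_unit (c : R) (h : 'M[R]_d) : c != 0 -> h \in unitmx ->
  invmx (c *: h) = c^-1 *: invmx h.
Proof. by move=> c0 uh; rewrite invmxZ// unitmxZ ?unitfE. Qed.

Context (U : set 'rV[R]_d) (g : 'rV[R]_d -> 'M[R]_d).
Context (oU : open U) (sg : smooth_mx U g) (pg : forall x, U x -> posdef (g x)).

(** A constant factor cancels in the Christoffel symbols, so the curvature with one upper index is
    unchanged. The norm contributes three factors [c^-1] from lower indices and one factor [c] from
    the upper index. *)
Lemma curvature_sqnormZ (c : R) x : c != 0 -> U x ->
  curvature_sqnorm (fun y => c *: g y) x = c ^- 2 * curvature_sqnorm g x.
Proof.
move=> c0 Ux.
have cE i y : U y -> conn (fun y => c *: g y) i y = conn g i y.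
  move=> Uy; apply/matrixP => j k; rewrite !mxE /christoffel; congr (_ * _).
  have pE i' j' k' : partial i' (fun y => (c *: g y) j' k') y =
      c * partial i' (fun y => g y j' k') y.
    have -> : (fun y => (c *: g y) j' k') = (fun y => c * g y j' k').
      by apply/funext => z; rewrite mxE.
    rewrite (@partialM _ _ (cst c) (fun y => g y j' k')).
    - by rewrite /partial derive_cst mulr0 addr0.
    - exact: derivable_cst.
    - exact: smooth_mx_derivable Uy _ _ _ _ _ _ sg.
  apply: eq_bigr => l _; rewrite invmxZ_unit//; last exact: (metric_unit pg Uy).
  rewrite mx_scaleE !pE -mulrDr -mulrBr.
  by rewrite mulrACA mulVf// mul1r.
have kE i j k l : curvature (fun y => c *: g y) i j k l x = curvature g i j k l x.
  have mE i' j' : mpartial i' (conn (fun y => c *: g y) j') x = mpartial i' (conn g j') x.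
    by apply: (mpartial_ext i' oU Ux) => y Uy; exact: cE.
  rewrite (curvatureE (fun y => c *: g y)) (curvatureE g) /curv_mx (mE i j) (mE j i).
  by rewrite (cE i x Ux) (cE j x Ux).
rewrite /curvature_sqnorm !tensor_sqnormE invmxZ_unit//; last exact: (metric_unit pg Ux).
etransitivity; first exact: (tensor_sqnormZ (invmx (g x)) (g x) _ c0).
congr (_ * tensor_sqnorm _ _ _).
apply/funext => i; apply/funext => j; apply/funext => k; apply/funext => l.
exact: kE.
Qed.

End Scaling.

(** As in [curv_gauge], derivatives are independent variables: [si] and [sj] stand for derivatives
    of rows of the covariant derivative of V, and [ddV] for the second derivative of V, which drops
    out. *)
Lemma killing_algebra (R : comNzRingType) (n : nat) (V diV djV ddV si sj : 'rV[R]_n)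
    (Ai Aj dAij dAji : 'M[R]_n) :
  diV *m Aj + V *m dAij = sj - ddV -> djV *m Ai + V *m dAji = si - ddV ->
  V *m (dAij - dAji + (Aj *m Ai - Ai *m Aj)) =
  sj - si + ((djV + V *m Aj) *m Ai - (diV + V *m Ai) *m Aj).
Proof.
move=> H1 H2; rewrite mulmxDr !mulmxBr !mulmxDl !mulmxA.
have -> : V *m dAij = sj - ddV - diV *m Aj by rewrite -H1 addrAC subrr add0r.
have -> : V *m dAji = si - ddV - djV *m Ai by rewrite -H2 addrAC subrr add0r.
move: (diV *m Aj) (djV *m Ai) (V *m Aj *m Ai) (V *m Ai *m Aj) => a1 a2 a3 a4.
by apply/rowP => h; rewrite !mxE; ring.
Qed.

Lemma row_entries (R : pzRingType) (n : nat) (X Y : 'M[R]_n) (p q : 'rV[R]_n) i j h :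
  (row i X - row j Y + (p - q)) 0 h = X i h - Y j h + (p 0 h - q 0 h).
Proof. by rewrite !mxE. Qed.

(** * Ricci curvature along a Killing field of constant length *)

Section KillingField.
Context {R : realType} {d : nat}.
Context (U : set 'rV[R]_d) (g : 'rV[R]_d -> 'M[R]_d) (V s : 'rV[R]_d -> 'rV[R]_d).
Context (a : R).
Context (oU : open U) (sg : smooth_mx U g) (pg : forall x, U x -> posdef (g x)).
Context (sV : smooth_mx U V) (ss : smooth_mx U s) (a0 : a != 0).

Let ds (x : 'rV[R]_d) : 'M[R]_d :=
  \matrix_(i, j) (partial i (fun y => s y 0 j) x - partial j (fun y => s y 0 i) x).

(** The form [a *: s] is dual to [V], and [V] is Killing. For a Killing field the last condition
    expresses that its length is constant, since the Lie derivative of the dual form vanishes. *)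
Context (Vg : forall x, U x -> V x *m g x = a *: s x).
Context (LVg : forall x, U x ->
  \sum_l V x 0 l *: mpartial l g x + (jac V x *m g x + (jac V x *m g x)^T) = 0).
Context (Vds : forall x, U x -> V x *m ds x = 0).

(* The covariant derivative of V: row i is nabla_i V. *)
Let S (x : 'rV[R]_d) : 'M[R]_d := jac V x + \sum_l V x 0 l *: conn g l x.

Let rowS i x : U x -> row i (S x) = mpartial i V x + V x *m conn g i x.
Proof.
move=> Ux; apply/rowP => k; rewrite mxE /S !mx_addE; congr (_ + _); first by rewrite [LHS]mxE [RHS]mxE.
rewrite summxE mulmx_entry; apply: eq_bigr => l _.
by rewrite mx_scaleE (conn_sym oU pg).
Qed.

Let sum_mulmx (x : 'rV[R]_d) (v : 'rV[R]_d) (A : 'I_d -> 'M[R]_d) :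
  (\sum_l v 0 l *: A l) *m g x = \sum_l v 0 l *: (A l *m g x).
Proof. by rewrite mulmx_suml; apply: eq_bigr => l _; rewrite scalemxAl. Qed.

Let S_antisym x : U x -> S x *m g x + (S x *m g x)^T = 0.
Proof.
move=> Ux; rewrite -(LVg Ux) /S mulmxDl raddfD /= addrACA addrC; congr (_ + _).
rewrite sum_mulmx linear_sum /= -big_split /=; apply: eq_bigr => l _.
by rewrite linearZ /= -scalerDr -(conn_compat oU pg).
Qed.

Let conn_mulmx_sym x i j l : U x -> (conn g i x *m g x) j l = (conn g j x *m g x) i l.
Proof.
by move=> Ux; rewrite !mulmx_entry; apply: eq_bigr => k _; rewrite (conn_sym oU pg).
Qed.

Let S_dual x i j : U x ->
  (S x *m g x) i j + (conn g i x *m g x *m (V x)^T) j 0 = a * partial i (fun y => s y 0 j) x.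
Proof.
move=> Ux.
have E : mpartial i V x *m g x + V x *m mpartial i g x = a *: mpartial i s x.
  rewrite -(mpartial_mul Ux i sV sg).
  rewrite (mpartial_ext i oU Ux Vg).
  apply/matrixP => k l; rewrite [LHS]mxE mx_scaleE [mpartial i s x k l]mxE.
  have -> : (fun y => (a *: s y) k l) = (fun y => a * s y k l).
    by apply/funext => y; rewrite mxE.
  rewrite (@partialM _ _ (cst a) (fun y => s y k l)).
  - by rewrite /partial derive_cst mulr0 addr0.
  - exact: derivable_cst.
  - exact: smooth_mx_derivable Ux _ _ _ _ _ _ ss.
move/rowP/(_ j): E; rewrite mx_scaleE [mpartial i s x 0 j]mxE => <-.
rewrite mx_addE (conn_compat oU pg i Ux) mulmxDr mx_addE addrA; congr (_ + _).
  have := congr1 (fun A : 'rV[R]_d => (A *m g x) 0 j) (rowS i Ux).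
  by rewrite -row_mul mxE => ->; rewrite mulmxDl mx_addE mulmxA.
by rewrite -[in RHS](trmxK (V x)) -trmx_mul [RHS]mxE.
Qed.

(** By the Killing equation the lowered covariant derivative of [V] is antisymmetric, hence equal to
    its antisymmetric part, which is half the exterior derivative of the dual form [a *: s]; the
    Christoffel terms cancel there. *)
Let S_gE x : U x -> S x *m g x = (a / 2) *: ds x.
Proof.
move=> Ux; apply/matrixP => i j; rewrite mx_scaleE [ds x i j]mxE.
have H1 := S_dual i j Ux; have H2 := S_dual j i Ux.
have H3 : (conn g i x *m g x *m (V x)^T) j 0 = (conn g j x *m g x *m (V x)^T) i 0.
  by rewrite !(mulmx_entry _ (V x)^T); apply: eq_bigr => l _; rewrite conn_mulmx_sym.
have /matrixP/(_ i j) := S_antisym Ux; rewrite mx_addE [(_^T) _ _]mxE [RHS]mxE => H4.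
have H5 : (S x *m g x) j i = - (S x *m g x) i j by apply/eqP; rewrite -addr_eq0 addrC H4.
rewrite H5 -H3 in H2.
have K (u v w t : R) : u + v = a * w -> - u + v = a * t -> u = a / 2 * (w - t).
  move=> E1 E2; have -> : a / 2 * (w - t) = (a * w - a * t) / 2 by field.
  by rewrite -E1 -E2; field.
exact: K H1 H2.
Qed.

Let SE x : U x -> S x = (a / 2) *: ds x *m invmx (g x).
Proof. by move=> Ux; rewrite -S_gE// mulmxK//; exact: (metric_unit pg). Qed.

Let VS x : U x -> V x *m S x = 0.
Proof. by move=> Ux; rewrite SE// -!scalemxAl -scalemxAr mulmxA Vds// mul0mx scaler0. Qed.

Let ds_antisym x : (ds x)^T = - ds x.
Proof. by apply/matrixP => i j; rewrite !mxE opprB. Qed.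

Let trS x : U x -> \tr (S x) = 0.
Proof.
move=> Ux; rewrite SE// -scalemxAl mxtraceZ.
suff -> : \tr (ds x *m invmx (g x)) = 0 by rewrite mulr0.
have sh : (invmx (g x))^T = invmx (g x) by rewrite trmx_inv (pg Ux).1.
have : \tr (ds x *m invmx (g x)) = - \tr (ds x *m invmx (g x)).
  by rewrite -[LHS]mxtrace_tr trmx_mul sh ds_antisym mulmxN raddfN /= mxtrace_mulC.
by move/eqP; rewrite -addr_eq0 -mulr2n mulrn_eq0 => /eqP.
Qed.

Let sS : smooth_mx U S.
Proof.
apply: smooth_mxD => //; first by apply: smooth_jac => j; exact: sV.
apply: smooth_mx_sum => // l; apply: (@smooth_mxZ _ _ _ _ U (fun x => V x 0 l)) => //.
exact: smooth_conn.
Qed.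

Let V_curv x i j : U x -> V x *m curv_mx g i j x =
  row j (mpartial i S x) - row i (mpartial j S x)
  + (row j (S x) *m conn g i x - row i (S x) *m conn g j x).
Proof.
move=> Ux.
have sA k : smooth_mx U (conn g k) by exact: smooth_conn.
have E k l : mpartial k V x *m conn g l x + V x *m mpartial k (conn g l) x
   = row l (mpartial k S x) - mpartial k (mpartial l V) x.
  rewrite -(mpartial_mul Ux k sV (sA l)); apply/eqP; rewrite eq_sym subr_eq; apply/eqP.
  rewrite addrC -(mpartialD Ux); last 2 first.
  - exact: smooth_mpartial.
  - exact: smooth_mx_mul.
  apply/rowP => h; rewrite mxE [LHS]mxE [RHS]mxE; apply: (partial_ext _ oU Ux) => y Uy.
  by rewrite -(rowS l Uy) [RHS]mxE.
have Eij := E i j; have Eji := E j i; rewrite (mpartialC oU Ux j i sV) in Eji.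
rewrite !rowS//; exact: killing_algebra Eij Eji.
Qed.

(** Bochner's computation. The left side is Rc(V, V); inserting [V_curv], it splits into derivatives
    of [S] and products of [S] with the connection. *)
Lemma ricci_killing x : U x ->
  \sum_i \sum_j V x 0 j * (V x *m curv_mx g i j x) 0 i = - \tr (S x *m S x).
Proof.
move=> Ux.
(* This is the derivative of [V *m S = 0], that is, of the fact that the integral curves of V are
   geodesics. Together with [T4] it forms the trace of [S *m S]; [T2] says that V has constant
   divergence. *)
have T1 i : \sum_j V x 0 j * mpartial i S x j i = - (jac V x *m S x) i i.
  have E : mpartial i V x *m S x + V x *m mpartial i S x = 0.
    rewrite -(mpartial_mul Ux i sV sS) -(mpartial_cst (0 : 'rV[R]_d) i x).
    by apply: (mpartial_ext i oU Ux) => y Uy; exact: VS.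
  have L : (jac V x *m S x) i i = (mpartial i V x *m S x) 0 i.
    rewrite [LHS]mulmx_entry [RHS]mulmx_entry; apply: eq_bigr => k _.
    by rewrite [mpartial i V x 0 k]mxE [jac V x i k]mxE.
  have /rowP/(_ i) := E; rewrite mx_addE [RHS]mxE -L addrC => /eqP.
  by rewrite addr_eq0 => /eqP <-; rewrite [RHS]mulmx_entry.
have T2 j : \sum_i mpartial j S x i i = 0.
  have -> : \sum_i mpartial j S x i i = partial j (fun y => \tr (S y)) x.
    rewrite (partial_sum _ _).1 => [|i]; last exact: smooth_mx_derivable Ux _ _ _ _ _ _ sS.
    by apply: eq_bigr => i _; rewrite mxE.
  have -> : partial j (fun y => \tr (S y)) x = partial j (cst 0) x.
    by apply: (partial_ext _ oU Ux) => y Uy; exact: trS.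
  by rewrite /partial derive_cst.
have T3 i : \sum_j V x 0 j * (row j (S x) *m conn g i x) 0 i = 0.
  transitivity ((V x *m S x *m conn g i x) 0 i); last by rewrite VS// mul0mx mxE.
  rewrite -mulmxA mulmx_entry; apply: eq_bigr => j _; congr (_ * _).
  by rewrite -row_mul mxE.
have T4 i : \sum_j V x 0 j * (row i (S x) *m conn g j x) 0 i =
    (S x *m \sum_l V x 0 l *: conn g l x) i i.
  rewrite mulmx_sumr summxE; apply: eq_bigr => j _.
  by rewrite -scalemxAr mx_scaleE -row_mul mxE.
transitivity (\sum_i (\sum_j V x 0 j * mpartial i S x j i - \sum_j V x 0 j * mpartial j S x i i
   + (\sum_j V x 0 j * (row j (S x) *m conn g i x) 0 i
      - \sum_j V x 0 j * (row i (S x) *m conn g j x) 0 i))).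
  apply: eq_bigr => i _; rewrite -!sumrB -big_split /=; apply: eq_bigr => j _.
  have -> : (V x *m curv_mx g i j x) 0 i = mpartial i S x j i - mpartial j S x i i
      + ((row j (S x) *m conn g i x) 0 i - (row i (S x) *m conn g j x) 0 i).
    by rewrite V_curv//; exact: row_entries.
  by rewrite -!mulrBr -mulrDr.
under eq_bigr => i _ do rewrite T1 T3 T4 sub0r.
rewrite big_split /= sumrB sumrN [X in - _ - X]exchange_big /=.
rewrite [X in - _ - X]big1 => [|j _]; last by rewrite -mulr_sumr T2 mulr0.
rewrite subr0 sumrN -opprD; congr (- _).
rewrite -/(\tr (jac V x *m S x)) -/(\tr (S x *m _)) mxtrace_mulC -mxtraceD.
by rewrite -mulmxDr.
Qed.

Lemma killing_curvature_gt0 x : U x -> ds x != 0 -> 0 < curvature_sqnorm g x.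
Proof.
move=> Ux ds0; rewrite /curvature_sqnorm tensor_sqnormE.
(* If all components vanished at [x], the trace of [S *m S] would be zero, whereas it is negative
   for a nonzero antisymmetric form. *)
have [[i [j [k [l H]]]]|H] := pselect (exists i j k l, curvature g i j k l x != 0).
  exact: tensor_sqnorm_gt0 (pg Ux) H.
have F0 i j : curv_mx g i j x = 0.
  apply/matrixP => k l; rewrite -curvatureE [RHS]mxE; apply/eqP; apply: contrapT => /negP H'.
  by apply: H; exists i, j, k, l.
have := ricci_killing Ux; rewrite big1 => [|i _]; last first.
  by rewrite big1// => j _; rewrite F0 mulmx0 mxE mulr0.
have A0 : (a / 2) *: ds x != 0
  by rewrite scaler_eq0 negb_or ds0 andbT mulf_neq0// invr_neq0// pnatr_eq0.
have aA : ((a / 2) *: ds x)^T = - ((a / 2) *: ds x) by rewrite linearZ /= ds_antisym scalerN.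
have := trace_sqr_antisym_lt0 (pg Ux) aA A0; rewrite -SE// => H1 H2.
by move: H1; rewrite -oppr_gt0 -H2 ltxx.
Qed.

End KillingField.

(* [vector.coord] hides the chart map. *)
Local Notation coord := Defs.coord.

(** * Manifolds and pullbacks *)

Section Charts.
Context {R : realType}.

(** The topological part of the atlas axioms. It suffices for the chain rule and passes to products
    without any statement about transition maps of the product. *)
Definition charts {d : nat} (M : charted R d) : Prop := forall al : chart_index M,
  [/\ open (dom al), open (img al),
      forall p, dom al p -> param al (coord al p) = p,
      forall p, dom al p -> {for p, continuous (coord al)}
    & forall x, img al x -> {for x, continuous (param al)}].

Lemma smooth_manifold_charts d (M : charted R d) : smooth_manifold M -> charts M.
Proof. by case. Qed.

Definition rep_dom {d e : nat} {M : charted R d} {N : charted R e} (W : set M)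
    (f : M -> N) (al : chart_index M) (be : chart_index N) : set 'rV[R]_d :=
  [set x | [/\ img al x, W (param al x) & dom be (f (param al x))]].

Section OneManifold.
Context {d : nat} {M : charted R d} (cM : charts M).
Implicit Types (al : chart_index M) (p : M).

Lemma paramK al p : dom al p -> param al (coord al p) = p.
Proof. by have [_ _ + _ _] := cM al; exact. Qed.

Lemma dom_param al x : img al x -> dom al (param al x).
Proof. by move=> [p dp <-]; rewrite paramK. Qed.

Lemma coordK al x : img al x -> coord al (param al x) = x.
Proof. by move=> [p dp <-]; rewrite paramK. Qed.

Lemma img_coord al p : dom al p -> img al (coord al p).
Proof. by move=> dp; exists p. Qed.

Lemma open_dom al : open (dom al). Proof. by have [] := cM al. Qed.
Lemma open_img al : open (img al). Proof. by have [] := cM al. Qed.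

Lemma continuous_param al x : img al x -> {for x, continuous (param al)}.
Proof. by have [_ _ _ _] := cM al; exact. Qed.

Lemma continuous_coord al p : dom al p -> {for p, continuous (coord al)}.
Proof. by have [_ _ _ + _] := cM al; exact. Qed.

End OneManifold.

Lemma rep_open d e (M : charted R d) (N : charted R e) (W : set M) (f : M -> N) al be :
  charts M -> charts N -> open W -> (forall p, W p -> {for p, continuous f}) ->
  open (rep_dom W f al be).
Proof.
move=> cM cN oW cf; rewrite openE => x [ix Wx dx].
have H1 : nbhs x (img al) by apply: open_nbhs_nbhs; split=> //; exact: open_img.
have cp := continuous_param cM ix.
have H2 : nbhs x (param al @^-1` W).
  by apply: cp; apply: open_nbhs_nbhs.
have H3 : nbhs x (param al @^-1` (f @^-1` dom be)).
  apply: cp; apply: (cf _ Wx); apply: open_nbhs_nbhs; split=> //; exact: open_dom.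
apply: filterS (filterI H1 (filterI H2 H3)) => y [iy [Wy dy]].
by split.
Qed.

Section Composition.
Context {d e l : nat} {M : charted R d} {N : charted R e} {L : charted R l}.
Context (cM : charts M) (cN : charts N) (cL : charts L).
Context (W : set M) (W' : set N) (f : M -> N) (h : N -> L).
Context (oW : open W) (oW' : open W') (WW' : forall p, W p -> W' (f p)).
Context (sf : smooth_map W f) (sh : smooth_map W' h).

Lemma continuous_smooth_comp p : W p -> {for p, continuous (h \o f)}.
Proof.
move=> Wp; apply: continuous_comp; first exact: sf.1.
exact: (sh.1 _ (WW' Wp)).
Qed.

Let O al be ga : set 'rV[R]_d := rep_dom W f al be `&` rep_dom W (h \o f) al ga.

Let oO al be ga : open (O al be ga).
Proof.
by apply: openI; apply: rep_open => //; [exact: sf.1|move=> p Wp; exact: continuous_smooth_comp].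
Qed.

Let repE al be ga x : O al be ga x ->
  coord_rep (h \o f) al ga x = coord_rep h be ga (coord_rep f al be x).
Proof. by case=> [[_ _ dx] _]; rewrite /coord_rep /= (paramK cN). Qed.

Let rep_image al be ga x : O al be ga x -> rep_dom W' h be ga (coord_rep f al be x).
Proof.
case=> [[ix Wx dx] [_ _ dhx]]; split; first exact: img_coord.
- by rewrite /coord_rep (paramK cN)//; exact: WW'.
- by rewrite /coord_rep (paramK cN).
Qed.

Let smooth_repO al be ga : smooth_vfun (O al be ga) (coord_rep f al be).
Proof. by move=> j; apply: (smooth_sub _ (sf.2 al be j)) => x []. Qed.

Let open_rep' be ga : open (rep_dom W' h be ga).
Proof. by apply: rep_open => //; exact: sh.1. Qed.

Lemma smooth_map_comp : (forall p : N, dom (chart_at p) p) -> smooth_map W (h \o f).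
Proof.
move=> dN; split=> [p|al ga j]; first exact: continuous_smooth_comp.
apply: smooth_cover => x [ix Wx dx].
set be := chart_at (f (param al x)).
exists (O al be ga); first by split; [split; [| |exact: dN]|split].
apply: (smooth_ext (@oO al be ga) (f := fun y => coord_rep h be ga (coord_rep f al be y) 0 j)).
  by move=> y Oy; rewrite -(repE Oy).
exact: (smooth_comp (@oO al be ga) (@open_rep' be ga) (@rep_image al be ga)
  (@smooth_repO al be ga) (sh.2 be ga j)).
Qed.

Lemma jac_comp al be ga x : img al x -> W (param al x) ->
  dom be (f (param al x)) -> dom ga (h (f (param al x))) ->
  jac (coord_rep (h \o f) al ga) x =
  jac (coord_rep f al be) x *m jac (coord_rep h be ga) (coord_rep f al be x).
Proof.
move=> ix Wx dx dhx.
have Ox : O al be ga x by split; split.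
rewrite (jac_ext (@oO al be ga) Ox (@repE al be ga)).
rewrite jac_compE//.
  exact: (smooth_vdifferentiable (@oO al be ga) (@smooth_repO al be ga) Ox).
move=> j; exact: (smooth_differentiable (@open_rep' be ga) (sh.2 be ga j) (rep_image Ox)).
Qed.

End Composition.

Lemma charts_euclid d : charts (euclid d : charted R d).
Proof.
move=> al; have iT : img al = [set: 'rV[R]_d].
  by apply/seteqP; split=> // x _; exists x.
split.
- exact: openT.
- by rewrite iT; exact: openT.
- by [].
- by move=> p _; exact: cvg_id.
- by move=> p _; exact: cvg_id.
Qed.

Lemma open_preimage_continuous (T T' : topologicalType) (f : T -> T') (A : set T') :
  continuous f -> open A -> open (f @^-1` A).
Proof. by move=> cf oA; apply: open_comp => // x _; exact: cf. Qed.

Lemma continuous_entries m n m' n' (a : 'I_m' -> 'I_n' -> 'I_m) (b : 'I_m' -> 'I_n' -> 'I_n)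
    (f : 'M[R]_(m, n) -> 'M[R]_(m', n')) :
  (forall x i j, f x i j = x (a i j) (b i j)) -> continuous f.
Proof.
move=> fE x; apply: continuous_mx => i j.
have -> : (fun y => f y i j) = (fun y => y (a i j) (b i j)) by apply/funext.
exact: coord_continuous.
Qed.

Lemma charts_prod2 d e (M : charted R d) (N : charted R e) :
  charts M -> charts N -> charts (prod2 M N).
Proof.
move=> cM cN [al be] /=.
have cl : continuous (@lsubmx R 1 d e).
  by apply: (@continuous_entries _ _ _ _ (fun i _ => i) (fun _ j => lshift e j)) => *; rewrite mxE.
have cr : continuous (@rsubmx R 1 d e).
  by apply: (@continuous_entries _ _ _ _ (fun i _ => i) (fun _ j => rshift d j)) => *; rewrite mxE.
have iE : @img _ _ (prod2 M N) (al, be) =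
    (@lsubmx R 1 d e) @^-1` (img al) `&` (@rsubmx R 1 d e) @^-1` (img be).
  apply/seteqP; split=> [_ [[p q] [/= dp dq] <-]|x [[p dp px] [q dq qx]]].
    by split; rewrite /= ?row_mxKl ?row_mxKr; exact: img_coord.
  by exists (p, q) => //=; rewrite px qx hsubmxK.
split.
- rewrite openE => -[p q] [/= dp dq].
  exists (dom al, dom be) => //; split; apply: open_nbhs_nbhs; split=> //; exact: open_dom.
- by rewrite iE; apply: openI; apply: open_preimage_continuous => //; exact: open_img.
- by move=> [p q] [/= dp dq]; rewrite row_mxKl row_mxKr !paramK.
- move=> [p q] [/= dp dq]; apply: continuous_mx => i j.
  case: (split_ordP j) => k ->.
    have -> : (fun y : M * N => row_mx (coord al y.1) (coord be y.2) i (lshift e k)) =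
       (fun z => z i k) \o (coord al \o fst) by apply/funext => y; rewrite /= row_mxEl.
    apply: (@continuous_comp _ _ _ (coord al \o fst) (fun z => z i k)); last exact: coord_continuous.
    by apply: (@continuous_comp _ _ _ fst (coord al)); [exact: cvg_fst|exact: continuous_coord].
  have -> : (fun y : M * N => row_mx (coord al y.1) (coord be y.2) i (rshift d k)) =
       (fun z => z i k) \o (coord be \o snd) by apply/funext => y; rewrite /= row_mxEr.
  apply: (@continuous_comp _ _ _ (coord be \o snd) (fun z => z i k)); last exact: coord_continuous.
  by apply: (@continuous_comp _ _ _ snd (coord be)); [exact: cvg_snd|exact: continuous_coord].
- move=> x; rewrite iE => -[ix1 ix2].
  have H1 : {for x, continuous (param al \o @lsubmx R 1 d e)}.
    by apply: continuous_comp; [exact: cl|exact: continuous_param].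
  have H2 : {for x, continuous (param be \o @rsubmx R 1 d e)}.
    by apply: continuous_comp; [exact: cr|exact: continuous_param].
  exact: (cvg_pair H1 H2).
Qed.

Lemma continuous_submxrow m (d : 'I_m -> nat) i :
  continuous (fun x : 'rV[R]_(\sum_i d i) => submxrow x i).
Proof.
by apply: (@continuous_entries _ _ _ _ (fun k _ => k) (fun _ j => tagnat.Rank i j)) => *; rewrite mxE.
Qed.

Lemma cvg_prodn (I : Type) (K : I -> topologicalType) (T : Type) (F : set_system T)
    (f : T -> prod_topology K) (l : prod_topology K) : Filter F ->
  (forall i, f x i @[x --> F] --> l i) -> f x @[x --> F] --> l.
Proof.
move=> FF H; apply/cvg_sup => i A; rewrite nbhsE => -[B [[B' oB' <-] B'l] BA].
apply: (@filterS _ F _ (fun x => B' (f x i))); first by move=> x B'x; exact: BA.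
by apply: H; exact: open_nbhs_nbhs.
Qed.

Lemma charts_prodn m (d : 'I_m -> nat) (M : forall i, charted R (d i)) :
  (forall i, charts (M i)) -> charts (prodn M).
Proof.
move=> cM al.
have iE : @img _ _ (prodn M) al =
    [set x : 'rV[R]_(\sum_i d i) | forall i, img (al i) (submxrow x i)].
  apply/seteqP; split=> [_ [p dp <-] i|x ix].
    by rewrite /= mxrowK; apply: img_coord; exact: dp.
  have H i : {p | dom (al i) p & coord (al i) p = submxrow x i}.
    by have /cid2[p dp px] := ix i; exists p.
  exists (fun i => s2val (H i)) => [i|]; first exact: s2valP.
  by rewrite /= -[RHS]submxrowK; apply: eq_mxrow => i; rewrite (s2valP' (H i)).
split.
- rewrite openE => p dp.
  apply: (@near_forall_fin (prod_topology (fun i => M i)) _ p (fun i z => dom (al i) (z i))) => i.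
  have := @proj_continuous 'I_m (fun i => M i) i p; apply.
  by apply: open_nbhs_nbhs; split; [exact: open_dom|exact: dp].
- rewrite iE openE => x ix; apply: (@near_forall_fin 'rV[R]_(\sum_i d i) _ x
    (fun i y => img (al i) (submxrow y i))) => i.
  have := @continuous_submxrow _ d i x (img (al i)); apply.
  by apply: open_nbhs_nbhs; split; [exact: open_img|exact: ix].
- move=> p dp; apply: functional_extensionality_dep => i /=.
  by rewrite mxrowK paramK.
- move=> p dp; apply: continuous_mx => k j.
  have -> : (fun y : prod_topology (fun i => M i) => (@coord R _ (prodn M) al y) k j) =
     (fun z => z k (tagnat.sig2 j)) \o (@coord _ _ (M (tagnat.sig1 j)) (al (tagnat.sig1 j)) \o
       (@proj _ (fun i => M i) (tagnat.sig1 j))).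
    by apply/funext => y; rewrite /= mxE.
  have H1 : {for p, continuous (@coord _ _ (M (tagnat.sig1 j)) (al (tagnat.sig1 j)) \o
       (@proj _ (fun i => M i) (tagnat.sig1 j)) : prod_topology (fun i => M i) -> _)}.
    apply: (@continuous_comp (prod_topology (fun i => M i))).
      exact: (@proj_continuous 'I_m (fun i => M i) (tagnat.sig1 j) p).
    by apply: continuous_coord => //; exact: dp.
  have H2 := @coord_continuous R 1 _ k (tagnat.sig2 j) (coord (al (tagnat.sig1 j)) (p (tagnat.sig1 j))).
  exact: (cvg_comp _ _ H1 H2).
- move=> x; rewrite iE => ix; apply: (@cvg_prodn _ _ _ (nbhs x)) => i.
  have H : {for x, continuous (param (al i) \o (fun y : 'rV[R]_(\sum_i d i) => submxrow y i))}.
    apply: continuous_comp; first exact: continuous_submxrow.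
    by apply: continuous_param => //; exact: ix.
  exact: H.
Qed.

End Charts.

(** * Pullbacks of covariant 2-tensors *)

Section Pullback.
Context {R : realType} {d e : nat} {M : charted R d} {N : charted R e}.
Context (cM : charts M) (hN : smooth_manifold N).
Context (W : set M) (f : M -> N) (oW : open W) (sf : smooth_map W f).
Context (T : field2 N) (tT : tensor2 T).

Let cN : charts N := smooth_manifold_charts hN.
Let tN : smooth_map [set: N] (@idfun N).
Proof. by case: hN. Qed.
Let dN p : dom (chart_at p : chart_index N) p.
Proof. by case: hN. Qed.

(** [pull2] works in the chart selected at the image point, which may jump with [x]. The tensor law
    replaces it by any chart [be], which can be kept fixed when derivatives are taken. *)
Lemma pull2E al be x : img al x -> W (param al x) -> dom be (f (param al x)) ->
  pull2 f T al x = jac (coord_rep f al be) x *m T be (coord_rep f al be x)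
                   *m (jac (coord_rep f al be) x)^T.
Proof.
move=> ix Wx dx; rewrite /pull2; set be0 := chart_at _.
have dx0 : dom be0 (f (param al x)) := dN _.
have iy : img be (coord_rep f al be x) by exact: img_coord.
have Py : param be (coord_rep f al be x) = f (param al x) by exact: paramK.
rewrite (tT.2 be be0 _ iy); last by rewrite Py.
have -> : coord_rep idfun be be0 (coord_rep f al be x) = coord_rep f al be0 x.
  by rewrite {1}/coord_rep Py.
have := @jac_comp R d e e M N N cM cN cN W setT f idfun oW openT
  (fun _ _ => I) sf tN al be be0 x ix Wx dx dx0.
rewrite -[idfun \o f]/f => ->.
by rewrite !trmx_mul !mulmxA.
Qed.

Lemma smooth_pull2 al i j :
  smooth_fun [set x | img al x /\ W (param al x)] (fun x => pull2 f T al x i j).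
Proof.
apply: smooth_cover => x [ix Wx].
set be := chart_at (f (param al x)).
have oO : open (rep_dom W f al be) by apply: rep_open => //; exact: sf.1.
exists (rep_dom W f al be); first by split=> //; exact: dN.
apply: (smooth_ext (f := fun x => (jac (coord_rep f al be) x *m T be (coord_rep f al be x)
                   *m (jac (coord_rep f al be) x)^T) i j) oO).
  by move=> y [iy Wy dy]; rewrite (pull2E iy Wy dy).
have sJ : smooth_mx (rep_dom W f al be) (jac (coord_rep f al be)).
  by apply: smooth_jac; exact: sf.2.
apply: (smooth_mx_mul oO _ (smooth_mx_tr sJ)); apply: smooth_mx_mul => // k l.
apply: (@smooth_comp _ _ _ _ (img be) (fun z => T be z k l) (coord_rep f al be) oO).
- exact: open_img.
- by move=> y [iy Wy dy]; exact: img_coord.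
- exact: sf.2.
- exact: (tT.1 be k l).
Qed.

End Pullback.

Section PullbackTensor.
Context {R : realType} {d e : nat} {M : charted R d} {N : charted R e}.
Context (hM : smooth_manifold M) (hN : smooth_manifold N).
Context (f : M -> N) (sf : smooth_map setT f) (T : field2 N) (tT : tensor2 T).

Lemma tensor2_pull2 : tensor2 (pull2 f T).
Proof.
have cM := smooth_manifold_charts hM; have cN := smooth_manifold_charts hN.
split=> [al i j|al be x ix dx /=].
  have := smooth_pull2 cM hN openT sf tT al i j.
  by apply: smooth_sub => x ix; split.
have tM : smooth_map [set: M] (@idfun M) by case: hM.
have dN p : dom (chart_at p : chart_index N) p by case: hN.
set ga := chart_at (f (param al x)).
have dga : dom ga (f (param al x)) := dN _.
have iy : img be (coord_rep idfun al be x) by exact: img_coord.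
have Py : param be (coord_rep idfun al be x) = param al x by exact: paramK.
rewrite (pull2E cM hN openT sf tT ix I dga).
rewrite (@pull2E _ _ _ _ _ cM hN _ _ openT sf _ tT be ga _ iy I); last by rewrite Py.
have := @jac_comp R d d e M M N cM cM cN setT setT idfun f openT openT
  (fun _ _ => I) tM sf al be ga x ix I dx dga.
rewrite -[f \o idfun]/f => ->.
have -> : coord_rep f be ga (coord_rep idfun al be x) = coord_rep f al ga x.
  by rewrite {1}/coord_rep Py.
by rewrite !trmx_mul !mulmxA.
Qed.

End PullbackTensor.

(** * The vertical field is Killing *)

Section LocalBundle.
Context {R : realType} {d m : nat} {e : 'I_m -> nat}.
Unset Implicit Arguments.
Context (U : set 'rV[R]_d) (W : forall i, set 'rV[R]_(e i)).
Context (s V : 'rV[R]_d -> 'rV[R]_d) (F : forall i, 'rV[R]_d -> 'rV[R]_(e i)).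
Context (h : forall i, 'rV[R]_(e i) -> 'M[R]_(e i)) (a : R) (b : 'I_m -> R).
Context (oU : open U) (oW : forall i, open (W i)).
Context (ss : smooth_mx U s) (sV : smooth_mx U V).
Context (sF : forall i, smooth_vfun U (F i)) (FW : forall i x, U x -> W i (F i x)).
Context (sh : forall i j k, smooth_fun (W i) (fun y => h i y j k)).
Context (symh : forall i y, W i y -> (h i y)^T = h i y).
Context (Vs : forall x, U x -> V x *m (s x)^T = 1%:M).
Context (VF : forall i x, U x -> V x *m jac (F i) x = 0).
Context (Vds : forall x, U x ->
  V x *m (\matrix_(i, j) (partial i (fun y => s y 0 j) x - partial j (fun y => s y 0 i) x)) = 0).

Set Implicit Arguments.

Let hF i x := jac (F i) x *m h i (F i x) *m (jac (F i) x)^T.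
Let G x : 'M[R]_d := a *: ((s x)^T *m s x) + \sum_i b i *: hF i x.

Let sJ i : smooth_mx U (jac (F i)).
Proof. exact: smooth_jac. Qed.

Let shF0 i : smooth_mx U (fun x => h i (F i x)).
Proof.
by move=> j k; apply: (@smooth_comp _ _ _ _ (W i) (fun z => h i z j k) (F i) oU (oW i)) => //; exact: FW.
Qed.

Let shF i : smooth_mx U (hF i).
Proof. by apply: smooth_mx_mul => //; [exact: smooth_mx_mul|exact: smooth_mx_tr]. Qed.

Let sst : smooth_mx U (fun x => (s x)^T *m s x).
Proof. by apply: smooth_mx_mul => //; exact: smooth_mx_tr. Qed.

Lemma bundle_form_contract x : U x -> V x *m G x = a *: s x.
Proof.
move=> Ux; rewrite /G mulmxDr -scalemxAr mulmxA Vs// mul1mx mulmx_sumr big1 ?addr0// => i _.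
by rewrite -scalemxAr /hF !mulmxA VF// !mul0mx scaler0.
Qed.

(** Only the entrywise derivative along [V]. For the Lie derivative of a covariant tensor the terms
    with [jac V] have to be added, as in [LV_hF]. *)
Let LV m' n' (A : 'rV[R]_d -> 'M[R]_(m', n')) x := \sum_l V x 0 l *: mpartial l A x.

Let LV_mul m' n' p' (A : 'rV[R]_d -> 'M[R]_(m', n')) (B : 'rV[R]_d -> 'M[R]_(n', p')) x :
  U x -> smooth_mx U A -> smooth_mx U B ->
  LV (fun x => A x *m B x) x = LV A x *m B x + A x *m LV B x.
Proof.
move=> Ux sA sB; rewrite /LV mulmx_suml mulmx_sumr -big_split /=; apply: eq_bigr => l _.
by rewrite (mpartial_mul Ux l sA sB) scalerDr scalemxAl scalemxAr.
Qed.

Let LV_tr m' n' (A : 'rV[R]_d -> 'M[R]_(m', n')) x :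
  LV (fun x => (A x)^T) x = (LV A x)^T.
Proof. by rewrite /LV linear_sum /=; apply: eq_bigr => l _; rewrite mpartial_tr linearZ. Qed.

(* Differentiating V.dF = 0 moves the derivative from dF to V. *)
Let LV_jac i x : U x -> LV (jac (F i)) x = - (jac V x *m jac (F i) x).
Proof.
move=> Ux; apply/matrixP => k j; rewrite mx_oppE.
have E : mpartial k V x *m jac (F i) x + V x *m mpartial k (jac (F i)) x = 0.
  rewrite -(mpartial_mul Ux k sV (sJ (i := i))) -(mpartial_cst (0 : 'rV[R]_(e i)) k x).
  by apply: (mpartial_ext k oU Ux) => y Uy; exact: VF.
have L : (jac V x *m jac (F i) x) k j = (mpartial k V x *m jac (F i) x) 0 j.
  rewrite [LHS]mulmx_entry [RHS]mulmx_entry; apply: eq_bigr => l _.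
  by rewrite [mpartial k V x 0 l]mxE [jac V x k l]mxE.
have /rowP/(_ j) := E; rewrite mx_addE [RHS]mxE -L addrC => /eqP.
rewrite addr_eq0 => /eqP <-; rewrite [RHS]mulmx_entry /LV summxE.
apply: eq_bigr => l _; rewrite mx_scaleE; congr (_ * _).
rewrite [LHS]mxE [RHS]mxE.
have Ey h' : (fun y => jac (F i) y h' j) = partial h' (fun y => F i y 0 j).
  by apply/funext => y; rewrite mxE.
by rewrite !Ey; exact: (partialC l k oU Ux (sF i j)).
Qed.

Let LV_comp i x : U x -> LV (fun y => h i (F i y)) x = 0.
Proof.
move=> Ux; rewrite /LV.
transitivity (\sum_a (V x *m jac (F i) x) 0 a *:
    (\matrix_(j, k) partial a (fun y => h i y j k) (F i x))); last first.
  by rewrite VF// big1// => k _; rewrite mxE scale0r.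
under eq_bigr => l _ do rewrite (mpartial_comp l oU (oW i) Ux (FW i x Ux) (sF i) (sh i)) scaler_sumr.
rewrite exchange_big /=; apply: eq_bigr => k _; rewrite mulmx_entry scaler_suml.
by apply: eq_bigr => l _; rewrite scalerA.
Qed.

Let LV_hF i x : U x -> LV (hF i) x + (jac V x *m hF i x + (jac V x *m hF i x)^T) = 0.
Proof.
move=> Ux.
rewrite /hF (LV_mul Ux (smooth_mx_mul oU (sJ (i := i)) (shF0 (i := i))) (smooth_mx_tr (sJ (i := i)))).
rewrite (LV_mul Ux (sJ (i := i)) (shF0 (i := i))) LV_comp// mulmx0 addr0 LV_tr LV_jac//.
rewrite linearN /= !trmx_mul trmxK (symh i _ (FW i x Ux)) !mulNmx mulmxN !mulmxA.
by rewrite -opprD addNr.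
Qed.

(** Cartan's formula: the Lie derivative of [s] along [V] is d(s(V)) + ds(V, .), where s(V) = 1 is
    constant and the second term is zero by hypothesis. *)
Let LV_s x : U x -> LV s x = - (s x *m (jac V x)^T).
Proof.
move=> Ux; apply/rowP => j; rewrite mx_oppE.
have E : mpartial j V x *m (s x)^T + V x *m (mpartial j s x)^T = 0.
  rewrite -mpartial_tr -(mpartial_mul Ux j sV (smooth_mx_tr ss)).
  rewrite -(mpartial_cst (1%:M : 'M[R]_1) j x).
  by apply: (mpartial_ext j oU Ux) => y Uy; exact: Vs.
have L : (s x *m (jac V x)^T) 0 j = (mpartial j V x *m (s x)^T) 0 0.
  rewrite [LHS]mulmx_entry [RHS]mulmx_entry; apply: eq_bigr => l _.
  by rewrite [mpartial j V x 0 l]mxE [(s x)^T l 0]mxE [(jac V x)^T l j]mxE [jac V x j l]mxE mulrC.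
have /matrixP/(_ 0 0) := E; rewrite mx_addE [RHS]mxE -L addrC => /eqP.
rewrite addr_eq0 => /eqP <-; rewrite [RHS]mulmx_entry /LV summxE.
have /rowP/(_ j) := Vds x Ux; rewrite mulmx_entry [RHS]mxE => H.
apply/eqP; rewrite -subr_eq0 -sumrB; apply/eqP; rewrite -[RHS]H; apply: eq_bigr => l _.
rewrite mx_scaleE -mulrBr; congr (_ * _).
by rewrite [mpartial l s x 0 j]mxE [(_^T) l 0]mxE [mpartial j s x 0 l]mxE [RHS]mxE.
Qed.

(** The Lie derivative of [G] along [V] is a sum over the fibre term and the pullbacks, and each
    summand vanishes by itself; the coefficients [a] and [b i] are constants. *)
Lemma bundle_form_killing x : U x ->
  \sum_l V x 0 l *: mpartial l G x + (jac V x *m G x + (jac V x *m G x)^T) = 0.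
Proof.
move=> Ux.
have L0 : LV (fun x => (s x)^T *m s x) x + (jac V x *m ((s x)^T *m s x)
   + (jac V x *m ((s x)^T *m s x))^T) = 0.
  rewrite (LV_mul Ux (smooth_mx_tr ss) ss) LV_tr LV_s// linearN /= !trmx_mul trmxK.
  by rewrite !mulNmx mulmxN trmxK !mulmxA -opprD addNr.
rewrite -[X in X + _]/(LV G x).
have -> : LV G x = a *: LV (fun x => (s x)^T *m s x) x + \sum_i b i *: LV (hF i) x.
  rewrite /LV scaler_sumr; under [X in _ = _ + X]eq_bigr => i _ do rewrite scaler_sumr.
  rewrite exchange_big -big_split /=; apply: eq_bigr => l _.
  have sa : smooth_mx U (fun x => a *: ((s x)^T *m s x)).
    by apply: (@smooth_mxZ _ _ _ _ U (cst a)) => //; exact: smooth_cst.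
  have sb i : smooth_mx U (fun x => b i *: hF i x).
    by apply: (@smooth_mxZ _ _ _ _ U (cst (b i))) => //; exact: smooth_cst.
  have Z (c : R) (A : 'rV[R]_d -> 'M[R]_d) : smooth_mx U A ->
      mpartial l (fun y => c *: A y) x = c *: mpartial l A x.
    move=> sA; rewrite (mpartialZ Ux l (@smooth_cst _ _ U c) sA).
    by rewrite /partial derive_cst scale0r add0r.
  rewrite /G (mpartialD Ux l sa (smooth_mx_sum _ oU sb)) (mpartial_sum Ux _ l sb) Z//.
  rewrite scalerDr scalerA mulrC -scalerA scaler_sumr; congr (_ + _).
  by apply: eq_bigr => i _; rewrite Z// scalerA mulrC -scalerA.
have -> : jac V x *m G x = a *: (jac V x *m ((s x)^T *m s x)) + \sum_i b i *: (jac V x *m hF i x).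
  rewrite /G mulmxDr -scalemxAr mulmx_sumr; congr (_ + _).
  by apply: eq_bigr => i _; rewrite -scalemxAr.
have -> : (a *: (jac V x *m ((s x)^T *m s x)) + \sum_i b i *: (jac V x *m hF i x))^T =
   a *: (jac V x *m ((s x)^T *m s x))^T + \sum_i b i *: (jac V x *m hF i x)^T.
  rewrite linearD linearZ linear_sum /=; congr (_ + _).
  by apply: eq_bigr => i _; rewrite linearZ.
rewrite [X in _ + X]addrACA [LHS]addrACA -!scalerDr L0 scaler0 add0r.
rewrite -!big_split /= big1// => i _.
by rewrite -!scalerDr LV_hF// scaler0.
Qed.

End LocalBundle.

(** * The circle bundle *)

Lemma derive_line (R : realType) (V : normedModType R) (f : V -> R) (y v : V) (s : R) :
  'D_1 (fun s : R => f (y + s *: v)) s = 'D_v f (y + s *: v).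
Proof.
have E : (fun h : R => h^-1 *: (f (y + (h *: (1 : R) + s) *: v) - f (y + s *: v)))
  = (fun h : R => h^-1 *: (f (h *: v + (y + s *: v)) - f (y + s *: v))).
  apply/funext => h; congr (_ *: (f _ - _)).
  by rewrite scalerDl [_%:A]mulr1 addrCA.
by rewrite /derive /= E.
Qed.

Section CircleBundle.
Context {R : realType} {m : nat} {n : 'I_m -> nat} {M : forall i, charted R (n i + n i)}.
Context {P : charted R (\sum_i (n i + n i)).+1}.
Unset Implicit Arguments.
Context (g : forall i, field2 (M i)) (q : 'I_m -> int).
Context (proj : P -> prodn M) (act : R -> P -> P) (sigma : field1 P).
Context (kM : forall i, kaehler (g i)).
Context (hP : principal_circle_bundle proj act).
Context (hsigma : principal_connection act sigma).
Context (hcurv : has_curvature g q proj sigma).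

Set Implicit Arguments.

Let D := (\sum_i (n i + n i))%N.

Lemma total_space_manifold : smooth_manifold P.
Proof. by case: hP => -[]. Qed.

Lemma factor_manifold i : smooth_manifold (M i).
Proof. by case: (kM i) => -[]. Qed.

Let cP : charts P := smooth_manifold_charts total_space_manifold.
Let cM i : charts (M i) := smooth_manifold_charts (factor_manifold i).
Let cB : charts (prodn M) := charts_prodn cM.
Let sproj : smooth_map setT proj.
Proof. by case: hP => -[]. Qed.

Lemma dom_chart_at_factor i p : dom (chart_at p : chart_index (M i)) p.
Proof. by case: (factor_manifold i). Qed.

Definition proj_at i (p : P) : M i := proj p i.

Lemma coord_rep_proj_at al (B : chart_index (prodn M)) i x :
  coord_rep (proj_at i) al (B i) x = submxrow (coord_rep proj al B x) i.
Proof. by rewrite /coord_rep /= mxrowK. Qed.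

Lemma smooth_proj_at i : smooth_map setT (proj_at i).
Proof.
split=> [p _|al be j].
  have H1 : {for p, continuous (proj : P -> prod_topology (fun i => M i))} := sproj.1 p I.
  have H2 := @proj_continuous 'I_m (fun i => M i) i (proj p).
  exact: (cvg_comp _ _ H1 H2).
apply: smooth_cover => x [ix _ dx].
(* Smoothness of [proj] is known only in product charts, so [be] is completed by charts of the other
   factors around the image point. *)
pose B : chart_index (prodn M) :=
  dfwith (fun j => chart_at (proj (param al x) j)) i be.
have Bi : B i = be by rewrite /B dfwithin.
exists (rep_dom setT proj al B).
  split=> // k; rewrite /B; case: (eqVneq i k) => [<-|ik].
    by rewrite dfwithin.
  by rewrite dfwithout//; exact: dom_chart_at_factor.
have oO : open (rep_dom setT proj al B) by apply: rep_open => //; [exact: openT|exact: sproj.1].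
apply: (smooth_ext (f := fun y => coord_rep proj al B y 0 (tagnat.Rank i j)) oO).
  by move=> y _; rewrite -Bi coord_rep_proj_at !mxE.
exact: sproj.2.
Qed.

Lemma jac_proj_at al (B : chart_index (prodn M)) i x :
  jac (coord_rep (proj_at i) al (B i)) x = submxrow (jac (coord_rep proj al B) x) i.
Proof.
apply/matrixP => k j; rewrite [LHS]mxE [RHS]mxE [RHS]mxE; congr (partial k _ x).
by apply/funext => y; rewrite coord_rep_proj_at mxE.
Qed.

Definition act_pair (z : prod2 (euclid 1) P) : P := act (z.1 0 0) z.2.

Let sact : smooth_map setT act_pair.
Proof. by case: hP. Qed.

Let cRP : charts (prod2 (euclid 1) P) := charts_prod2 (@charts_euclid R 1) cP.

Let pair_chart (al : chart_index P) : chart_index (prod2 (euclid 1) P) := (tt, al).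

Let img_pair al (t : R) y : img al y ->
  img (pair_chart al) (row_mx (const_mx t : 'rV[R]_1) y).
Proof.
move=> iy; exists ((const_mx t : 'rV[R]_1), param al y); first by split=> //; exact: dom_param.
by rewrite /= coordK.
Qed.

Lemma coord_rep_act t al be y : coord_rep (act t) al be y =
  coord_rep act_pair (pair_chart al) be (row_mx (const_mx t : 'rV[R]_1) y).
Proof. by rewrite /coord_rep /act_pair /= row_mxKl row_mxKr mxE. Qed.

Lemma row_mx_affine (c : 'rV[R]_1) (k : nat) (y : 'rV[R]_k) :
  row_mx c y = row_mx c 0 + y *m row_mx 0 1%:M.
Proof. by rewrite mul_mx_row mulmx0 mulmx1 add_row_mx addr0 add0r. Qed.

Lemma continuous_act_pair z : {for z, continuous act_pair}.
Proof. exact: sact.1. Qed.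

Lemma smooth_act t : smooth_map setT (act t).
Proof.
have cact p : {for p, continuous (act t)}.
  have H1 : (fun p : P => ((const_mx t : 'rV[R]_1), p)) p' @[p' --> p] --> ((const_mx t : 'rV[R]_1), p).
    have A : (fun _ : P => const_mx t : 'rV[R]_1) p' @[p' --> p] --> (const_mx t : 'rV[R]_1).
      exact: cvg_cst.
    have B : (fun p : P => p) p' @[p' --> p] --> p by exact: cvg_id.
    exact: (cvg_pair A B).
  have H2 := cvg_comp _ _ H1 (@continuous_act_pair (const_mx t, p)).
  have -> : act t = act_pair \o (fun p : P => ((const_mx t : 'rV[R]_1), p)).
    by apply/funext => p'; rewrite /act_pair /= mxE.
  exact: H2.
split=> [p _|al be j]; first exact: cact.
have oO : open (rep_dom setT (act t) al be) by apply: rep_open => //; exact: openT.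
have oO' : open (rep_dom setT act_pair (pair_chart al) be).
  by apply: rep_open => //; [exact: openT|move=> z _; exact: continuous_act_pair].
have -> : (fun x => coord_rep (act t) al be x 0 j) = (fun y =>
    coord_rep act_pair (pair_chart al) be (row_mx (const_mx t : 'rV[R]_1) 0 + y *m row_mx 0 1%:M) 0 j).
  by apply/funext => y; rewrite coord_rep_act row_mx_affine.
apply: (@smooth_comp _ _ _ _ _ (fun z => coord_rep act_pair (pair_chart al) be z 0 j)
  (fun y => row_mx (const_mx t : 'rV[R]_1) 0 + y *m row_mx 0 1%:M) oO oO').
- move=> y [iy _ dy]; rewrite -row_mx_affine; split=> //; first exact: img_pair.
  by rewrite /act_pair /= row_mxKl row_mxKr mxE.
- exact: affine_smooth.
- exact: (sact.2 (pair_chart al) be j).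
Qed.

Let act0 p : act 0 p = p.
Proof. by case: hP => _ _ []. Qed.

Let proj_act t p : proj (act t p) = proj p.
Proof. by case: hP => _ _ _ [_ H] _; symmetry; apply/H; exists t. Qed.

(* In [row_mx 0 y] the block 0 is the time t of the action. *)
Definition generator (al : chart_index P) (y : 'rV[R]_D.+1) : 'rV[R]_D.+1 :=
  \row_j partial (lshift D.+1 (0 : 'I_1))
    (fun z => coord_rep act_pair (pair_chart al) al z 0 j) (row_mx 0 y).

Lemma generatorE al y j :
  'D_1 (fun t : R => coord al (act t (param al y)) 0 j) 0 = generator al y 0 j.
Proof.
rewrite mxE /partial.
have -> : (fun t : R => coord al (act t (param al y)) 0 j) =
   (fun t => (fun z => coord_rep act_pair (pair_chart al) al z 0 j)
      (row_mx 0 y + t *: delta_mx 0 (lshift D.+1 (0 : 'I_1)))).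
  apply/funext => t; have -> : row_mx 0 y + t *: delta_mx 0 (lshift D.+1 0) =
      row_mx (const_mx t : 'rV[R]_1) y.
    apply/rowP => k; case: (split_ordP k) => l ->.
      by rewrite mx_addE mx_scaleE !row_mxEl !mxE (ord1 l) !eqxx mulr1 add0r.
    by rewrite mx_addE mx_scaleE !row_mxEr !mxE eq_rlshift andbF mulr0 addr0.
  by rewrite -coord_rep_act.
etransitivity.
  exact: (derive_line (fun z => coord_rep act_pair (pair_chart al) al z 0 j) (row_mx 0 y)
    (delta_mx 0 (lshift D.+1 (0 : 'I_1))) 0).
by rewrite scale0r addr0.
Qed.

Let row0_pair al y : img al y -> rep_dom setT act_pair (pair_chart al) al (row_mx 0 y).
Proof.
move=> iy; have -> : (0 : 'rV[R]_1) = const_mx 0 by apply/rowP => k; rewrite !mxE.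
split=> //; first exact: img_pair.
by rewrite /act_pair /= row_mxKl row_mxKr mxE act0; exact: dom_param.
Qed.

Let oact al : open (rep_dom setT act_pair (pair_chart al) al).
Proof. by apply: rep_open => //; [exact: openT|move=> z _; exact: continuous_act_pair]. Qed.

Lemma smooth_generator al : smooth_mx (img al) (generator al).
Proof.
move=> i j.
have -> : (fun y => generator al y i j) =
   (fun y => partial (lshift D.+1 (0 : 'I_1)) (fun z => coord_rep act_pair (pair_chart al) al z 0 j)
     (row_mx 0 0 + y *m row_mx 0 1%:M)).
  by apply/funext => y; rewrite mxE [in LHS]row_mx_affine.
apply: (@smooth_comp _ _ _ _ _ (partial (lshift D.+1 (0 : 'I_1))
    (fun z => coord_rep act_pair (pair_chart al) al z 0 j))
  (fun y => row_mx 0 0 + y *m row_mx 0 1%:M) _ (@oact al)).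
- exact: open_img.
- by move=> y iy; rewrite -row_mx_affine; exact: row0_pair.
- by apply: affine_smooth; exact: open_img.
- by apply: smooth_partial; exact: (sact.2 (pair_chart al) al j).
Qed.

(** The derivative at t = 0 of [proj (act t p) = proj p]. The chain rule is applied to [act_pair],
    of which the generator is the time derivative. *)
Lemma generator_vertical al i be x : img al x -> dom be (proj_at i (param al x)) ->
  generator al x *m jac (coord_rep (proj_at i) al be) x = 0.
Proof.
move=> ix dx; have z0 := row0_pair ix; have [iz _ dz] := z0.
have Ez : param (pair_chart al) (row_mx 0 x) = (0, param al x).
  by rewrite /= row_mxKl row_mxKr.
have pE : proj_at i \o act_pair = proj_at i \o snd.
  by apply/funext => z; rewrite /= /proj_at /act_pair proj_act.
have := @jac_comp R _ _ _ (prod2 (euclid 1) P) P (M i) cRP cP (@cM i) setT setT act_pair (proj_at i)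
  openT openT (fun _ _ => I) sact (smooth_proj_at i) (pair_chart al) al be (row_mx 0 x) iz I dz.
have E0 : act_pair (param (pair_chart al) (row_mx 0 x)) = param al x.
  by rewrite Ez /act_pair /= mxE act0.
have E1 : coord_rep act_pair (pair_chart al) al (row_mx 0 x) = x.
  by rewrite /coord_rep E0 coordK.
rewrite E0 E1 => /(_ dx) H.
have gE : generator al x = row (lshift D.+1 (0 : 'I_1))
     (jac (coord_rep act_pair (pair_chart al) al) (row_mx 0 x)).
  by apply/rowP => j; rewrite !mxE.
rewrite gE -row_mul -H pE.
apply/rowP => j; rewrite !mxE /partial.
transitivity ('D_(delta_mx 0 (lshift D.+1 (0 : 'I_1)))
   (fun z : 'rV[R]_(1 + D.+1) => coord_rep (proj_at i) al be (rsubmx z) 0 j) (row_mx 0 x)).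
  by [].
rewrite /derive; set F := (X in lim (X @ _)).
(* The composite depends on its argument only through [rsubmx], which a step in the time direction
   does not change. *)
have -> : F = cst 0.
  apply/funext => h; rewrite /F /cst /=.
  have -> : rsubmx (h *: delta_mx 0 (lshift D.+1 0) + row_mx 0 x : 'rV[R]_(1 + D.+1)) =
     rsubmx (row_mx (0 : 'rV[R]_1) x).
    rewrite linearD /= row_mxKr -[RHS]add0r; congr (_ + _).
    by apply/rowP => k; rewrite !mxE eq_rlshift andbF mulr0.
  by rewrite subrr scaler0.
exact: lim_cst.
Qed.

Lemma connection_generator al x : img al x ->
  generator al x *m (sigma al x)^T = 1%:M.
Proof.
move=> ix; apply/matrixP => i j; rewrite !ord1 mulmx_entry [RHS]mxE eqxx.
case: hsigma => _ /(_ al x ix) H _; rewrite -[RHS]H; apply: eq_bigr => k _.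
by rewrite generatorE mulrC [(_^T) _ _]mxE.
Qed.

(* A local section through param al x exists because the circle acts transitively on fibres. *)
Lemma proj_submersion al (B : chart_index (prodn M)) x : img al x ->
  dom B (proj (param al x)) ->
  exists K, K *m jac (coord_rep proj al B) x = 1%:M.
Proof.
move=> ix dB; set p := param al x in dB *; set b := proj p.
case: hP => _ _ _ [_ Hfib] /(_ b)[U [s [phi [[oU Ub] ss sec _ _]]]].
have [t pt] : exists t, p = act t (s b).
  by apply/Hfib; rewrite sec.
have cs' : smooth_map U (act t \o s).
  apply: (smooth_map_comp cB cP cP oU openT (fun _ _ => I) ss (smooth_act t)).
  by case: total_space_manifold.
have Pb : param B (coord B b) = b by exact: (paramK cB).
have ib : img B (coord B b) by exact: img_coord.
have := @jac_comp R _ _ _ (prodn M) P (prodn M) cB cP cB U setT (act t \o s) proj oU openT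
  (fun _ _ => I) cs' sproj B al B (coord B b) ib.
rewrite Pb => /(_ Ub); rewrite [(act t \o s) b]/= -pt => /(_ (dom_param cP ix) dB).
have -> : coord_rep (act t \o s) B al (coord B b) = x.
  by rewrite /coord_rep Pb /= -pt coordK.
move=> H; exists (jac (coord_rep (act t \o s) B al) (coord B b)); rewrite -H.
have oO : open (rep_dom U (act t \o s) B al).
  by apply: rep_open => //; exact: cs'.1.
have Ox : rep_dom U (act t \o s) B al (coord B b).
  by split; rewrite ?Pb//= -pt; exact: dom_param.
rewrite -(jac_id (coord B b)); apply: (jac_ext oO Ox) => y [iy Uy _].
by rewrite /coord_rep /= proj_act sec// -[RHS](coordK cB iy).
Qed.

End CircleBundle.

Lemma mul_submxrow (R : pzRingType) (m k l : nat) (e : 'I_m -> nat)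
    (u : 'M[R]_(k, l)) (J : 'M[R]_(l, \sum_i e i)) i :
  u *m submxrow J i = submxrow (u *m J) i.
Proof.
apply/matrixP => r c; rewrite [LHS]mxE [RHS]mxE [RHS]mxE.
by apply: eq_bigr => j _; rewrite mxE.
Qed.

Lemma mulmx_sum_eq0 (R : pzRingType) (I : finType) (k l r : nat) (v : 'M[R]_(k, l))
    (A : I -> 'M[R]_(l, r)) :
  (forall i, v *m A i = 0) -> v *m (\sum_i A i) = 0.
Proof. by move=> H; rewrite mulmx_sumr big1. Qed.

Lemma form_sum (R : pzRingType) (I : finType) (k l : nat) (u : 'M[R]_(1, k)) (v : 'M[R]_(l, 1))
    (A : I -> 'M[R]_(k, l)) :
  (u *m (\sum_i A i) *m v) 0 0 = \sum_i (u *m A i *m v) 0 0.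
Proof. by rewrite mulmx_sumr mulmx_suml summxE. Qed.

Lemma lincomb_ext (R : pzRingType) (k : nat) (c : 'rV[R]_k) (A B : 'I_k -> 'M[R]_k) (X : 'M[R]_k) :
  (forall l, A l = B l) -> \sum_l c 0 l *: A l + X = \sum_l c 0 l *: B l + X.
Proof. by move=> E; congr (_ + _); apply: eq_bigr => l _; rewrite E. Qed.

Lemma form_pull (R : comPzRingType) (k l : nat) (u u' : 'rV[R]_k) (J : 'M[R]_(k, l))
    (w w' : 'rV[R]_l) (K : 'M[R]_l) :
  u *m J = w -> u' *m J = w' -> u *m (J *m K *m J^T) *m u'^T = w *m K *m w'^T.
Proof. by move=> <- <-; rewrite trmx_mul !mulmxA. Qed.

(** The left inverse [K] forces [J] to have rank [k], so the kernel is a line, and [V] spans it. *)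
Lemma ker_corank1 (F : fieldType) (k : nat) (J : 'M[F]_(k.+1, k)) (K : 'M[F]_(k, k.+1))
    (V v : 'rV[F]_k.+1) :
  K *m J = 1%:M -> V *m J = 0 -> V != 0 -> v *m J = 0 -> exists c, v = c *: V.
Proof.
move=> KJ VJ V0 vJ.
have rJ : \rank J = k.
  apply/eqP; rewrite eqn_leq rank_leq_col /= -{1}(mxrank1 F k) -KJ.
  exact: mxrankM_maxr.
have rk : \rank (kermx J) = 1%N by rewrite mxrank_ker rJ subSnn.
have sV : (V <= kermx J)%MS by apply/sub_kermxP.
have sv : (v <= kermx J)%MS by apply/sub_kermxP.
apply/sub_rVP; apply: submx_trans sv _.
by rewrite -(mxrank_leqif_sup sV) rk rank_rV V0.
Qed.

Lemma Jstd_unit (R : realType) k (w : 'rV[R]_(k + k)) : w != 0 -> w *m Jstd k != 0.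
Proof.
apply: contra => /eqP wJ; apply/eqP.
have JJ : @Jstd R k *m Jstd k = - 1%:M.
  rewrite /Jstd mulmx_block !mulmx0 !mul0mx !mul1mx !mulmx1 !add0r !addr0.
  by rewrite scalar_mx_block opp_block_mx !oppr0.
have : w *m (Jstd k *m Jstd k) = 0 by rewrite mulmxA wJ mul0mx.
by rewrite JJ mulmxN mulmx1 => /eqP; rewrite oppr_eq0 => /eqP.
Qed.

Section BundleMetric.
Context {R : realType} {m : nat} {n : 'I_m -> nat} {M : forall i, charted R (n i + n i)}.
Context {P : charted R (\sum_i (n i + n i)).+1}.
Unset Implicit Arguments.
Context (g : forall i, field2 (M i)) (q : 'I_m -> int).
Context (proj : P -> prodn M) (act : R -> P -> P) (sigma : field1 P).
Context (kM : forall i, kaehler (g i)).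
Context (hP : principal_circle_bundle proj act).
Context (hsigma : principal_connection act sigma).
Context (hcurv : has_curvature g q proj sigma).
Context (a : R) (b : 'I_m -> R) (a0 : 0 < a) (b0 : forall i, 0 < b i).
Set Implicit Arguments.

Let hPm := total_space_manifold hP.
Let cP : charts P := smooth_manifold_charts hPm.
Let cM i : charts (M i) := smooth_manifold_charts (factor_manifold kM i).
Let cB : charts (prodn M) := charts_prodn cM.
Let sproj : smooth_map setT proj.
Proof. by case: hP => -[]. Qed.
Let sproj_at i := smooth_proj_at kM hP i.
Let tg i : tensor2 (g i).
Proof. by case: (kM i) => _ []. Qed.
Let pg i al x : img al x -> posdef (g i al x).
Proof. by case: (kM i) => _ [_ H] _ _ /H. Qed.
Let G : field2 P := bundle_metric g proj sigma a b.

Let best (p : P) : chart_index (prodn M) := fun i => chart_at (proj p i).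
Let dom_best p : dom (best p) (proj p).
Proof. by move=> i; apply: dom_chart_at_factor; exact: kM. Qed.

Let oO al B : open (rep_dom setT proj al B).
Proof. by apply: rep_open => //; [exact: openT|exact: sproj.1]. Qed.

Unset Implicit Arguments.
Let F al (B : chart_index (prodn M)) i := coord_rep (proj_at proj i) al (B i).
Set Implicit Arguments.

Lemma bundle_metricE al B x : rep_dom setT proj al B x ->
  G al x = a *: ((sigma al x)^T *m sigma al x) +
    \sum_i b i *: (jac (F al B i) x *m g i (B i) (F al B i x) *m (jac (F al B i) x)^T).
Proof.
case=> ix _ dx; congr (_ + _); apply: eq_bigr => i _; congr (_ *: _).
exact: (pull2E cP (factor_manifold kM i) openT (sproj_at i) (tg i) ix I (dx i)).
Qed.

Lemma tensor2_bundle_metric : tensor2 G.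
Proof.
have tp i : tensor2 (pull2 (proj_at proj i) (g i)).
  exact: (tensor2_pull2 hPm (factor_manifold kM i) (sproj_at i) (tg i)).
have [[so to] _ _] := hsigma.
split=> [al|al be x ix dx /=].
  have oal := @open_img _ _ _ cP al.
  apply: (@smooth_mxD R _ _ _ (img al)) => //.
    apply: (@smooth_mxZ _ _ _ _ (img al) (cst a)) => //; first exact: smooth_cst.
    have ss : smooth_mx (img al) (sigma al) by move=> i j; rewrite ord1; exact: so.
    by apply: smooth_mx_mul => //; exact: smooth_mx_tr.
  apply: smooth_mx_sum => // i.
  apply: (@smooth_mxZ _ _ _ _ (img al) (cst (b i))) => //; first exact: smooth_cst.
  exact: ((tp i).1 al).
rewrite {1}/G /bundle_metric (to al be x ix dx).
set y := coord_rep idfun al be x; set J := jac _ x.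
rewrite /G /bundle_metric mulmxDr mulmxDl; congr (_ + _).
  by rewrite -scalemxAr -scalemxAl trmx_mul trmxK !mulmxA.
rewrite mulmx_sumr mulmx_suml; apply: eq_bigr => i _.
rewrite -scalemxAr -scalemxAl; congr (_ *: _).
exact: ((tp i).2 al be x ix dx).
Qed.

Lemma smooth_bundle_metric al : smooth_mx (img al) (G al).
Proof. exact: (tensor2_bundle_metric.1 al). Qed.

Let V := generator act.
Let Vs al x : img al x -> V al x *m (sigma al x)^T = 1%:M.
Proof. exact: (connection_generator hsigma). Qed.

Let posdef_ge0 k (h : 'M[R]_k) (v : 'rV[R]_k) : posdef h -> 0 <= (v *m h *m v^T) 0 0.
Proof.
move=> [_ ph]; have [->|/ph/ltW//] := eqVneq v 0.
by rewrite !mul0mx mxE.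
Qed.

(** All summands are nonnegative. If they vanish at [v], then [v] projects to zero and is a multiple
    of the generator; the factor is the value of sigma on [v], which vanishes too. *)
Lemma posdef_bundle_metric al x : img al x -> posdef (G al x).
Proof.
move=> ix; pose B := best (param al x).
have Ox : rep_dom setT proj al B x by split=> //; exact: dom_best.
rewrite (bundle_metricE Ox); set h := fun i => _.
have ph i : posdef (g i (B i) (F al B i x)).
  by apply: pg; apply: img_coord; have [_ _ ] := Ox; apply.
split.
  rewrite linearD linearZ linear_sum /= trmx_mul trmxK; congr (_ + _).
  apply: eq_bigr => i _; rewrite linearZ /= !trmx_mul trmxK mulmxA; congr (_ *: (_ *m _ *m _)).
  exact: (ph i).1.
move=> v v0; rewrite mulmxDr mulmxDl mx_addE.
set t := (v *m (sigma al x)^T) 0 0.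
have -> : (v *m (a *: ((sigma al x)^T *m sigma al x)) *m v^T) 0 0 = a * t ^+ 2.
  rewrite -scalemxAr -scalemxAl mx_scaleE; congr (_ * _).
  rewrite mulmxA -(mulmxA (v *m _)) mulmx_entry big_ord1 expr2; congr (_ * _).
  by rewrite -[sigma al x]trmxK -trmx_mul mxE.
pose w i := v *m jac (F al B i) x.
have -> : (v *m (\sum_i b i *: (jac (F al B i) x *m g i (B i) (F al B i x)
     *m (jac (F al B i) x)^T)) *m v^T) 0 0 =
   \sum_i b i * (w i *m g i (B i) (F al B i x) *m (w i)^T) 0 0.
  rewrite mulmx_sumr mulmx_suml summxE; apply: eq_bigr => i _.
  by rewrite -scalemxAr -scalemxAl mx_scaleE /w trmx_mul !mulmxA.
have qi i : 0 <= b i * (w i *m g i (B i) (F al B i x) *m (w i)^T) 0 0.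
  by apply: mulr_ge0; [exact: ltW|exact: posdef_ge0].
have s0 : 0 <= \sum_i b i * (w i *m g i (B i) (F al B i x) *m (w i)^T) 0 0.
  by apply: sumr_ge0.
have [t0|t0] := eqVneq t 0; last first.
  by apply: ltr_pwDl => //; rewrite mulr_gt0// exprn_even_gt0.
rewrite t0 expr0n mulr0 add0r lt_neqAle s0 andbT eq_sym.
apply: contra v0 => /eqP /psumr_eq0P H.
have w0 i : w i = 0.
  apply/eqP; apply: contraT => /(ph i).2 wpos.
  have /eqP := H (fun i _ => qi i) i isT.
  by rewrite mulf_eq0 gt_eqF//= gt_eqF.
have [K KJ] := proj_submersion kM hP ix (dom_best (param al x)).
have vJ (u : 'rV[R]__) : (forall i, u *m jac (F al B i) x = 0) -> u *m jac (coord_rep proj al B) x = 0.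
  move=> H'; apply/mxrowP => i; rewrite -mul_submxrow -(jac_proj_at proj al B i x).
  rewrite [LHS]H'; apply/matrixP => r c; by rewrite !mxE.
have V0 : V al x != 0.
  apply/eqP => V0; have := Vs ix; rewrite V0 mul0mx => /matrixP/(_ 0 0).
  by rewrite !mxE eqxx => /eqP; rewrite eq_sym oner_eq0.
have VJ i : V al x *m jac (F al B i) x = 0.
  apply: (generator_vertical kM hP ix).
  by have [_ _ ] := Ox; apply.
have [c vE] := ker_corank1 KJ (vJ _ VJ) V0 (vJ _ w0).
have : t = c by rewrite /t vE -scalemxAl Vs// mxE mxE eqxx mulr1.
by rewrite t0 vE => <-; rewrite scale0r.
Qed.

(** The hypotheses of [killing_curvature_gt0] are verified in one chart of the total space and one
    product chart of the base. The remaining point, that d sigma does not vanish, is checked on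
    horizontally chosen test vectors from the factor [i0]. *)
Lemma curvature_bundle_metric_gt0 al x i0 : (0 < n i0)%N -> (forall i, q i != 0) ->
  img al x -> 0 < curvature_sqnorm (G al) x.
Proof.
move=> n0 q0 ix; pose B := best (param al x).
have Ox : rep_dom setT proj al B x by split=> //; exact: dom_best.
pose U := rep_dom setT proj al B.
have oU : open U by exact: oO.
have Uimg : U `<=` img al by move=> y [].
have [[so to] _ _] := hsigma.
have ss : smooth_mx U (sigma al).
  by move=> i j; rewrite ord1; apply: smooth_sub Uimg _; exact: so.
have sV : smooth_mx U (V al).
  by move=> i j; apply: smooth_sub Uimg _; exact: (smooth_generator hP al).
have sF i : smooth_vfun U (F al B i).
  move=> j; apply: smooth_sub ((sproj_at i).2 al (B i) j) => y [iy _ dy].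
  by split=> //; exact: dy.
(* By the curvature equation d sigma is a combination of forms pulled back from the factors, and the
   vertical field is annihilated by the projections. *)
have Vds y : U y -> V al y *m ext_deriv1 sigma al y = 0.
  move=> Uy; rewrite (hcurv al y (Uimg _ Uy)); apply: mulmx_sum_eq0 => i.
  rewrite -scalemxAr /pull2 !mulmxA.
  have -> : V al y *m jac (coord_rep (fun p => proj p i) al (chart_at (proj (param al y) i))) y = 0.
    apply: (generator_vertical kM hP (Uimg _ Uy)).
    exact: (dom_chart_at_factor kM).
  by rewrite !mul0mx scaler0.
have FW i y : U y -> img (B i) (F al B i y).
  by move=> [iy _ dy]; apply: img_coord; exact: dy.
have VF i y : U y -> V al y *m jac (F al B i) y = 0.
  move=> [iy _ dy]; apply: (generator_vertical kM hP iy); exact: dy.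
have Vs' y : U y -> V al y *m (sigma al y)^T = 1%:M by move=> /Uimg; exact: Vs.
pose h i := g i (B i).
pose GL y := a *: ((sigma al y)^T *m sigma al y) +
    \sum_i b i *: (jac (F al B i) y *m h i (F al B i y) *m (jac (F al B i) y)^T).
have GE y : U y -> G al y = GL y by exact: bundle_metricE.
have oW i : open (@img R _ (M i) (B i)) by exact: open_img.
have sh i j k : smooth_fun (img (B i)) (fun y => h i y j k) by exact: ((tg i).1 (B i) j k).
have symh i y : img (B i) y -> (h i y)^T = h i y by move=> /pg [].
apply: (@killing_curvature_gt0 R _ U (G al) (V al) (sigma al) a oU) => //.
- by move=> i j; apply: smooth_sub Uimg _; exact: smooth_bundle_metric.
- by move=> y /Uimg; exact: posdef_bundle_metric.
- by rewrite lt0r_neq0.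
- move=> y Uy; rewrite (GE y Uy).
  exact: (@bundle_form_contract _ _ _ _ U (sigma al) (V al) (F al B) h a b).
- move=> y Uy; rewrite (GE y Uy).
  etransitivity; last exact: (@bundle_form_killing _ _ _ _ U (fun i => @img R _ (M i) (B i))
    (sigma al) (V al) (F al B) h a b oU oW ss sV sF FW sh symh Vs' VF Vds y Uy).
  by apply: lincomb_ext => l; exact: (mpartial_ext l oU Uy GE).
have [K KJ] := proj_submersion kM hP ix (dom_best (param al x)).
(* A basis vector of the factor [i0], extended by zero. The right multiplication by [K] lifts [w]
   and its image under the complex structure to [u] and [u'], on which d sigma takes the value
   [q i0] times a squared length. *)
pose w i : 'rV[R]_(n i + n i) := \row_l ((i == i0) && (val l == 0%N))%:R.
pose u := \mxrow_i w i *m K.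
pose u' := \mxrow_i (w i *m Jstd (n i)) *m K.
have uJ i : u *m jac (F al B i) x = w i.
  rewrite (jac_proj_at proj al B i x) mul_submxrow /u -mulmxA KJ mulmx1.
  exact: mxrowK.
have u'J i : u' *m jac (F al B i) x = w i *m Jstd (n i).
  rewrite (jac_proj_at proj al B i x) mul_submxrow /u' -mulmxA KJ mulmx1.
  exact: mxrowK.
have pos : 0 < (w i0 *m Jstd (n i0) *m h i0 (F al B i0 x) *m (w i0 *m Jstd (n i0))^T) 0 0.
  apply: (pg (FW i0 x Ox)).2; apply: Jstd_unit; apply/eqP => /rowP.
  have n0' : (0 < n i0 + n i0)%N by rewrite addn_gt0 n0.
  by move=> /(_ (Ordinal n0')); rewrite !mxE !eqxx /= => /eqP; rewrite oner_eq0.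
have E : (u *m ext_deriv1 sigma al x *m u'^T) 0 0 = (q i0)%:~R *
   (w i0 *m Jstd (n i0) *m h i0 (F al B i0 x) *m (w i0 *m Jstd (n i0))^T) 0 0.
  rewrite (hcurv al x ix) form_sum.
  have T i : (u *m ((q i)%:~R *: pull2 (fun p => proj p i) (kaehler_form (g i)) al x) *m u'^T) 0 0
    = (q i)%:~R * (w i *m Jstd (n i) *m h i (F al B i x) *m (w i *m Jstd (n i))^T) 0 0.
    rewrite -scalemxAr -scalemxAl mx_scaleE; congr (_ * _).
    have H := form_pull (kaehler_form (g i) (B i) (F al B i x)) (uJ i) (u'J i).
    have -> : w i *m Jstd (n i) *m h i (F al B i x) =
        w i *m kaehler_form (g i) (B i) (F al B i x) by rewrite /kaehler_form mulmxA.
    by rewrite -H.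
  rewrite (eq_bigr _ (fun i _ => T i)) (bigD1 i0)//= big1 ?addr0// => i ii0.
  have -> : w i = 0 by apply/rowP => l; rewrite !mxE (negPf ii0).
  by rewrite !mul0mx mxE mulr0.
apply/eqP => ds0.
have : (u *m ext_deriv1 sigma al x *m u'^T) 0 0 = 0.
  by rewrite -[ext_deriv1 sigma al x]/(\matrix_(i, j) _) ds0 mulmx0 mul0mx mxE.
rewrite E => /eqP; rewrite mulf_eq0 intr_eq0 (negPf (q0 i0)) /= => /eqP H.
by move: pos; rewrite H ltxx.
Qed.

End BundleMetric.

(** * Compactness of the total space *)

Lemma ultra_compact_cvg (T : Type) (X : topologicalType) (F : set_system T) (f : T -> X)
    (A : set X) : UltraFilter F -> compact A -> F (f @^-1` A) ->
  exists2 b, A b & f @ F --> b.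
Proof.
move=> FU cA FA; have PF : ProperFilter F by exact: ultra_proper.
have [b [Ab clb]] := cA (f @ F) (fmap_proper_filter f PF) FA.
exists b => // N nN; rewrite /fmap /=.
have [//|FN] := in_ultra_setVsetC (f @^-1` N) FU.
have [z [/= nz Nz]] := clb (~` N) N FN nN.
by [].
Qed.

Lemma cvg_const_mx (R : realType) (T : Type) (F : set_system T) (k l : nat) (f : T -> R) (y : R) :
  Filter F -> f x @[x --> F] --> y ->
  (const_mx (f x) : 'M[R]_(k, l)) @[x --> F] --> (const_mx y : 'M[R]_(k, l)).
Proof.
move=> FF fy; apply: cvg_mx => i j; rewrite mxE.
have -> : (fun x => (const_mx (f x) : 'M[R]_(k, l)) i j) = f by apply/funext => x; rewrite mxE.
exact: fy.
Qed.

Lemma compact_prodn (R : realType) m (d : 'I_m -> nat) (M : forall i, charted R (d i)) :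
  (forall i, compact [set: M i]) -> compact [set: prodn M].
Proof.
move=> cM; rewrite compact_ultra => F FU _.
have PF : ProperFilter F by exact: ultra_proper.
have H i : {b : M i | (fun z : prodn M => z i) @ F --> b}.
  apply: cid; have [||b _ Fb] := @ultra_compact_cvg (prodn M) (M i) F (fun z => z i) setT FU.
  - exact: cM.
  - by rewrite preimage_setT; exact: filterT.
  by exists b.
exists (fun i => sval (H i)); split=> //.
by apply: (@cvg_prodn 'I_m (fun i => M i) _ F id) => i; exact: svalP (H i).
Qed.

Section Compactness.
Context {R : realType} {m : nat} {n : 'I_m -> nat} {M : forall i, charted R (n i + n i)}.
Context {P : charted R (\sum_i (n i + n i)).+1} {proj : P -> prodn M} {act : R -> P -> P}.

(** Along an ultrafilter the projections converge to some [b]. Near [b] a point is [act t (s b')]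
    with [t] in a period interval, so [t] converges as well, and continuity of the section and of
    the action gives the limit. *)
Lemma compact_total_space : principal_circle_bundle proj act ->
  (forall i, compact [set: M i]) -> compact [set: P].
Proof.
move=> hP cM; rewrite compact_ultra => F FU _.
have PF : ProperFilter F by exact: ultra_proper.
have [||b _ Fb] := @ultra_compact_cvg P (prodn M) F proj setT FU.
- exact: compact_prodn.
- by rewrite preimage_setT; exact: filterT.
case: (hP) => _ sact [act0 actD] [actper Hfib] /(_ b)[U [s [phi [[oU Ub] ss sec _ _]]]].
have tpi : 0 < 2 * pi :> R by rewrite mulr_gt0// pi_gt0.
(* The time is reduced modulo 2 pi by subtracting whole periods; for points outside the domain of
   the section it is set to 0. *)
have HT p : {t : R | t \in `[0, 2 * pi] & U (proj p) -> p = act t (s (proj p))}.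
  have [Up|nUp] := pselect (U (proj p)); last first.
    by exists 0 => //; rewrite in_itv /= lexx ltW.
  have /cid[t pt] : exists t, p = act t (s (proj p)) by apply/Hfib; rewrite sec.
  pose k := Num.floor (t / (2 * pi)).
  exists (t - k%:~R * (2 * pi)) => [|_].
    rewrite in_itv /= subr_ge0 -ler_pdivlMr// floor_le_tmp /= lerBlDr.
    rewrite -{1}(mul1r (2 * pi)) -mulrDl -ler_pdivrMr// ltW//.
    by rewrite addrC; have := floorD1_gt (t / (2 * pi)); rewrite intrD.
  have E : act (k%:~R * (2 * pi)) (s (proj p)) = s (proj p).
    by apply: (actper _ _).2; exists k.
  have : act t (s (proj p)) = act (t - k%:~R * (2 * pi)) (s (proj p)).
    by have := actD (t - k%:~R * (2 * pi)) (k%:~R * (2 * pi)) (s (proj p)); rewrite subrK E.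
  by rewrite -pt.
pose T p := s2val (HT p).
have [||t0 _ Ft] := @ultra_compact_cvg P R F T `[0, 2 * pi] FU.
- exact: segment_compact.
- apply: (@filterS _ F _ setT); last exact: filterT.
  by move=> p _; exact: (s2valP (HT p)).
exists (act t0 (s b)); split=> //.
have FU' : F (proj @^-1` U) by apply: Fb; exact: open_nbhs_nbhs.
have cs : {for b, continuous s} by exact: ss.1.
have H1 : s (proj p) @[p --> F] --> s b by exact: (cvg_comp _ _ Fb cs).
have H2 : (const_mx (T p) : 'rV[R]_1) @[p --> F] --> (const_mx t0 : 'rV[R]_1).
  exact: cvg_const_mx.
have ca : {for (const_mx t0, s b), continuous (fun z : prod2 (euclid 1) P => act (z.1 0 0) z.2)}.
  exact: sact.1.
have H4 := cvg_comp _ _ (cvg_pair H2 H1) ca.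
rewrite /= mxE in H4; move=> N nN.
have FN : F [set p | N (act ((const_mx (T p) : 'rV[R]_1) 0 0) (s (proj p)))] by apply: H4.
apply: (@filterS P F _ _ _ _ (filterI FU' FN)) => p [/= Up].
by rewrite mxE -(s2valP' (HT p) Up).
Qed.

End Compactness.

(** * Excluding factors of dimension zero *)

Section DimensionZero.
Context {R : realType} {N : charted R (0 + 0)}.

(** A chart with values in R^0 is injective, so its domain is a single point; the topology is
    discrete, and connectedness leaves one point. *)
Lemma connected_dim0 : smooth_manifold N -> connected [set: N] -> forall p q : N, p = q.
Proof.
move=> hN coN p q; have cN := smooth_manifold_charts hN.
have op z : open [set z : N].
  have dz : dom (chart_at z) z by case: hN.
  have -> : [set z] = dom (chart_at z); last exact: open_dom.
  apply/seteqP; split=> [_ ->//|w dw /=].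
  have E : coord (chart_at z) w = coord (chart_at z) z by apply/rowP => -[].
  by have := congr1 (param (chart_at z)) E; rewrite !(paramK cN).
apply: contrapT => pq.
have oC : open (~` [set p]).
  have -> : ~` [set p] = \bigcup_(z in ~` [set p]) [set z].
    by apply/seteqP; split=> [z nz|_ [z nz ->]]; [exists z|].
  by apply: bigcup_open => z _; exact: op.
have : [set p] = [set: N].
  apply: (coN [set p]); first by exists p.
  - by exists [set p] => //; rewrite setTI.
  - exists [set p]; last by rewrite setTI.
    by rewrite -openC.
by move/seteqP => [_ /(_ q I)] /= qp; apply: pq.
Qed.

(** All simplices in a point are constant. The three faces of a 2-simplex enter with signs +, -, +,
    so every 2-cochain is the coboundary of the 1-cochain with the same value. The class is zero,
    against its infinite order. *)
Lemma dim0_not_indivisible (w : field2 N) : (forall p q : N, p = q) ->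
  ~ indivisible_integral w.
Proof.
move=> N1 [c [[cc _] _ free _]].
have fE k (f f' : 'rV[R]_k -> N) : f = f' by apply/funext => x; exact: N1.
have : (1 : int) = 0; last by [].
apply: free; exists (fun _ => c (fun _ => base N)).
  by move=> f f' _ _ _.
move=> f _; rewrite mul1r add0r /coboundary !big_ord_recl big_ord0 /=.
by rewrite addr0 (fE _ f (fun _ => base N)) addrA addrN add0r.
Qed.

End DimensionZero.

(** * The family of metrics with unit fibre *)

Section ParametricCurvature.
Context {R : realType} {d m : nat}.

Lemma partial_lshift (F : 'rV[R]_(d + m) -> R) (b : 'rV[R]_m) (i : 'I_d) (y : 'rV[R]_d) :
  partial i (fun y => F (row_mx y b)) y = partial (lshift m i) F (row_mx y b).
Proof.
have E : (fun h : R => h^-1 *: (F (row_mx (h *: delta_mx 0 i + y) b) - F (row_mx y b)))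
  = (fun h : R => h^-1 *: (F (h *: delta_mx 0 (lshift m i) + row_mx y b) - F (row_mx y b))).
  apply/funext => h; congr (_ *: (F _ - _)).
  have -> : delta_mx 0 (lshift m i) = row_mx (delta_mx 0 i) 0 :> 'rV[R]_(d + m).
    apply/rowP => k; case: (split_ordP k) => l ->.
      by rewrite row_mxEl !mxE eq_lshift.
    by rewrite row_mxEr !mxE eq_rlshift andbF.
  by rewrite scale_row_mx add_row_mx scaler0 add0r.
by rewrite /partial /derive /= E.
Qed.

Context (O : set 'rV[R]_(d + m)) (G : 'rV[R]_(d + m) -> 'M[R]_d).
Context (oO : open O) (sG : forall i j, smooth_fun O (fun z => G z i j)).
Context (uG : forall z, O z -> G z \in unitmx).

(** Differentiation is along the first [d] coordinates only; the last [m] are parameters. Joint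
    smoothness in point and parameter then follows from the rules for smooth functions of [d + m]
    variables. *)
Definition param_christoffel (i j k : 'I_d) (z : 'rV[R]_(d + m)) : R :=
  2^-1 * \sum_l invmx (G z) k l *
    (partial (lshift m i) (fun z => G z j l) z + partial (lshift m j) (fun z => G z i l) z
     - partial (lshift m l) (fun z => G z i j) z).

Definition param_curvature (i j k l : 'I_d) (z : 'rV[R]_(d + m)) : R :=
  partial (lshift m i) (param_christoffel j k l) z
  - partial (lshift m j) (param_christoffel i k l) z
  + \sum_h (param_christoffel j k h z * param_christoffel i h l z
            - param_christoffel i k h z * param_christoffel j h l z).

Definition param_sqnorm (z : 'rV[R]_(d + m)) : R :=
  tensor_sqnorm (invmx (G z)) (G z) (fun i j k l => param_curvature i j k l z).

Lemma param_christoffelE b i j k :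
  christoffel (fun y => G (row_mx y b)) i j k = fun y => param_christoffel i j k (row_mx y b).
Proof.
apply/funext => y; congr (_ * _); apply: eq_bigr => l _; congr (_ * _).
by rewrite -!partial_lshift.
Qed.

Lemma param_curvatureE b i j k l y :
  curvature (fun y => G (row_mx y b)) i j k l y = param_curvature i j k l (row_mx y b).
Proof.
rewrite /curvature /param_curvature !param_christoffelE -!partial_lshift; congr (_ + _).
by apply: eq_bigr => h _; rewrite !param_christoffelE.
Qed.

Lemma param_sqnormE b y :
  curvature_sqnorm (fun y => G (row_mx y b)) y = param_sqnorm (row_mx y b).
Proof.
rewrite /curvature_sqnorm tensor_sqnormE; congr (tensor_sqnorm _ _ _).
apply/funext => i; apply/funext => j; apply/funext => k; apply/funext => l.
exact: param_curvatureE.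
Qed.

Lemma smooth_param_christoffel i j k : smooth_fun O (param_christoffel i j k).
Proof.
apply: (@smoothM _ _ O (cst 2^-1) (fun x => \sum_l _)) => //; first exact: smooth_cst.
apply: (@smooth_sum _ _ O _ _ xpredT (fun l x => _)) => // l _.
apply: (@smoothM _ _ O (fun x => invmx (G x) k l) (fun x => _)) => //.
  exact: smooth_invmx.
apply: (@smoothB _ _ O (fun x => partial (lshift m i) _ x + partial (lshift m j) _ x)
  (partial (lshift m l) _)) => //; last exact/smooth_partial/sG.
by apply: (@smoothD _ _ O (partial (lshift m i) _) (partial (lshift m j) _)) => //; exact/smooth_partial/sG.
Qed.

Lemma smooth_param_curvature i j k l : smooth_fun O (param_curvature i j k l).
Proof.
have sc := smooth_param_christoffel.
apply: (@smoothD _ _ O (fun z => partial (lshift m i) (param_christoffel j k l) z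
  - partial (lshift m j) (param_christoffel i k l) z)) => //.
  by apply: (@smoothB _ _ O (partial (lshift m i) _) (partial (lshift m j) _)) => //; exact/smooth_partial/sc.
apply: (@smooth_sum _ _ O _ _ xpredT (fun h z => param_christoffel j k h z * param_christoffel i h l z
            - param_christoffel i k h z * param_christoffel j h l z)) => // h _.
apply: (@smoothB _ _ O (fun z => param_christoffel j k h z * param_christoffel i h l z)) => //;
by apply: smoothM => //; exact: sc.
Qed.

Lemma smooth_contract (h : 'rV[R]_(d + m) -> 'M[R]_d) (F : 'I_d -> 'I_d -> 'rV[R]_(d + m) -> R) :
  (forall i j, smooth_fun O (fun z => h z i j)) -> (forall i j, smooth_fun O (F i j)) ->
  smooth_fun O (fun z => contract (h z) (fun i j => F i j z)).
Proof.
move=> sh sF; rewrite /contract.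
apply: (@smooth_sum _ _ O _ _ xpredT (fun i z => \sum_j h z i j * F i j z)) => // i _.
apply: (@smooth_sum _ _ O _ _ xpredT (fun j z => h z i j * F i j z)) => // j _.
by apply: (@smoothM _ _ O (fun z => h z i j)).
Qed.

Lemma smooth_param_sqnorm : smooth_fun O param_sqnorm.
Proof.
have si : forall i j, smooth_fun O (fun z => invmx (G z) i j) by exact: smooth_invmx.
apply: (@smooth_contract (fun z => invmx (G z)) (fun i i' z => _)) => // i i'.
apply: (@smooth_contract (fun z => invmx (G z)) (fun j j' z => _)) => // j j'.
apply: (@smooth_contract (fun z => invmx (G z)) (fun k k' z => _)) => // k k'.
apply: (@smooth_contract G (fun l l' z => _)) => // l l'.
by apply: smoothM => //; exact: smooth_param_curvature.
Qed.

End ParametricCurvature.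

Lemma jac_transition_unit (R : realType) d (M : charted R d) (al be : chart_index M) x :
  smooth_manifold M -> img al x -> dom be (param al x) ->
  jac (coord_rep (@idfun M) al be) x \in unitmx.
Proof.
move=> hM ix dx; have cM := smooth_manifold_charts hM.
have tM : smooth_map [set: M] (@idfun M) by case: hM.
have := @jac_comp R d d d M M M cM cM cM setT setT idfun idfun openT openT
  (fun _ _ => I) tM tM al be al x ix I dx (dom_param cM ix).
have -> : jac (coord_rep (idfun \o idfun) al al) x = 1%:M.
  rewrite -(jac_id x); apply: (jac_ext (@open_img _ _ _ cM al) ix) => y iy.
  by rewrite /coord_rep /= coordK.
by move=> /esym /mulmx1_unit [].
Qed.

Lemma curvature_sqnorm_chart (R : realType) d (M : charted R d) (T : field2 M)
    (al be : chart_index M) x :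
  smooth_manifold M -> tensor2 T -> (forall al x, img al x -> posdef (T al x)) ->
  img al x -> dom be (param al x) ->
  curvature_sqnorm (T al) x = curvature_sqnorm (T be) (coord be (param al x)).
Proof.
move=> hM tT pT ix dx; have cM := smooth_manifold_charts hM.
have tM : smooth_map [set: M] (@idfun M) by case: hM.
pose U := rep_dom setT (@idfun M) al be.
have oU : open U by apply: rep_open => //; [exact: openT|exact: tM.1].
apply: (@curvature_sqnorm_change _ _ U (img be) (T al) (T be) (coord_rep idfun al be) oU).
- exact: open_img.
- by move=> i j; apply: smooth_sub (tT.1 al i j) => y [].
- exact: (tT.1 be).
- by move=> y [iy _ _]; exact: pT.
- exact: pT.
- by move=> y [_ _ dy]; exact: img_coord.
- exact: (tM.2 al be).
- by move=> y [iy _ dy]; exact: jac_transition_unit.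
- by move=> y [iy _ dy]; exact: (tT.2 al be y iy dy).
- by split.
Qed.

Section MetricFamily.
Context {R : realType} {m : nat} {n : 'I_m -> nat} {M : forall i, charted R (n i + n i)}.
Context {P : charted R (\sum_i (n i + n i)).+1}.
Unset Implicit Arguments.
Context (g : forall i, field2 (M i)) (q : 'I_m -> int).
Context (proj : P -> prodn M) (act : R -> P -> P) (sigma : field1 P).
Context (kM : forall i, kaehler (g i)).
Context (hP : principal_circle_bundle proj act).
Context (hsigma : principal_connection act sigma).
Context (hcurv : has_curvature g q proj sigma).
Set Implicit Arguments.

Let d := (\sum_i (n i + n i)).+1.

(* Up to scaling, all the metrics of the family have a = 1; be lists the b_i. *)
Definition unit_fiber_metric (be : 'rV[R]_m) : field2 P :=
  bundle_metric g proj sigma 1 (fun i => be 0 i).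

Definition positive_row : set 'rV[R]_m := [set be | forall i, 0 < be 0 i].

Lemma open_positive_row : open positive_row.
Proof.
rewrite openE => b pb; apply: (@near_forall_fin 'rV[R]_m _ b (fun i c => 0 < c 0 i)) => i.
have := @coord_continuous R 1 m 0 i b [set t | 0 < t]; apply.
apply: open_nbhs_nbhs; split; [exact: open_gt|exact: pb].
Qed.

Let hPm := total_space_manifold hP.
Let cP : charts P := smooth_manifold_charts hPm.

Let pos be : positive_row be -> forall al x, img al x -> posdef (unit_fiber_metric be al x).
Proof. by move=> pb al x; exact: (posdef_bundle_metric kM hP hsigma ltr01 pb). Qed.

Let tens be : tensor2 (unit_fiber_metric be).
Proof. exact: (tensor2_bundle_metric kM hP hsigma). Qed.

Definition family_domain (al : chart_index P) : set 'rV[R]_(d + m) :=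
  [set z | img al (lsubmx z) /\ positive_row (rsubmx z)].

Definition family_form (al : chart_index P) (z : 'rV[R]_(d + m)) : 'M[R]_d :=
  unit_fiber_metric (rsubmx z) al (lsubmx z).

Lemma open_family_domain al : open (family_domain al).
Proof.
have cl : continuous (@lsubmx R 1 d m).
  by apply: (@continuous_entries _ _ _ _ _ (fun i _ => i) (fun _ j => lshift m j)) => *; rewrite mxE.
have cr : continuous (@rsubmx R 1 d m).
  by apply: (@continuous_entries _ _ _ _ _ (fun i _ => i) (fun _ j => rshift d j)) => *; rewrite mxE.
have -> : family_domain al = (@lsubmx R 1 d m) @^-1` (img al) `&` (@rsubmx R 1 d m) @^-1` positive_row.
  by [].
apply: openI; apply: open_preimage_continuous => //; [exact: open_img|exact: open_positive_row].
Qed.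

Lemma smooth_family_form al i j : smooth_fun (family_domain al) (fun z => family_form al z i j).
Proof.
have oO := @open_family_domain al.
have sl : smooth_vfun (family_domain al) (@lsubmx R 1 d m).
  move=> k; apply: (smooth_ext (f := fun z => z 0 (lshift m k)) oO); last exact: smooth_coord.
  by move=> z _; rewrite mxE.
have sc (A : 'rV[R]_d -> R) : smooth_fun (img al) A -> smooth_fun (family_domain al) (fun z => A (lsubmx z)).
  by move=> sA; apply: (smooth_comp oO (@open_img _ _ _ cP al) _ sl sA) => z [].
have [[so _] _ _] := hsigma.
apply: (smooth_ext (f := fun z => (sigma al (lsubmx z) 0 i * sigma al (lsubmx z) 0 j) +
   \sum_k z 0 (rshift d k) * pull2 (fun p => proj p k) (g k) al (lsubmx z) i j) oO).
  move=> z _; rewrite /family_form /unit_fiber_metric /bundle_metric scale1r mx_addE summxE.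
  rewrite mulmx_entry big_ord1 [(_^T) i 0]mxE; congr (_ + _); apply: eq_bigr => k _.
  by rewrite mx_scaleE [rsubmx z 0 k]mxE.
apply: (@smoothD _ _ _ (fun z => sigma al (lsubmx z) 0 i * sigma al (lsubmx z) 0 j)) => //.
  by apply: (@smoothM _ _ _ (fun z => sigma al (lsubmx z) 0 i)) => //;
    apply: (sc (fun y => sigma al y 0 _)); exact: so.
apply: (@smooth_sum _ _ _ _ _ xpredT (fun k z => z 0 (rshift d k) *
  pull2 (fun p => proj p k) (g k) al (lsubmx z) i j)) => // k _.
apply: (@smoothM _ _ _ (fun z : 'rV[R]_(d + m) => z 0 (rshift d k))) => //; first exact: smooth_coord.
apply: (sc (fun y => pull2 (fun p => proj p k) (g k) al y i j)).
have tg : tensor2 (g k) by case: (kM k) => _ [].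
have := smooth_pull2 cP (factor_manifold kM k) openT (smooth_proj_at kM hP k) tg al i j.
by apply: smooth_sub => y iy; split.
Qed.

Lemma family_form_posdef al z : family_domain al z -> posdef (family_form al z).
Proof. by move=> [iz pz]; exact: pos. Qed.

Definition family_sqnorm (z : P * 'rV[R]_m) : R :=
  curvature_sqnorm (unit_fiber_metric z.2 (chart_at z.1)) (coord (chart_at z.1) z.1).

Lemma dom_chart_at_total p : dom (chart_at p : chart_index P) p.
Proof. by case: hPm. Qed.

Lemma family_sqnormE al p be : positive_row be -> dom al p ->
  family_sqnorm (p, be) = param_sqnorm (family_form al) (row_mx (coord al p) be).
Proof.
move=> pb dp; rewrite -param_sqnormE /family_sqnorm /=.
have -> : (fun y => family_form al (row_mx y be)) = unit_fiber_metric be al.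
  by apply/funext => y; rewrite /family_form row_mxKl row_mxKr.
have Pp : param (chart_at p) (coord (chart_at p) p) = p.
  by rewrite (paramK cP)//; exact: dom_chart_at_total.
have ip : img (chart_at p) (coord (chart_at p) p).
  by apply: img_coord; exact: dom_chart_at_total.
have := @curvature_sqnorm_chart R _ P (unit_fiber_metric be) (chart_at p) al
  (coord (chart_at p) p) hPm (@tens be) (pos pb) ip.
rewrite Pp => H; exact: (H dp).
Qed.

Lemma continuous_row_mx_coord al (p : P) (be : 'rV[R]_m) : dom al p ->
  {for (p, be), continuous (fun z : P * 'rV[R]_m => row_mx (coord al z.1) z.2)}.
Proof.
move=> dp; have H1 : (fun z : P * 'rV[R]_m => coord al z.1) z @[z --> (p, be)] --> coord al p.
  have F1 : (fun z : P * 'rV[R]_m => z.1) z @[z --> (p, be)] --> p by exact: cvg_fst.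
  have F2 : {for p, continuous (coord al)} by exact: continuous_coord.
  exact: (cvg_comp _ _ F1 F2).
have H2 : (fun z : P * 'rV[R]_m => z.2) z @[z --> (p, be)] --> be by exact: cvg_snd.
apply: continuous_mx => i j; rewrite /prop_for /continuous_at /=.
case: (split_ordP j) => k ->.
  have -> : (fun z : P * 'rV[R]_m => row_mx (coord al z.1) z.2 i (lshift m k)) =
     (fun z => coord al z.1 i k) by apply/funext => z; rewrite row_mxEl.
  rewrite row_mxEl; exact: (cvg_comp _ _ H1 (@coord_continuous _ _ _ i k _)).
have -> : (fun z : P * 'rV[R]_m => row_mx (coord al z.1) z.2 i (rshift d k)) =
     (fun z => z.2 i k) by apply/funext => z; rewrite row_mxEr.
rewrite row_mxEr; exact: (cvg_comp _ _ H2 (@coord_continuous _ _ _ i k _)).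
Qed.

(** The definition refers to the chart selected at each point. Around [p] it is rewritten in the
    single chart [al], where it is a smooth function of point and parameters. *)
Lemma continuous_family_sqnorm p be : positive_row be ->
  {for (p, be), continuous family_sqnorm}.
Proof.
move=> pb; set al := chart_at p; have dp : dom al p by exact: dom_chart_at_total.
pose U : set (P * 'rV[R]_m) := [set z | dom al z.1 /\ positive_row z.2].
have oU : open U.
  rewrite openE => -[p' b'] [/= dp' pb'].
  exists (dom al, positive_row) => //; split; apply: open_nbhs_nbhs; split=> //.
    exact: open_dom.
  exact: open_positive_row.
have Up : U (p, be) by [].
apply: (continuous_at_ext oU Up (f := fun z => param_sqnorm (family_form al) (row_mx (coord al z.1) z.2))).
  by move=> [p' b'] [/= dp' pb']; rewrite (family_sqnormE pb' dp').
have H1 := @continuous_row_mx_coord al p be dp.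
have H2 : {for row_mx (coord al p) be, continuous (param_sqnorm (family_form al))}.
  apply: (@smooth_continuous _ _ (family_domain al)).
    apply: smooth_param_sqnorm => [|i j|z Oz]; first exact: open_family_domain.
      exact: smooth_family_form.
    exact: posdef_unitmx (family_form_posdef Oz).
  by split; rewrite ?row_mxKl ?row_mxKr//; exact: img_coord.
exact: (cvg_comp _ _ H1 H2).
Qed.

Definition row_box (lo hi : R) : set 'rV[R]_m := [set be | forall i, `[lo, hi]%classic (be 0 i)].

Lemma compact_row_box lo hi : compact (row_box lo hi).
Proof. by apply: (@rV_compact _ _ (fun _ => `[lo, hi]%classic)) => i; exact: segment_compact. Qed.

Lemma row_box_positive lo hi be : 0 < lo -> row_box lo hi be -> positive_row be.
Proof. by move=> lo0 kb i; have := kb i; rewrite /= in_itv /= => /andP[/(lt_le_trans lo0)]. Qed.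

Lemma family_sqnorm_bounds (lo hi : R) i0 : compact [set: P] -> (0 < n i0)%N ->
  (forall i, q i != 0) -> 0 < lo -> lo <= hi ->
  exists de C, 0 < de /\ forall p be, row_box lo hi be ->
    de <= family_sqnorm (p, be) <= C.
Proof.
move=> cpt n0 q0 lo0 lohi.
pose A : set (P * 'rV[R]_m) := [set: P] `*` row_box lo hi.
have cA : compact A by apply: compact_setX => //; exact: compact_row_box.
have A0 : A !=set0.
  exists (base P, const_mx lo); split=> // i.
  by rewrite mxE /= in_itv /= lexx.
have cf : {within A, continuous family_sqnorm}.
  apply: continuous_in_subspaceT => -[p be]; rewrite inE => -[_ /= kb].
  exact: continuous_family_sqnorm (row_box_positive lo0 kb).
have [zM _ HM] := compact_EVT_max A0 cA cf.
have [zm zmA Hm] := compact_EVT_min A0 cA cf.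
exists (family_sqnorm zm), (family_sqnorm zM); split=> [|p be kb].
  move: zmA; rewrite inE => -[_ kb]; case: zm {Hm} kb => p be /= kb.
  apply: (curvature_bundle_metric_gt0 kM hP hsigma hcurv ltr01 (row_box_positive lo0 kb) n0 q0).
  by apply: img_coord; exact: dom_chart_at_total.
have zA : (p, be) \in A by rewrite inE.
by apply/andP; split; [exact: Hm|exact: HM].
Qed.

End MetricFamily.

(** * Lengths, balls and volumes *)

Section UnmeasurableIntegrands.
Context {R : realType}.
Local Open Scope ereal_scope.

(* No measurability is needed: the integral of a nonnegative function is a
   supremum over simple functions below it. *)
Lemma integral_ge0_mono d (T : measurableType d) (mu : {measure set T -> \bar R})
    (D : set T) (f1 f2 : T -> \bar R) :
  (forall x, D x -> 0 <= f1 x) -> (forall x, D x -> f1 x <= f2 x) ->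
  \int[mu]_(x in D) f1 x <= \int[mu]_(x in D) f2 x.
Proof.
move=> f0 f12; have g0 x : D x -> 0 <= f2 x.
  by move=> Dx; exact: le_trans (f0 x Dx) (f12 x Dx).
rewrite (ge0_integralE mu f0) (ge0_integralE mu g0).
apply: ge_ereal_sup => _ [h /= hf <-]; apply: ereal_sup_ubound; exists h => //= x.
by apply: le_trans (hf x) _; apply: lee_restrict.
Qed.

Lemma integral_lower_bound (a b : R) (k : R) (f : R -> \bar R) : (a <= b)%R -> (0 <= k)%R ->
  (forall x, 0 <= f x) -> (forall x, (a < x < b)%R -> k%:E <= f x) ->
  (k * (b - a))%:E <= \int[@lebesgue_measure R]_x f x.
Proof.
move=> ab k0 f0 fk; have mI : measurable (`]a, b[%classic : set (measurableTypeR R)).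
  exact: measurable_itv.
have -> : (k * (b - a))%:E = \int[@lebesgue_measure R]_(x in `]a, b[) (cst k%:E) x.
  rewrite integral_cst//= lebesgue_measure_itv /= lte_fin; case: ltP => [//|ba].
  have -> : b = a by apply/eqP; rewrite eq_le ab ba.
  by rewrite subrr mulr0 mule0.
rewrite integral_mkcond; apply: integral_ge0_mono => x _.
  by apply: erestrict_ge0 => y _; rewrite lee_fin.
rewrite patchE; case: ifP => [|_]; last exact: f0.
by rewrite inE /= in_itv /= => /fk.
Qed.

Lemma iter_integral_ge0 d (f : 'rV[R]_d -> \bar R) : (forall x, 0 <= f x) -> 0 <= iter_integral f.
Proof.
elim: d f => [|d IH] f f0 /=; first exact: f0.
by apply: integral_ge0 => t _; apply: IH => x; exact: f0.
Qed.

Lemma iter_integral_lower_bound d (f : 'rV[R]_d -> \bar R) (c : 'rV[R]_d) (r k : R) :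
  (0 <= r)%R -> (0 <= k)%R -> (forall x, 0 <= f x) ->
  (forall x : 'rV[R]_d, (forall i, `|(x - c)%R 0%R i| < r)%R -> k%:E <= f x) ->
  (k * (2 * r) ^+ d)%:E <= iter_integral f.
Proof.
move=> r0 k0; elim: d f c => [|d IH] f c f0 fk /=.
  by rewrite expr0 mulr1; apply: fk => -[].
pose c' : 'rV[R]_(1 + d) := c.
have -> : (k * (2 * r) ^+ d.+1 = (k * (2 * r) ^+ d) * ((c' 0 0 + r) - (c' 0 0 - r)))%R.
  by rewrite exprSr mulrA; congr (_ * _)%R; ring.
apply: integral_lower_bound => [|||t tr].
- by rewrite lerBlDr -addrA lerDl addr_ge0.
- by rewrite mulr_ge0// exprn_ge0// mulr_ge0.
- by move=> t; apply: iter_integral_ge0.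
- apply: (IH _ (rsubmx c')) => [x|x xc]; first exact: f0.
  apply: fk => i; case: (split_ordP (i : 'I_(1 + d))) => j ->.
    have E0 : lshift d j = (0%R : 'I_(1 + d)) by rewrite (ord1 j); apply: val_inj.
    have -> : ((row_mx (const_mx t : 'rV_1) x - c) 0 (lshift d j) = t - c' 0 0)%R.
      by rewrite (mx_addE (row_mx _ _)) mx_oppE row_mxEl [X in (X + _)%R]mxE E0.
    by case/andP: tr => t1 t2; rewrite ltr_norml ltrBrDl t1 ltrBlDl t2.
  have := xc j; rewrite mx_addE mx_oppE [rsubmx _ _ _]mxE => H.
  have -> : ((row_mx (const_mx t : 'rV_1) x - c) 0 (rshift 1 j) = x 0 j - c' 0 (rshift 1 j))%R.
    by rewrite (mx_addE (row_mx _ _)) mx_oppE row_mxEr.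
  exact: H.
Qed.

End UnmeasurableIntegrands.

(** * Metric balls and coordinate cubes *)

Section SegmentsAndBalls.
Context {R : realType} {d : nat} {M : charted R d} (hM : smooth_manifold M).
Context (G : field2 M) (tG : tensor2 G).

Let cM : charts M := smooth_manifold_charts hM.

Definition segment (al : chart_index M) (x y : 'rV[R]_d) : 'rV[R]_1 -> M :=
  fun s => param al (x + s *m (y - x)).

Lemma row1_mul_norm (s : 'rV[R]_1) (w : 'rV[R]_d) : `|s *m w| = `|s 0 0| * `|w|.
Proof. by rewrite {1}(mx11_scalar s) mul_scalar_mx normrZ. Qed.

Lemma norm_row_lt (x : 'rV[R]_d) (e : R) : 0 < e -> (forall i, `|x 0 i| < e) -> `|x| < e.
Proof.
move=> e0 H; rewrite [ltLHS]/Num.Def.normr/= mx_normrE.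
by apply: bigmax_lt => // -[i j] _ /=; rewrite ord1.
Qed.

Lemma quadratic_form_bound (A : 'M[R]_d) (L : R) (v : 'rV[R]_d) : (forall i j, `|A i j| <= L) ->
  (v *m A *m v^T) 0 0 <= d%:R ^+ 2 * L * `|v| ^+ 2.
Proof.
move=> AL; rewrite mxE; apply: (@le_trans _ _ (\sum_(j < d) d%:R * L * `|v| ^+ 2)).
  apply: ler_sum => j _; rewrite mxE [v^T _ _]mxE mulr_suml.
  apply: (@le_trans _ _ (\sum_(i < d) L * `|v| ^+ 2)).
    apply: ler_sum => i _; apply: le_trans (ler_norm _) _.
    rewrite !normrM mulrAC mulrC expr2.
    by apply: ler_pM; rewrite ?mulr_ge0//; apply: ler_pM => //; exact: entry_le_norm.
  by rewrite sumr_const card_ord -[leLHS]mulr_natl mulrA lexx.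
rewrite sumr_const card_ord -[leLHS]mulr_natl.
by have -> (a b c : R) : a * (a * b * c) = a ^+ 2 * b * c by ring.
Qed.

(** For t >= 0 one has t <= (t + 1)^2. The bound thus becomes a perfect square, which bounds the
    speed of a segment directly, and the constant is positive even if [La] is 0. *)
Lemma quadratic_form_bound_norm (A : 'M[R]_d) (La : R) (v : 'rV[R]_d) : `|A| <= La ->
  (v *m A *m v^T) 0 0 <= ((d%:R ^+ 2 * La + 1) * `|v|) ^+ 2.
Proof.
move=> AL; have L0 : 0 <= La by exact: le_trans AL.
apply: le_trans (quadratic_form_bound v (fun i j => le_trans (entry_le_norm A i j) AL)) _.
rewrite exprMn ler_wpM2r ?sqr_ge0//.
have : 0 <= d%:R ^+ 2 * La by rewrite mulr_ge0 ?sqr_ge0.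
by move: (_ * La) => t t0; nra.
Qed.

Section OneSegment.
Context (al : chart_index M) (x : 'rV[R]_d) (r L : R) (L0 : 0 <= L).
Context (bound : forall z, `|z - x| < r ->
  img al z /\ forall v : 'rV[R]_d, (v *m G al z *m v^T) 0 0 <= (L * `|v|) ^+ 2).
Context (y : 'rV[R]_d) (xy : `|y - x| < r).

Let A : 'rV[R]_1 -> 'rV[R]_d := fun s => x + s *m (y - x).
(** A singular simplex must be smooth on a neighbourhood of the standard simplex; this is the open
    set of all parameters for which the line stays in the chart. *)
Let W : set 'rV[R]_1 := A @^-1` img al.

Let cA (s : 'rV[R]_1) : {for s, continuous A}.
Proof. by apply: (@smooth_vcontinuous _ _ setT _ A) => //; apply: affine_smooth; exact: openT. Qed.

Let oW : open W.
Proof. by apply: open_preimage_continuous; [exact: cA|exact: (open_img cM)]. Qed.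

Let segW (t : R) : 0 <= t <= 1 -> `|A (const_mx t) - x| < r.
Proof.
move=> /andP[t0 t1]; rewrite /A addrC addKr row1_mul_norm mxE ger0_norm//.
by apply: le_lt_trans xy; rewrite ler_piMl.
Qed.

Let smooth_segment : smooth_map (M := euclid 1) W (segment al x y).
Proof.
have cs (s : euclid 1 : charted R 1) : W s -> {for s, continuous (segment al x y : euclid 1 -> M)}.
  move=> Ws; apply: (@continuous_comp _ _ _ A (param al)); first exact: cA.
  exact: continuous_param.
split=> // -[] be; rewrite -/(rep_dom _ _ _ _).
have [_ _ _ _ sid] := hM.
apply: (@smooth_vcomp _ _ _ _ _ (rep_dom setT idfun al be) (coord_rep idfun al be) A).
- exact: (rep_open (@charts_euclid R 1) cM oW cs).
- exact: (rep_open cM cM openT sid.1).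
- by move=> s [_ Ws ds]; split.
- by apply: affine_smooth; exact: (rep_open (@charts_euclid R 1) cM oW cs).
- exact: sid.2.
Qed.

Lemma singular_segment : singular (segment al x y).
Proof.
exists W; split; [exact: oW| |exact: smooth_segment].
move=> s [s0]; rewrite big_ord1 => s1; apply: (bound _).1.
have -> : s = const_mx (s 0 0) by apply/rowP => i; rewrite mxE (ord1 i).
by apply: segW; rewrite (s0 0) s1.
Qed.

Lemma speed_segment t : 0 <= t <= 1 -> speed G (segment al x y) t <= L * `|y - x|.
Proof.
move=> t01; have [iz bz] := bound (segW t01).
rewrite /speed (pull2E (@charts_euclid R 1) hM oW smooth_segment tG (al := tt) (be := al)) //; last 2 first.
- by exists (const_mx t).
- exact: dom_param.
have E : jac (coord_rep (segment al x y : euclid 1 -> M) tt al) (const_mx t) = y - x.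
  rewrite -[RHS](@jac_affine _ _ _ (y - x) x (const_mx t)).
  by apply: (jac_ext oW iz) => s Ws; rewrite /coord_rep /= (coordK cM).
rewrite E /coord_rep /= (coordK cM iz) -[leRHS]ger0_norm ?mulr_ge0//.
by rewrite -sqrtr_sqr; apply: ler_wsqrtr; exact: bz.
Qed.

Lemma curve_length_segment : curve_length G (segment al x y) <= L * `|y - x|.
Proof.
have K0 : 0 <= L * `|y - x| by rewrite mulr_ge0.
rewrite /curve_length /Rintegral.
set I := (X in fine X).
have I0 : (0 <= I)%E by apply: integral_ge0 => t _; rewrite lee_fin sqrtr_ge0.
(* The bound in the extended reals comes first: it shows that the integral is finite, so that [fine]
   keeps its value. *)
have : (I <= (L * `|y - x|)%:E)%E.
  apply: (@le_trans _ _ (\int[@lebesgue_measure R]_(t in `[0%R, 1%R]) (cst (L * `|y - x|)%:E t))%E).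
    apply: integral_ge0_mono => t t01; first by rewrite lee_fin sqrtr_ge0.
    by rewrite lee_fin; apply: speed_segment; move: t01; rewrite /= in_itv.
  rewrite integral_cst//= lebesgue_measure_itv /= lte_fin ltr01.
  by rewrite -EFinB subr0 mule1.
by case: I I0 => [s||] //=; rewrite lee_fin.
Qed.

Lemma path_length_segment p (l : R) : path_length G p (param al x) l ->
  exists2 l', path_length G p (param al y) l' & l' <= l + L * `|y - x|.
Proof.
move=> pl; exists (l + curve_length G (segment al x y)); last first.
  by rewrite lerD2l curve_length_segment.
have E1 : segment al x y (const_mx 1) = param al y.
  by congr param; rewrite (_ : const_mx 1 = 1%:M) ?mul1mx ?subrKC// ?addrC ?subrK//;
     apply/matrixP => i j; rewrite !mxE !ord1.
rewrite -E1; apply: (path_snoc pl singular_segment).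
by rewrite /segment (_ : const_mx 0 = 0) ?mul0mx ?addr0//; apply/matrixP => i j; rewrite !mxE.
Qed.

End OneSegment.

Lemma riem_ballP p rho q : riem_ball G p rho q <->
  exists2 l, path_length G p q l & l < rho.
Proof.
split=> [/ereal_inf_lt[_ [l pl <-]]|[l pl lr]]; first by rewrite lte_fin => lr; exists l.
by apply: (@le_lt_trans _ _ l%:E); [apply: ereal_inf_lbound; exists l|rewrite lte_fin].
Qed.

(** A path to [q] of length [l < rho] leaves the slack [rho - l], enough for a segment to any nearby
    point. Openness makes balls measurable, as monotonicity of the volume requires. *)
Lemma open_riem_ball p rho : open (riem_ball G p rho).
Proof.
have [_ _ dM _ _] := hM.
rewrite openE => q /riem_ballP[l pl lr].
pose al := chart_at q; pose x := coord al q.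
have ix : img al x by apply: img_coord; exact: dM.
have cG : {for x, continuous (G al)}.
  by apply: continuous_mx => i j; exact: (smooth_continuous (tG.1 al i j) ix).
have /nbhs_norm_ltP[r1 r10 H1] : nbhs x (img al `&` (G al @^-1` ball (G al x) 1)).
  apply: filterI; last by apply: cG; exact: nbhsx_ballx.
  by apply: open_nbhs_nbhs; split=> //; exact: (@open_img _ _ _ cM al).
pose La := `|G al x| + 1; pose L := d%:R ^+ 2 * La + 1.
have La0 : 0 <= La by rewrite addr_ge0.
have L0 : 0 < L by rewrite ltr_wpDl// mulr_ge0 ?sqr_ge0.
have bound z : `|z - x| < r1 ->
    img al z /\ forall v : 'rV[R]_d, (v *m G al z *m v^T) 0 0 <= (L * `|v|) ^+ 2.
  rewrite distrC => /H1[iz Bz]; split=> // v.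
  apply: quadratic_form_bound_norm; move: Bz; rewrite /= -ball_normE /= => B.
  rewrite -{1}[G al z](subKr (G al x)); apply: le_trans (ler_normB _ _) _.
  by rewrite lerD2l ltW.
(* Segments shorter than [r1] stay where the metric is bounded; the second term keeps their length,
   at most [L] times the coordinate distance, below the slack. *)
pose r2 := Num.min r1 ((rho - l) / L).
have r20 : 0 < r2 by rewrite lt_min r10 divr_gt0// subr_gt0.
have N : nbhs q (dom al `&` (coord al @^-1` [set y | `|x - y| < r2])).
  apply: filterI; first by apply: open_nbhs_nbhs; split; [exact: (open_dom cM)|exact: dM].
  apply: (continuous_coord cM (dM q)).
  by rewrite -/(coord al q) -/x; apply/nbhs_norm_ltP; exists r2.
apply: filterS N => q' [dq' /=]; rewrite distrC lt_min => /andP[x1 x2].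
have plx : path_length G p (param al x) l by rewrite (paramK cM)//; exact: dM.
have [l' pl' ll'] := path_length_segment (ltW L0) bound x1 plx.
apply/riem_ballP; exists l'; first by rewrite -(paramK cM dq').
by apply: le_lt_trans ll' _; rewrite -ltrBrDl mulrC -ltr_pdivlMr.
Qed.

(** The norm on rows is the maximum norm, so [A] is a coordinate cube of side 2 r. Its points are
    reached with extra length less than [L * r], and the volume density on it is at least
    [Num.sqrt D]. *)
Lemma riem_ball_volume (mu : {measure set (borel M) -> \bar R}) (al : chart_index M)
    (x : 'rV[R]_d) (r L D : R) p rho l :
  riemannian_volume G mu -> 0 < L -> 0 < r -> 0 <= D ->
  (forall z, `|z - x| < r ->
    [/\ img al z, D <= \det (G al z)
      & forall v : 'rV[R]_d, (v *m G al z *m v^T) 0 0 <= (L * `|v|) ^+ 2]) ->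
  path_length G p (param al x) l -> l + L * r <= rho ->
  ((Num.sqrt D * (2 * r) ^+ d)%:E <= mu (riem_ball G p rho))%E.
Proof.
move=> vmu L0 r0 D0 H pl lr.
pose A : set M := dom al `&` (coord al @^-1` [set y | `|y - x| < r]).
have oA : open A.
  rewrite openE => q [dq /=]; rewrite distrC => xq.
  apply: filterI; first by apply: open_nbhs_nbhs; split=> //; exact: (open_dom cM).
  apply: (continuous_coord cM dq); apply/nbhs_norm_ltP.
  exists (r - `|x - coord al q|); first by rewrite subr_gt0.
  move=> y; rewrite ltrBrDl => yx /=; rewrite distrC; apply: le_lt_trans yx.
  exact: ler_distD.
have mo (B : set M) : open B -> measurable (B : set (borel M)).
  by move=> oB; apply: sub_sigma_algebra.
apply: (@le_trans _ _ (mu A)); last first.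
  apply: le_measure; rewrite ?inE; [exact: mo|exact: mo (open_riem_ball _ _)|].
  move=> q [dq xq]; apply/riem_ballP.
  have plx := path_length_segment (ltW L0) _ xq pl.
  have [|l' pl' ll'] := plx; first by move=> z /H[].
  exists l'; first by rewrite -(paramK cM dq).
  apply: le_lt_trans ll' _; apply: lt_le_trans lr; by rewrite ltrD2l ltr_pM2l.
rewrite (vmu al A (mo A oA)); last by move=> q [].
apply: (@iter_integral_lower_bound _ _ _ x) => [||z|z zx].
- exact: ltW.
- exact: sqrtr_ge0.
- by rewrite lee_fin mulr_ge0// sqrtr_ge0.
- have {}zx := norm_row_lt r0 zx; have [iz Dz _] := H z zx.
  rewrite lee_fin indicE mem_set ?mul1r; first exact: ler_wsqrtr.
  exists (param al z); last exact: (coordK cM).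
  by split; [exact: (dom_param cM)|rewrite /= (coordK cM)].
Qed.

End SegmentsAndBalls.

Lemma posdef_det_gt0 (R : realType) d (A : 'M[R]_d) : posdef A -> 0 < \det A.
Proof.
move=> /posdef_orthonormal[L _ /(congr1 determinant)].
rewrite !det_mulmx det_tr det1 mulrAC -expr2 => E.
have : 0 < \det L ^+ 2 * \det A by rewrite E.
have [->|L0] := eqVneq (\det L) 0; first by rewrite expr0n mul0r ltxx.
by rewrite pmulr_rgt0// exprn_even_gt0.
Qed.

(** * Volume of small balls, uniformly over the family *)

Section UniformVolume.
Context {R : realType} {m : nat} {n : 'I_m -> nat} {M : forall i, charted R (n i + n i)}.
Context {P : charted R (\sum_i (n i + n i)).+1}.
Unset Implicit Arguments.
Context (g : forall i, field2 (M i)).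
Context (proj : P -> prodn M) (act : R -> P -> P) (sigma : field1 P).
Context (kM : forall i, kaehler (g i)).
Context (hP : principal_circle_bundle proj act).
Context (hsigma : principal_connection act sigma).
Set Implicit Arguments.

Let d := (\sum_i (n i + n i)).+1.
Let hPm := total_space_manifold hP.
Let cP : charts P := smooth_manifold_charts hPm.

Local Notation metric := (unit_fiber_metric g proj sigma).

Definition scaled_metric (c : R) (be : 'rV[R]_m) : field2 P :=
  fun al x => c *: metric be al x.

Lemma scaled_metricE c be :
  scaled_metric c be = bundle_metric g proj sigma c (fun i => c * be 0 i).
Proof.
apply/funext => al; apply/funext => x.
rewrite /scaled_metric /unit_fiber_metric /bundle_metric scale1r scalerDr scaler_sumr.
by congr (_ + _); apply: eq_bigr => i _; rewrite scalerA.
Qed.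

Lemma tensor2_scaled_metric c be : tensor2 (scaled_metric c be).
Proof. by rewrite scaled_metricE; exact: (tensor2_bundle_metric kM hP hsigma). Qed.

(** A compact product of intervals in the joint coordinates: a closed cube around [x] in the first
    [d], the parameter range in the last [m]. *)
Definition metric_box (x : 'rV[R]_d) (r lo hi : R) (j : 'I_(d + m)) : set R :=
  match fintype.split j with
  | inl k => `[x 0 k - r, x 0 k + r]%classic
  | inr k => `[lo, hi]%classic
  end.

Lemma metric_boxl x r lo hi k :
  metric_box x r lo hi (lshift m k) = `[x 0 k - r, x 0 k + r]%classic.
Proof. by rewrite /metric_box (unsplitK (inl k)). Qed.

Lemma metric_boxr x r lo hi k : metric_box x r lo hi (rshift d k) = `[lo, hi]%classic.
Proof. by rewrite /metric_box (unsplitK (inr k)). Qed.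

Lemma metric_local_bounds (lo hi : R) (al : chart_index P) x0 : 0 < lo -> lo <= hi -> img al x0 ->
  exists r de L, [/\ 0 < r, 0 < de, 0 < L & forall z be, `|z - x0| < r -> row_box lo hi be ->
    [/\ img al z, de <= \det (metric be al z)
      & forall v : 'rV[R]_d, (v *m metric be al z *m v^T) 0 0 <= (L * `|v|) ^+ 2]].
Proof.
move=> lo0 lohi ix.
(* The neighbourhood of radius [r1] lies in the image of the chart. *)
have /nbhs_norm_ltP[r1 r10 H1] : nbhs x0 (img al).
  by apply: open_nbhs_nbhs; split=> //; exact: (@open_img _ _ _ cP al).
pose r := r1 / 2; have r0 : 0 < r by rewrite divr_gt0.
pose B : set 'rV[R]_(d + m) := [set z | forall j, metric_box x0 r lo hi j (z 0 j)].
have cB : compact B.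
  apply: (@rV_compact _ _ (metric_box x0 r lo hi)) => j.
  by rewrite /metric_box; case: fintype.split => k; exact: segment_compact.
have BE z be : `|z - x0| < r -> row_box lo hi be -> B (row_mx z be).
  move=> zx kb j; case: (split_ordP j) => k ->.
    rewrite row_mxEl metric_boxl /= in_itv /=.
    have := le_lt_trans (entry_le_norm (z - x0) 0 k) zx; rewrite mx_addE mx_oppE ltr_norml.
    by move=> /andP[h1 h2]; apply/andP; split; lra.
  by rewrite row_mxEr metric_boxr.
have B0 : B !=set0.
  exists (row_mx x0 (const_mx lo)); apply: BE; first by rewrite subrr normr0.
  by move=> i; rewrite mxE /= in_itv /= lexx.
have BD z : B z -> family_domain al z.
  move=> Bz; split.
    apply: H1; apply: (@le_lt_trans _ _ r); last by rewrite /r ltr_pdivrMr// ltr_pMr// ltr1n.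
    apply: norm_row_le => [|k]; first exact: ltW.
    have := Bz (lshift m k); rewrite metric_boxl /= in_itv /=.
    rewrite mx_addE mx_oppE [lsubmx z 0 k]mxE ler_norml => /andP[h1 h2].
    by apply/andP; split; lra.
  move=> k; have := Bz (rshift d k).
  rewrite metric_boxr /= in_itv /= mxE => /andP[h1 _].
  exact: lt_le_trans lo0 h1.
pose F := family_form g proj sigma al.
have oD := @open_family_domain _ _ _ _ _ proj act hP al.
have sF i j := @smooth_family_form _ _ _ _ _ g proj act sigma kM hP hsigma al i j.
have cD : {within B, continuous (fun z => \det (F z))}.
  apply: continuous_in_subspaceT => z; rewrite inE => /BD Dz.
  exact: (smooth_continuous (smooth_det oD sF) Dz).
have cN : {within B, continuous (fun z => `|F z|)}.
  apply: continuous_in_subspaceT => z; rewrite inE => /BD Dz.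
  apply: (@continuous_comp _ _ _ F (fun A : 'M[R]_d => `|A|)); last exact: norm_continuous.
  by apply: continuous_mx => i j; exact: (smooth_continuous (sF i j) Dz).
have [de de0 Hde] : exists2 de, 0 < de & forall z, B z -> de <= \det (F z).
  have [zm zmB Hm] := compact_EVT_min B0 cB cD.
  exists (\det (F zm)); last by move=> z Bz; apply: Hm; rewrite inE.
  apply: posdef_det_gt0; apply: (family_form_posdef kM hP hsigma).
  by apply: BD; move: zmB; rewrite inE.
have [La La0 HLa] : exists2 La, 0 <= La & forall z, B z -> `|F z| <= La.
  have [zM _ HM] := compact_EVT_max B0 cB cN.
  by exists `|F zM|; [exact: normr_ge0|move=> z Bz; apply: HM; rewrite inE].
exists r, de, (d%:R ^+ 2 * La + 1); split; [exact: r0|exact: de0| |].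
  by rewrite ltr_wpDl// mulr_ge0 ?sqr_ge0.
move=> z be zx kb; have Bz := BE z be zx kb; have [iz _] := BD _ Bz.
have FE : F (row_mx z be) = metric be al z by rewrite /F /family_form row_mxKl row_mxKr.
have HN := HLa _ Bz; have HD := Hde _ Bz; rewrite FE in HN HD.
split; [by move: iz; rewrite row_mxKl|exact: HD|move=> v].
exact: (quadratic_form_bound_norm v HN).
Qed.

(** A single [e] limits the radius, in units of [Num.sqrt c], and serves as the volume ratio.
    Decreasing it weakens both, so the bounds of finitely many neighbourhoods can be combined. *)
Definition volume_bound (lo hi e : R) (p : P) : Prop :=
  forall be (c rho : R) (mu : {measure set (borel P) -> \bar R}),
    row_box lo hi be -> 0 < c -> riemannian_volume (scaled_metric c be) mu ->
    0 < rho -> rho <= Num.sqrt c * e ->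
    ((e * rho ^+ d)%:E <= mu (riem_ball (scaled_metric c be) p rho))%E.

Lemma volume_boundW lo hi e e' p : 0 < e' -> e' <= e ->
  volume_bound lo hi e p -> volume_bound lo hi e' p.
Proof.
move=> e0 ee H be c rho mu kb c0 vmu rho0 rc.
have rc' : rho <= Num.sqrt c * e by apply: le_trans rc _; rewrite ler_wpM2l ?sqrtr_ge0.
apply: le_trans (H be c rho mu kb c0 vmu rho0 rc').
by rewrite lee_fin ler_wpM2r ?exprn_ge0// ltW.
Qed.

Lemma volume_bound_local lo hi (p0 : P) : 0 < lo -> lo <= hi ->
  exists2 e, 0 < e & nbhs p0 (volume_bound lo hi e).
Proof.
move=> lo0 lohi; pose al := chart_at p0; pose x0 := coord al p0.
have dp0 : dom al p0 by exact: (dom_chart_at_total hP).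
have [r [de [L [r0 de0 L0 H]]]] := @metric_local_bounds lo hi al x0 lo0 lohi (img_coord dp0).
(* The coordinate radius used for a ball is [s = rho / (sqrt c * L)]. The first term gives
   [s <= r / 2]; the second is the ratio of the cube's volume bound,
   [sqrt (c ^+ d * de) * (2 * s) ^+ d], to [rho ^+ d], from which [c] cancels. *)
pose e := Num.min (L * (r / 2)) (Num.sqrt de * (2 / L) ^+ d).
have r20 : 0 < r / 2 by rewrite divr_gt0.
exists e; first by rewrite lt_min !mulr_gt0 ?exprn_gt0 ?sqrtr_gt0 ?divr_gt0.
(* Half of [r] is spent on moving the centre from [p0] to [p], the other half on the cube around
   [p]. *)
have N : nbhs p0 (dom al `&` (coord al @^-1` [set y | `|x0 - y| < r / 2])).
  apply: filterI; first by apply: open_nbhs_nbhs; split=> //; exact: (open_dom cP).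
  by apply: (continuous_coord cP dp0); apply/nbhs_norm_ltP; exists (r / 2).
apply: filterS N => p [dp /= xp] be c rho mu kb c0 vmu rho0 rc.
pose sc := Num.sqrt c; have sc0 : 0 < sc by rewrite sqrtr_gt0.
have scE : sc ^+ 2 = c by rewrite sqr_sqrtr// ltW.
pose s := rho / (sc * L).
have s0 : 0 < s by rewrite divr_gt0// mulr_gt0.
have sr : s <= r / 2.
  rewrite ler_pdivrMr ?mulr_gt0//; apply: le_trans rc _.
  have -> : r / 2 * (sc * L) = sc * (L * (r / 2)) by ring.
  by apply: ler_wpM2l; [exact: ltW|rewrite /e ge_min lexx].
have rhoE : sc * L * s = rho by rewrite /s mulrC divfK// gt_eqF// mulr_gt0.
have pl : path_length (scaled_metric c be) p (param al (coord al p)) 0.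
  by rewrite (paramK cP)//; exact: path_nil.
have Hs z : `|z - coord al p| < s ->
    [/\ img al z, c ^+ d * de <= \det (scaled_metric c be al z)
      & forall v : 'rV[R]_d, (v *m scaled_metric c be al z *m v^T) 0 0 <= (sc * L * `|v|) ^+ 2].
  move=> zx; have zx0 : `|z - x0| < r.
    rewrite -(subrKA (coord al p)); apply: le_lt_trans (ler_normD _ _) _.
    rewrite [ltRHS](splitr r); apply: ltrD; last by rewrite distrC.
    exact: lt_le_trans zx sr.
  have [iz Dz Qz] := H z be zx0 kb; split=> //.
    by rewrite detZ ler_pM2l// exprn_gt0.
  move=> v; rewrite /scaled_metric -scalemxAr -scalemxAl mx_scaleE.
  by rewrite -mulrA [leRHS]exprMn scE ler_pM2l.
apply: le_trans (riem_ball_volume hPm (tensor2_scaled_metric c be) vmu _ s0 _ Hs pl _).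
- rewrite lee_fin sqrtrM; last by rewrite exprn_ge0// ltW.
  have -> : Num.sqrt (c ^+ d) = sc ^+ d.
    by rewrite -scE exprAC sqrtr_sqr ger0_norm// exprn_ge0// ltW.
  have -> : sc ^+ d * Num.sqrt de * (2 * s) ^+ d = Num.sqrt de * (2 / L) ^+ d * rho ^+ d.
    rewrite mulrAC -exprMn [RHS]mulrAC mulrC -!mulrA -exprMn; congr (_ * _ ^+ _).
    by rewrite -rhoE; field; rewrite gt_eqF.
  by apply: ler_wpM2r; [rewrite exprn_ge0// ltW|rewrite /e ge_min lexx orbT].
- by rewrite mulr_gt0.
- by rewrite ltW// mulr_gt0// exprn_gt0.
- by rewrite add0r rhoE.
Qed.

(** Near each point the bound holds for all sufficiently small positive [e]; compactness, in the
    form of near coverings, makes this uniform as [e] tends to 0 from the right. *)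
Lemma volume_bound_uniform lo hi : compact [set: P] -> 0 < lo -> lo <= hi ->
  exists2 e, 0 < e & forall p, volume_bound lo hi e p.
Proof.
move=> cpt lo0 lohi; have {}cpt := (compact_near_coveringP _).1 cpt.
have H : \forall e \near (0 : R)^'+, [set: P] `<=` volume_bound lo hi e.
  apply: cpt => p _; have [e e0 He] := volume_bound_local p lo0 lohi.
  exists (volume_bound lo hi e, [set e' | 0 < e' <= e]).
    by split=> //=; apply: filterS2 (nbhs_right_gt 0) (nbhs_right_le e0) => e' /= -> ->.
  by move=> [p' e'] /= [vp /andP[e'0 e'e]]; exact: volume_boundW vp.
have [e [e0 He]] : exists e, 0 < e /\ [set: P] `<=` volume_bound lo hi e.
  by apply: (@filter_ex _ ((0 : R)^'+)); apply: filterS2 (nbhs_right_gt 0) H => e' /=.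
by exists e => // p; exact: He.
Qed.

End UniformVolume.

(** * The flow *)

Lemma continuous_postcomp (R : realType) (T : topologicalType) (B : set T) (F : T -> R)
    (h : R -> R) :
  {within B, continuous F} -> continuous h -> {within B, continuous (fun x => h (F x))}.
Proof. by move=> cF ch x; exact: cvg_comp (cF x) (ch (F x)). Qed.

Lemma continuous_withinB (R : realType) (T : topologicalType) (B : set T) (F1 F2 : T -> R) :
  {within B, continuous F1} -> {within B, continuous F2} -> {within B, continuous (F1 - F2)}.
Proof. by move=> c1 c2 x; apply: cvgB; [exact: c1|exact: c2]. Qed.

Section Primitive.
Context {R : realType} (f : R -> R).
Context (cf : {within `[0, +oo[, continuous f}).

Let primitive (u : R) : R := \int[@lebesgue_measure R]_(z in `[0, u]) f z.

Lemma within_segment (h : R -> R) (b : R) :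
  {within `[0, +oo[, continuous h} -> {within `[0, b], continuous h}.
Proof.
apply: continuous_subspaceW => x /=; rewrite !in_itv /= => /andP[-> _] //.
Qed.

Let integrable_segment (b : R) : lebesgue_measure.-integrable `[0, b] (EFin \o f).
Proof.
by apply: continuous_compact_integrable; [exact: segment_compact|exact: within_segment].
Qed.

Lemma primitive_at0 : primitive 0 = 0.
Proof. by rewrite /primitive set_itv1 Rintegral_set1. Qed.

Lemma primitive_ge0 : (forall z, 0 <= z -> 0 <= f z) -> forall u, 0 <= primitive u.
Proof.
by move=> f0 u; apply: Rintegral_ge0 => z /=; rewrite in_itv /= => /andP[/f0].
Qed.

Lemma primitive_derive (x : R) : 0 < x -> is_derive x 1 primitive (f x).
Proof.
move=> x0; have x1 : x < x + 1 by rewrite ltrDl.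
have cx : {for x, continuous f}.
  have [+ _ _] := (continuous_within_itvP f (lt_trans x0 x1)).1 (within_segment cf).
  by apply; rewrite in_itv /= x0.
have [df dE] := continuous_FTC1_closed x1 (@integrable_segment (x + 1)) x0 cx.
split; [exact: df|rewrite -derive1E; exact: dE].
Qed.

(** Differentiability settles the interior points; at 0 only one-sided continuity is claimed, and it
    comes from continuity of the integral on [0, 1]. *)
Lemma primitive_continuous : {within `[0, +oo[, continuous primitive}.
Proof.
apply/continuous_within_itvcyP; split.
  move=> x; rewrite in_itv /= andbT => x0.
  by have [/derivable1_diffP/differentiable_continuous] := primitive_derive x0.
have := parameterized_integral_continuous (ler01 : (0 : R) <= 1) (@integrable_segment 1).
by move=> /(continuous_within_itvP _ ltr01)[].
Qed.

End Primitive.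

Section ExponentialGrowth.
Context {R : realType} (f : R -> R) (e a0 : R).
Context (cf : {within `[0, +oo[, continuous f}).
Context (e0 : 0 < e) (fe : forall z, 0 <= z -> e <= f z) (a00 : 0 < a0).

Let F (u : R) : R := \int[@lebesgue_measure R]_(z in `[0, u]) f z.
Let A (u : R) : R := a0 * expR (F u).
Let T (u : R) : R := \int[@lebesgue_measure R]_(z in `[0, u]) A z.

Let cA : {within `[0, +oo[, continuous A}.
Proof.
have cF := primitive_continuous cf.
have cE := @continuous_postcomp R R `[0, +oo[ F expR cF (@continuous_expR R).
exact: (@continuous_postcomp R R `[0, +oo[ _ ( *%R a0) cE (@mulrl_continuous _ a0)).
Qed.

Let A0 u : 0 < A u. Proof. by rewrite mulr_gt0 ?expR_gt0. Qed.

Let dA (x : R) : 0 < x -> is_derive x 1 A (A x * f x).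
Proof.
move=> x0; have dF := primitive_derive cf x0.
have dE := is_derive1_comp (is_derive_expR (F x)) dF.
by have := is_deriveZ a0 dE; rewrite /A /= -mulrA.
Qed.

Let monotone_from0 (h dh : R -> R) : {within `[0, +oo[, continuous h} ->
  (forall x : R, 0 < x -> is_derive x 1 h (dh x)) -> (forall x, 0 < x -> 0 <= dh x) ->
  forall u, 0 <= u -> h 0 <= h u.
Proof.
move=> ch dhE dh0 u u0.
have := @ger0_derive1_le_cc R h 0 u _ _ (within_segment ch).
apply; rewrite ?in_itv /= ?lexx ?u0 //.
  by move=> x; rewrite in_itv /= => /andP[/dhE[]].
by move=> x; rewrite in_itv /= => /andP[x0 _]; rewrite derive1E; have [_ ->] := dhE x x0; exact: dh0.
Qed.

(** The difference [A - e * T] has derivative [A * f - e * A >= 0] and the positive value [A 0] at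
    0. *)
Lemma growth_time_le u : 0 <= u -> e * T u <= A u.
Proof.
move=> u0.
have := @monotone_from0 (A - e \*: T) (fun x => A x * f x - e *: A x) _ _ _ u u0.
rewrite !fctE /= => H; have T0 : T 0 = 0 by exact: primitive_at0.
have : A 0 - e *: T 0 <= A u - e *: T u.
  apply: H => [|x x0|x x0].
  - have cT := primitive_continuous cA.
    have ceT := @continuous_postcomp R R `[0, +oo[ T ( *%R e) cT (@mulrl_continuous _ e).
    exact: continuous_withinB cA ceT.
  - by apply: is_deriveB; [exact: dA|apply: is_deriveZ; exact: primitive_derive].
  - by rewrite subr_ge0 /GRing.scale /= mulrC ler_wpM2l ?fe// ltW.
move=> H1; rewrite -subr_ge0; apply: le_trans (ltW (A0 0)) _.
by have K (x t z : R) : t = 0 -> x - e *: t <= z -> x <= z;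
  [move=> ->; rewrite scaler0 subr0|exact: K T0 H1].
Qed.

Lemma growth_scale_ge u : a0 <= A u.
Proof.
have F0 : 0 <= F u by apply: primitive_ge0 => z z0; exact: le_trans (ltW e0) (fe z0).
by rewrite /A ler_peMr ?(ltW a00)// -expR0 ler_expR.
Qed.

Lemma growth_time_ge u : 0 <= u -> a0 * u <= T u.
Proof.
move=> u0.
have := @monotone_from0 (T - a0 \*: id) (fun x => A x - a0 *: 1) _ _ _ u u0.
rewrite !fctE /= => H; have T0 : T 0 = 0 by exact: primitive_at0.
have : T 0 - a0 *: 0 <= T u - a0 *: u.
  apply: H => [|x x0|x x0].
  - have ca : {within `[0, +oo[, continuous ( *%R a0)}.
      by apply: continuous_subspaceT; exact: mulrl_continuous.
    exact: continuous_withinB (primitive_continuous cA) ca.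
  - by apply: is_deriveB; exact: primitive_derive.
  - by rewrite subr_ge0 /GRing.scale /= mulr1; exact: growth_scale_ge.
by have K (x y z : R) : x = 0 -> x - a0 *: 0 <= y - z -> z <= y;
  [move=> ->; rewrite scaler0 subr0 subr_ge0|move=> /(K _ _ _ T0)].
Qed.

(** The correspondence prescribes the metric only at times of the form [T u], so all t >= 0 must be
    of this form. As [A >= a0], the time [t] is passed before [u = t / a0], and the intermediate
    value theorem applies. *)
Lemma growth_time_surj t : 0 <= t -> exists2 u, 0 <= u & T u = t.
Proof.
move=> t0; have u0 : 0 <= t / a0 by rewrite divr_ge0// ltW.
have Tu : t <= T (t / a0).
  by apply: le_trans (growth_time_ge u0); rewrite mulrC divfK// gt_eqF.
have T0 : T 0 = 0 by exact: primitive_at0.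
have [|c] := @IVT R T 0 (t / a0) t u0 (within_segment (primitive_continuous cA)).
  by rewrite T0 ge_min t0 le_max Tu orbT.
by rewrite in_itv /= => /andP[c0 _] Tc; exists c.
Qed.

End ExponentialGrowth.

(** The limit controls the tail, between l / 2 and l + 1; the compact initial segment is treated by
    extreme values. *)
Lemma positive_limit_bounds (R : realType) (y : R -> R) (l : R) :
  {within `[0, +oo[, continuous y} -> (forall u, 0 <= u -> 0 < y u) -> 0 < l ->
  y u @[u --> +oo] --> l ->
  exists lo hi, [/\ 0 < lo, 0 < hi & forall u, 0 <= u -> lo <= y u <= hi].
Proof.
move=> cy y0 l0 ly.
have l2 : l / 2 < l by rewrite ltr_pdivrMr// ltr_pMr// ltr1n.
have l1 : l < l + 1 by rewrite ltrDl.
have [U U0 HU] : exists2 U : R, 0 < U & forall u, U < u -> l / 2 <= y u <= l + 1.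
  have : \forall u \near +oo, l / 2 <= y u <= l + 1.
    by apply: filterS2 (cvgr_gt _ ly _ l2) (cvgr_lt _ ly _ l1) => u /= /ltW -> /ltW ->.
  move=> [U [_ HU]]; exists (Num.max U 1); first by rewrite lt_max ltr01 orbT.
  by move=> u; rewrite gt_max => /andP[/HU].
have cy' := @within_segment R y U cy.
have B0 : `[0, U]%classic !=set0 by exists 0; rewrite /= in_itv /= lexx ltW.
have [xm xmI Hm] := compact_EVT_min B0 (@segment_compact R 0 U) cy'.
have [xM xMI HM] := compact_EVT_max B0 (@segment_compact R 0 U) cy'.
have pos x : x \in `[0, U]%classic -> 0 < y x.
  by rewrite inE /= in_itv /= => /andP[/y0].
exists (Num.min (y xm) (l / 2)), (Num.max (y xM) (l + 1)); split.
- by rewrite lt_min pos//= divr_gt0.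
- by rewrite lt_max pos.
- move=> u u0; rewrite ge_min le_max; have [uU|Uu] := leP u U.
    have uI : u \in `[0, U]%classic by rewrite inE /= in_itv /= u0.
    by rewrite Hm// HM.
  by have /andP[-> ->] := HU u Uu; rewrite !orbT.
Qed.

(** * Curvature decay and noncollapsing for rescaled metrics *)

Section ScaledFamily.
Context {R : realType} {m : nat} {n : 'I_m -> nat} {M : forall i, charted R (n i + n i)}.
Context {P : charted R (\sum_i (n i + n i)).+1}.
Unset Implicit Arguments.
Context (g : forall i, field2 (M i)).
Context (proj : P -> prodn M) (act : R -> P -> P) (sigma : field1 P).
Context (kM : forall i, kaehler (g i)).
Context (hP : principal_circle_bundle proj act).
Context (hsigma : principal_connection act sigma).
Set Implicit Arguments.

Let hPm := total_space_manifold hP.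
Let cP : charts P := smooth_manifold_charts hPm.

Lemma normRm_scaled_metric c be (x : P) : 0 < c -> positive_row be ->
  normRm (scaled_metric g proj sigma c be) x =
  Num.sqrt (family_sqnorm g proj sigma (x, be)) / c.
Proof.
move=> c0 pb.
have t1 : tensor2 (unit_fiber_metric g proj sigma be).
  exact: (tensor2_bundle_metric kM hP hsigma).
have p1 al y : img al y -> posdef (unit_fiber_metric g proj sigma be al y).
  exact: (posdef_bundle_metric kM hP hsigma ltr01 pb).
have ix := img_coord (dom_chart_at_total hP x).
rewrite /normRm (curvature_sqnormZ (@open_img _ _ _ cP _) (t1.1 _) (@p1 _) _ ix) ?gt_eqF//.
rewrite sqrtrM ?invr_ge0 ?sqr_ge0// sqrtrV ?sqr_ge0// sqrtr_sqr ger0_norm ?(ltW c0)//.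
by rewrite mulrC.
Qed.

Lemma type_I_scaled_metric (lo hi C e : R) (c : R -> R) (be : R -> 'rV[R]_m) :
  0 < lo -> 0 < e ->
  (forall p be, row_box lo hi be -> family_sqnorm g proj sigma (p, be) <= C) ->
  (forall t, 0 <= t -> [/\ 0 < c t, e * t <= c t & row_box lo hi (be t)]) ->
  type_I (fun t => scaled_metric g proj sigma (c t) (be t)).
Proof.
move=> lo0 e0 HC H; exists (Num.sqrt C / e), 0 => t t0.
have [ct0 et kb] := H t t0.
apply: (@le_trans _ _ (t%:E * (Num.sqrt C / c t)%:E)%E).
  apply: lee_wpmul2l; first by rewrite lee_fin.
  apply: ge_ereal_sup => _ [x _ <-]; rewrite lee_fin.
  rewrite (normRm_scaled_metric x ct0 (row_box_positive lo0 kb)).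
  by rewrite ler_pM2r ?invr_gt0//; apply: ler_wsqrtr; exact: HC.
rewrite lee_fin mulrCA; apply: ler_wpM2l; first exact: sqrtr_ge0.
by rewrite ler_pdivrMr// mulrC ler_pdivlMr// mulrC.
Qed.

(* The lower bound on the curvature turns |Rm| <= rho^-2 into rho <= C sqrt c, so
   it suffices to consider balls of radius at most e sqrt c. *)
Lemma noncollapsed_scaled_metric (lo hi de e : R) : 0 < lo -> 0 < de -> 0 < e ->
  (forall p be, row_box lo hi be -> de <= family_sqnorm g proj sigma (p, be)) ->
  (forall p, volume_bound g proj sigma lo hi e p) ->
  exists kappa : R, 0 < kappa /\ forall c be, 0 < c -> row_box lo hi be ->
    noncollapsed kappa (scaled_metric g proj sigma c be).
Proof.
(* The curvature norm is at least [sqrt de / c], so [|Rm| <= rho^-2] gives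
   [rho ^+ 2 * sqrt de <= c]; with the fourth root [s] of [de] this reads [s * rho <= sqrt c]. *)
move=> lo0 de0 e0 Hde Hvol; pose s := Num.sqrt (Num.sqrt de).
have s0 : 0 < s by rewrite !sqrtr_gt0.
have sE : s ^+ 2 = Num.sqrt de by rewrite sqr_sqrtr// sqrtr_ge0.
(* For large [rho] the ball of radius [rho1 = e * sqrt c >= e * s * rho] has volume at least [e]
   times the corresponding power of [rho1]. *)
pose k := e * (e * s) ^+ (\sum_i (n i + n i)).+1.
have k0 : 0 < k by rewrite mulr_gt0// exprn_gt0// mulr_gt0.
exists (Num.min e k); split; first by rewrite lt_min e0.
move=> c be c0 kb mu vmu x rho rho0 Hrm.
have kap : Num.min e k * rho ^+ (\sum_i (n i + n i)).+1 <= e * rho ^+ (\sum_i (n i + n i)).+1.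
  by apply: ler_wpM2r; [rewrite exprn_ge0// ltW|rewrite ge_min lexx].
have [rc|rc] := leP rho (Num.sqrt c * e).
  apply: le_trans (Hvol x be c rho mu kb c0 vmu rho0 rc).
  by rewrite lee_fin.
pose rho1 := Num.sqrt c * e; have sc0 : 0 < Num.sqrt c by rewrite sqrtr_gt0.
have rho10 : 0 < rho1 by rewrite mulr_gt0.
have xb : riem_ball (scaled_metric g proj sigma c be) x rho x.
  by apply/riem_ballP; exists 0 => //; exact: path_nil.
have := Hrm x xb; rewrite (normRm_scaled_metric x c0 (row_box_positive lo0 kb)) => Hx.
have Hs : s * rho <= Num.sqrt c.
  have H1 : Num.sqrt de / c <= (rho ^+ 2)^-1.
    apply: le_trans Hx; rewrite ler_pM2r ?invr_gt0//.
    by apply: ler_wsqrtr; exact: Hde.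
  rewrite ler_pdivrMr// mulrC ler_pdivlMr ?exprn_gt0// in H1.
  have sr0 : 0 <= s * rho by rewrite mulr_ge0// ltW.
  by rewrite -[leLHS](ger0_norm sr0) -sqrtr_sqr; apply: ler_wsqrtr; rewrite exprMn sE.
have mo (B : set P) : open B -> measurable (B : set (borel P)).
  by move=> oB; apply: sub_sigma_algebra.
have ob r := open_riem_ball hPm (tensor2_scaled_metric kM hP hsigma c be) x r.
apply: (@le_trans _ _ (mu (riem_ball (scaled_metric g proj sigma c be) x rho1))); last first.
  apply: le_measure; rewrite ?inE; [exact: mo (ob rho1)|exact: mo (ob rho)|].
  by move=> y; rewrite /riem_ball /= => /lt_trans; apply; rewrite lte_fin.
apply: le_trans (Hvol x be c rho1 mu kb c0 vmu rho10 (lexx _)).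
rewrite lee_fin; apply: (@le_trans _ _ (k * rho ^+ (\sum_i (n i + n i)).+1)).
  by apply: ler_wpM2r; [rewrite exprn_ge0// ltW|rewrite ge_min lexx orbT].
rewrite /k -mulrA -exprMn; apply: ler_wpM2l; first exact: ltW.
apply: lerXn2r; rewrite ?nnegrE; [by rewrite ltW// !mulr_gt0|exact: ltW|].
by rewrite -mulrA [leRHS]mulrC; apply: ler_wpM2l; first exact: ltW.
Qed.

End ScaledFamily.

Lemma indivisible_dim_gt0 (R : realType) k (N : charted R (k + k)) (w : field2 N) :
  smooth_manifold N -> connected [set: N] -> indivisible_integral w -> (0 < k)%N.
Proof.
case: k N w => [|//] N w sN cN iw.
by case: (dim0_not_indivisible (connected_dim0 sN cN) iw).
Qed.

Lemma index_of_neq (S : Type) m (y z : 'I_m -> S) : y <> z -> exists i0 : 'I_m, y i0 <> z i0.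
Proof.
by move=> yz; apply/not_existsP => H; apply: yz; apply/funext => i; exact: contrapT (H i).
Qed.

Section FlowBounds.
Context {R : realType} {m : nat} (n p : 'I_m -> nat) (q : 'I_m -> int).
Context (Y : R -> 'I_m -> R) (xi : 'I_m -> R).
Context (hY : flow_solution n p q Y) (xi0 : forall i, 0 < xi i).
Context (hlim : forall i, Y u i @[u --> +oo] --> xi i).

Lemma flow_bounds : exists lo hi : 'I_m -> R,
  forall i, [/\ 0 < lo i, 0 < hi i & forall u, 0 <= u -> lo i <= Y u i <= hi i].
Proof.
have [Y0 cY _] := hY.
have /choice[lo /choice[hi H]] i := positive_limit_bounds (cY i) (fun u => Y0 u i) (xi0 i) (@hlim i).
by exists lo, hi.
Qed.

Lemma inverse_row_box : exists lo hi : R, [/\ 0 < lo, lo <= hi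
  & forall u, 0 <= u -> row_box lo hi (\row_i (Y u i)^-1)].
Proof.
have [lo [hi H]] := flow_bounds.
(* The sums dominate every single bound; the summand 1 makes both numbers at least 1, so that
   [S^-1 <= T] holds for every [m]. *)
pose S := 1 + \sum_i hi i; pose T := 1 + \sum_i (lo i)^-1.
have hi0 i : 0 <= hi i by have [_ /ltW] := H i.
have lo0 i : 0 <= (lo i)^-1 by have [/ltW] := H i; rewrite invr_ge0.
have S1 : 1 <= S by rewrite lerDl sumr_ge0.
have T1 : 1 <= T by rewrite lerDl sumr_ge0.
have S0 : 0 < S by exact: lt_le_trans S1.
have hiS i : hi i <= S.
  by rewrite /S (bigD1 i)//= addrCA lerDl addr_ge0// sumr_ge0.
have loT i : (lo i)^-1 <= T.
  by rewrite /T (bigD1 i)//= addrCA lerDl addr_ge0// sumr_ge0.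
exists S^-1, T; split=> [||u u0 i]; first by rewrite invr_gt0.
  by apply: le_trans T1; rewrite invf_le1.
have [l0 h0 /(_ u u0)/andP[lY Yh]] := H i; have Y0 := lt_le_trans l0 lY.
rewrite mxE /= in_itv /=; apply/andP; split.
  by rewrite lef_pV2 ?posrE//; exact: le_trans Yh (hiS i).
by apply: le_trans (loT i); rewrite lef_pV2 ?posrE.
Qed.

Lemma flowE_continuous : {within `[0, +oo[, continuous (fun u => flowE n q (Y u))}.
Proof.
have [_ cY _] := hY; move=> x; apply: cvg_sumr => i _.
have ch : continuous (fun y : R => (n i)%:R * (q i)%:~R ^+ 2 * y ^+ 2).
  by move=> y; apply: cvgM; [exact: cvg_cst|exact: exprn_continuous].
exact: (continuous_postcomp (cY i) ch).
Qed.

Lemma flowE_lower_bound i0 : (0 < n i0)%N -> q i0 != 0 ->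
  exists2 e, 0 < e & forall u, 0 <= u -> e <= flowE n q (Y u).
Proof.
move=> n0 q0; have [lo [hi H]] := flow_bounds; have [l0 _ Hl] := H i0.
exists ((n i0)%:R * (q i0)%:~R ^+ 2 * lo i0 ^+ 2).
  apply: mulr_gt0; last exact: exprn_gt0.
  by apply: mulr_gt0; [rewrite ltr0n|rewrite exprn_even_gt0//= intr_eq0].
move=> u u0; rewrite /flowE (bigD1 i0)//=; have /andP[lY _] := Hl u u0.
apply: (@le_trans _ _ ((n i0)%:R * (q i0)%:~R ^+ 2 * Y u i0 ^+ 2)).
  apply: ler_wpM2l; first by rewrite mulr_ge0 ?sqr_ge0.
  by apply: lerXn2r; rewrite ?nnegrE; [exact: ltW|exact: le_trans (ltW l0) lY|].
by rewrite lerDl sumr_ge0// => i _; do 2 rewrite mulr_ge0 ?sqr_ge0//.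
Qed.

End FlowBounds.

Theorem theorem3p11 (R : realType) (m : nat)
  (n p : 'I_m -> nat) (q : 'I_m -> int)
  (M : forall i : 'I_m, charted R (n i + n i))
  (g : forall i : 'I_m, field2 (M i))
  (hp : forall i, (0 < p i)%N)
  (hM : forall i, compact_kaehler_einstein (g i) (p i)%:R)
  (homega : forall i, indivisible_integral
     (fun al x => (2 * pi)^-1 *: kaehler_form (g i) al x))
  (hq : forall i, q i != 0)
  (P : charted R (\sum_i (n i + n i)).+1)
  (proj : P -> prodn M) (act : R -> P -> P) (sigma : field1 P)
  (hP : principal_circle_bundle proj act)
  (hsigma : principal_connection act sigma)
  (hcurv : has_curvature g q proj sigma)
  (xi : 'I_m -> R)
  (hxi : forall i, 0 < xi i /\ flowF n p q i xi = 0)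
  (Y : R -> 'I_m -> R)
  (hY : flow_solution n p q Y)
  (hnonconst : exists u v, [/\ 0 <= u, 0 <= v & Y u <> Y v])
  (hlim : forall i, Y u i @[u --> +oo] --> xi i)
  (a : R -> R) (b : 'I_m -> R -> R)
  (hab : corresponding n q Y a b) :
  type_I (fun tau => bundle_metric g proj sigma (a tau) (b ^~ tau)) /\
  exists kappa : R, 0 < kappa /\
    forall tau, 0 <= tau ->
      noncollapsed kappa (bundle_metric g proj sigma (a tau) (b ^~ tau)).
Proof.
have kM i : kaehler (g i) by case: (hM i).
have cM i : compact [set: M i] by case: (hM i).
have n0 i : (0 < n i)%N.
  have [[[sM _] _ _ _] _ coM _] := hM i.
  exact: indivisible_dim_gt0 sM coM (homega i).
(* Two different values of [Y] differ at some index, which shows in particular that m is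
   positive. *)
have [i0 _] : exists i0 : 'I_m, true.
  by case: hnonconst => u [v [_ _ /index_of_neq[i0 _]]]; exists i0.
have cpt : compact [set: P] by exact: (compact_total_space hP).
have xi0 i : 0 < xi i by case: (hxi i).
have [lo [hi [lo0 lohi Hbox]]] := inverse_row_box hY xi0 hlim.
have [de [C [de0 HC]]] := family_sqnorm_bounds kM hP hsigma hcurv cpt (n0 i0) hq lo0 lohi.
have [e e0 Hvol] := volume_bound_uniform kM hP hsigma cpt lo0 lohi.
have [f f0 Hf] := flowE_lower_bound hY xi0 hlim (n0 i0) (hq i0).
have cE := flowE_continuous hY.
have [a0 Hab] := hab.
(* A choice of the parameter [u] for each time; for negative times it is the irrelevant value 0. *)
have /choice[u Hu] t : exists u, 0 <= t -> 0 <= u /\ back_time n q (a 0) Y u = t.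
  have [t0|] := boolP (0 <= t); last by exists 0.
  by have [u u0 ut] := growth_time_surj cE f0 Hf a0 t0; exists u.
pose be t : 'rV[R]_m := \row_i (Y (u t) i)^-1.
have metricE t : 0 <= t ->
    bundle_metric g proj sigma (a t) (b ^~ t) = scaled_metric g proj sigma (a t) (be t).
  move=> /Hu[u0 ut]; rewrite scaled_metricE; congr bundle_metric; apply/funext => i.
  by have [aE bE] := Hab _ u0; have := bE i; rewrite -aE ut mxE.
have aP t : 0 <= t -> [/\ 0 < a t, f * t <= a t & row_box lo hi (be t)].
  move=> /Hu[u0 ut]; have aE : a t = fiber_scale n q (a 0) Y (u t).
    by have [<- _] := Hab _ u0; rewrite ut.
  rewrite aE; split; last exact: Hbox.
    by rewrite /fiber_scale mulr_gt0// expR_gt0.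
  have : f * back_time n q (a 0) Y (u t) <= fiber_scale n q (a 0) Y (u t).
    exact: (growth_time_le cE Hf a0 u0).
  by rewrite ut.
split.
  have [C1 [t0 H]] := type_I_scaled_metric kM hP hsigma lo0 f0 (fun p be kb => (andP (HC p be kb)).2) aP.
  (* The metric agrees with the rescaled family only for t >= 0, hence the maximum. *)
  exists C1, (Num.max 0 t0) => t; rewrite ge_max => /andP[t1 /H].
  by rewrite metricE.
have [k [k0 Hk]] := noncollapsed_scaled_metric kM hP hsigma lo0 de0 e0
  (fun p be kb => (andP (HC p be kb)).1) Hvol.
exists k; split=> // t t0; have [at0 _ kb] := aP t t0.
by rewrite (metricE t t0); exact: Hk.
Qed.
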